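(* Let $g$ satisfy (KPP$_g$) and $f$ satisfy (KPP$_f$). For every continuous, bounded, non-negative initial datum $(u_0,v_0)\not\equiv(0,0)$, the solution $(u,v)$ of problem (H) satisfies $\lim_{t\to+\infty}(u,v)=(U,V)$ locally uniformly in each domain, where $(U,V)$ is the unique positive bounded steady state of (H) depending only on $x_N$.
   Context: Problem (H) ($N\geq2$, $D,d,\mu,\nu>0$): $u_t-D\Delta u=g(u)$ in $\{x_N<0\}\times(0,\infty)$, $v_t-d\Delta v=f(v)$ in $\{x_N>0\}\times(0,\infty)$, $D\partial_{x_N}u=\nu v-\mu u$ and $-d\partial_{x_N}v=\mu u-\nu v$ on $\{x_N=0\}\times(0,\infty)$. (KPP$_g$): $g$ locally Lipschitz, differentiable at $0$, $g(0)=g(1)=0$, $0<g(s)\leq g'(0)s$ on $(0,1)$, $g(s)<0$ for $s>1$. (KPP$_f$): for some $S>0$, $f$ locally Lipschitz, differentiable at $0$, $f(0)=f(S)=0$, $0<f(s)\leq f'(0)s$ on $(0,S)$, $f(s)<0$ for $s>S$. *)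

(* Defs.v *)
From Stdlib Require Import Reals.
From mathcomp Require Import ssreflect ssrfun ssrbool eqtype ssrnat fintype bigop.
Open Scope R_scope.

(* A point of R^N is written (y, z) with y : 'I_(N.-1) -> R the tangential
   coordinates x_1..x_{N-1} and z = x_N the normal coordinate. *)
Definition Pt (N : nat) := 'I_(N.-1) -> R.

Definition upd {N : nat} (y : Pt N) (i : 'I_(N.-1)) (s : R) : Pt N :=
  fun j => if eq_op j i then s else y j.

Definition sumI {n : nat} (a : 'I_n -> R) : R := \big[Rplus/0]_(i < n) a i.

Definition loc_lipschitz (h : R -> R) : Prop :=
  forall K, 0 < K -> exists L, forall a b, Rabs a <= K -> Rabs b <= K ->
    Rabs (h a - h b) <= L * Rabs (a - b).

Definition KPP_g (g : R -> R) : Prop :=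
  loc_lipschitz g /\
  exists g0, derivable_pt_lim g 0 g0 /\
  g 0 = 0 /\ g 1 = 0 /\
  (forall s, 0 < s < 1 -> 0 < g s <= g0 * s) /\
  (forall s, 1 < s -> g s < 0).

Definition KPP_f (f : R -> R) : Prop :=
  exists S, 0 < S /\ loc_lipschitz f /\
  exists f0, derivable_pt_lim f 0 f0 /\
  f 0 = 0 /\ f S = 0 /\
  (forall s, 0 < s < S -> 0 < f s <= f0 * s) /\
  (forall s, S < s -> f s < 0).

Definition lderiv (h : R -> R) (x l : R) : Prop :=
  forall eps, 0 < eps -> exists delta, 0 < delta /\
    forall k, - delta < k < 0 -> Rabs ((h (x + k) - h x) / k - l) < eps.
Definition rderiv (h : R -> R) (x l : R) : Prop :=
  forall eps, 0 < eps -> exists delta, 0 < delta /\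
    forall k, 0 < k < delta -> Rabs ((h (x + k) - h x) / k - l) < eps.

Definition second_deriv (h : R -> R) (x l : R) : Prop :=
  exists h' : R -> R, (exists delta, 0 < delta /\
     forall s, Rabs (s - x) < delta -> derivable_pt_lim h s (h' s)) /\
  derivable_pt_lim h' x l.

Definition cont_on3 {N : nat} (P : Pt N -> R -> R -> Prop) (w : Pt N -> R -> R -> R) : Prop :=
  forall y z t, P y z t -> forall eps, 0 < eps -> exists delta, 0 < delta /\
    forall y' z' t', P y' z' t' -> (forall i, Rabs (y' i - y i) < delta) ->
      Rabs (z' - z) < delta -> Rabs (t' - t) < delta ->
      Rabs (w y' z' t' - w y z t) < eps.

Definition cont_on2 {N : nat} (P : Pt N -> R -> Prop) (w : Pt N -> R -> R) : Prop :=
  forall y z, P y z -> forall eps, 0 < eps -> exists delta, 0 < delta /\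
    forall y' z', P y' z' -> (forall i, Rabs (y' i - y i) < delta) ->
      Rabs (z' - z) < delta -> Rabs (w y' z' - w y z) < eps.

Definition initial_datum (N : nat) (u0 v0 : Pt N -> R -> R) : Prop :=
  cont_on2 (fun _ z => z <= 0) u0 /\ cont_on2 (fun _ z => 0 <= z) v0 /\
  (exists M, forall y z, z <= 0 -> Rabs (u0 y z) <= M) /\
  (exists M, forall y z, 0 <= z -> Rabs (v0 y z) <= M) /\
  (forall y z, z <= 0 -> 0 <= u0 y z) /\
  (forall y z, 0 <= z -> 0 <= v0 y z) /\
  ((exists y z, z <= 0 /\ u0 y z <> 0) \/ (exists y z, 0 <= z /\ v0 y z <> 0)).

Definition solution_H (N : nat) (D d mu nu : R) (g f : R -> R)
    (u0 v0 : Pt N -> R -> R) (u v : Pt N -> R -> R -> R) : Prop :=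
  cont_on3 (fun _ z t => z <= 0 /\ 0 <= t) u /\
  cont_on3 (fun _ z t => 0 <= z /\ 0 <= t) v /\
  (forall T, 0 < T -> exists M, forall y z t, z <= 0 -> 0 <= t <= T -> Rabs (u y z t) <= M) /\
  (forall T, 0 < T -> exists M, forall y z t, 0 <= z -> 0 <= t <= T -> Rabs (v y z t) <= M) /\
  (forall y z, z <= 0 -> u y z 0 = u0 y z) /\
  (forall y z, 0 <= z -> v y z 0 = v0 y z) /\
  (forall y z t, z < 0 -> 0 < t -> exists (c : R) (a : 'I_(N.-1) -> R) (b : R),
      derivable_pt_lim (fun s => u y z s) t c /\
      (forall i, second_deriv (fun s => u (upd y i s) z t) (y i) (a i)) /\
      second_deriv (fun s => u y s t) z b /\
      c - D * (sumI a + b) = g (u y z t)) /\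
  (forall y z t, 0 < z -> 0 < t -> exists (c : R) (a : 'I_(N.-1) -> R) (b : R),
      derivable_pt_lim (fun s => v y z s) t c /\
      (forall i, second_deriv (fun s => v (upd y i s) z t) (y i) (a i)) /\
      second_deriv (fun s => v y s t) z b /\
      c - d * (sumI a + b) = f (v y z t)) /\
  (forall y t, 0 < t -> exists l, lderiv (fun s => u y s t) 0 l /\
      D * l = nu * v y 0 t - mu * u y 0 t) /\
  (forall y t, 0 < t -> exists l, rderiv (fun s => v y s t) 0 l /\
      - d * l = mu * u y 0 t - nu * v y 0 t).

Definition steady_1d (D d mu nu : R) (g f : R -> R) (U V : R -> R) : Prop :=
  (forall z, z < 0 -> exists a, second_deriv U z a /\ - D * a = g (U z)) /\
  (forall z, 0 < z -> exists a, second_deriv V z a /\ - d * a = f (V z)) /\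
  (exists l, lderiv U 0 l /\ D * l = nu * V 0 - mu * U 0) /\
  (exists l, rderiv V 0 l /\ - d * l = mu * U 0 - nu * V 0) /\
  (forall z, z <= 0 -> 0 < U z) /\ (forall z, 0 <= z -> 0 < V z) /\
  (exists M, forall z, z <= 0 -> U z <= M) /\
  (exists M, forall z, 0 <= z -> V z <= M).

Definition conv_loc_unif (N : nat) (u v : Pt N -> R -> R -> R) (U V : R -> R) : Prop :=
  forall K eps, 0 < K -> 0 < eps -> exists T, forall t, T <= t ->
    (forall y z, z <= 0 -> (forall i, Rabs (y i) <= K) -> Rabs z <= K ->
       Rabs (u y z t - U z) < eps) /\
    (forall y z, 0 <= z -> (forall i, Rabs (y i) <= K) -> Rabs z <= K ->
       Rabs (v y z t - V z) < eps).

(* Main.v *)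
Require Import Defs.
From HB Require Import structures.
From Stdlib Require Import Reals Lra Lia List Classical FunctionalExtensionality.
From Stdlib Require Import IndefiniteDescription.
From Coquelicot Require Import Coquelicot.
From mathcomp Require Import ssreflect ssrfun ssrbool eqtype ssrnat fintype bigop.
Open Scope R_scope.

(* No solution of the parabolic problem is ever constructed: the given solution is
   trapped between stationary strict sub- and supersolutions by the maximum principle.

   Fold both half spaces onto [0 <= z] and rescale, so that the exchange condition reads
   [kap_b * dw_b/dz = w_b - w_(1-b)].  A strict stationary subsolution [A(z)] with a
   uniform margin can be pushed: if [w >= A - del] on a cone [|x| <= c t], then
   [w >= A] on a thinner cone.  Hence along a continuous family of strict
   subsolutions the bound [w >= A_s] propagates from [s = 0] to [s = 1].

   Replace the nonlinearities by slightly smaller ones, with zeros [e'_b] slightly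
   smaller than those of [h_b].  The one-dimensional profiles tending to [e'_b] satisfy
   [A' = - speed(A)] with [speed] increasing; they are determined by [A(0) = p], form a
   contraction in [p], and the exchange condition becomes an inequality between the two
   boundary values, valid along a curve from [-oo] up to almost the boundary values of
   [(U, V)].  This bounds the solution from below by almost [(U, V)]; the bound from above
   is the same statement for [-w].  To start the family one needs a positive lower
   bound on a cone, which follows from explicit moving subsolutions supported in balls
   and a layer carrying positivity across the interface.

   Uniqueness of [(U, V)] follows since any steady state is itself a solution. *)

(** The attained minimum of a continuous function on a compact box is the only tool applied to the
    parabolic problem: no regularity estimate, Harnack inequality or strong maximum principle
    enters. Hence each barrier must satisfy its inequalities strictly and must lie below the
    solution on the lateral sides of some box, and the margins must be uniform in [z]. The limiting
    profile itself has no margin. A profile tending to [e'_b < e_b] has one, because [h_b] exceeds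
    the smaller nonlinearity by a positive constant, also far from the interface, where the profile
    is flat. Bounds are kept on cones [|x| <= c t] because the datum may have bounded support, and
    because the paraboloid that closes a barrier laterally is flat enough only on sets that grow
    with time; a push may lower [c] but keeps it positive. Profiles are handled by a first-order
    equation because [speed] is increasing: two such flows separate at most linearly in [z], which
    gives stability under small changes of the nonlinearity and of the boundary value. *)

HB.instance Definition _ :=
  Monoid.isComLaw.Build R 0 Rplus
    (fun x y z => Logic.eq_sym (Rplus_assoc x y z)) Rplus_comm Rplus_0_l.

Ltac rabs :=
  repeat match goal with
  | H : Rabs _ < _ |- _ => apply Rabs_def2 in H; destruct H
  | H : Rabs _ <= _ |- _ => apply Rabs_le_between in H; destruct H
  end;
  try (apply Rabs_def1); try (apply Rabs_le; split); lra.

(** * Finite sums over the tangential coordinates *)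

Lemma sumI_const n (c : R) : sumI (fun _ : 'I_n => c) = INR n * c.
Proof.
elim: n => [|n IH]; first by rewrite /sumI big_ord0 /=; lra.
move: IH; rewrite /sumI big_ord_recl => ->; rewrite S_INR; ring.
Qed.

Lemma sumI_ext n (a b : 'I_n -> R) : (forall i, a i = b i) -> sumI a = sumI b.
Proof. by move=> H; apply: eq_bigr => i _. Qed.

Lemma sumI_plus n (a b : 'I_n -> R) : sumI (fun i => a i + b i) = sumI a + sumI b.
Proof. exact: big_split. Qed.

Lemma sumI_scale n (c : R) (a : 'I_n -> R) : sumI (fun i => c * a i) = c * sumI a.
Proof.
rewrite /sumI; elim: n a => [|n IH] a; first by rewrite !big_ord0; lra.
rewrite !big_ord_recl IH; ring.
Qed.

Lemma sumI_le n (a b : 'I_n -> R) : (forall i, a i <= b i) -> sumI a <= sumI b.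
Proof.
move=> H; rewrite /sumI; elim: n a b H => [|n IH] a b H; first by rewrite !big_ord0; lra.
rewrite !big_ord_recl; apply: Rplus_le_compat; first exact: H.
by apply: IH => i; apply: H.
Qed.

Lemma sumI_ge0 n (a : 'I_n -> R) : (forall i, 0 <= a i) -> 0 <= sumI a.
Proof. by move=> H; have := sumI_le _ (fun _ => 0) a H; rewrite sumI_const; lra. Qed.

Lemma sumI_upd {N} (F : 'I_(N.-1) -> R -> R) (y : Pt N) i s :
  sumI (fun j => F j (upd y i s j)) = sumI (fun j => F j (y j)) - F i (y i) + F i s.
Proof.
rewrite /sumI (bigD1 i) //= [in RHS](bigD1 i) //= {1}/upd eq_refl.
rewrite [X in _ + X = _](eq_bigr (fun j => F j (y j))); last first.
  by move=> j /negbTE ji; rewrite /upd ji.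
lra.
Qed.

Lemma sumI_ge_term n (a : 'I_n -> R) i : (forall j, 0 <= a j) -> a i <= sumI a.
Proof.
move=> H; elim: n a i H => [|n IH] a i H; first by case: i.
rewrite /sumI big_ord_recl -/(sumI (fun j : 'I_n => a (lift ord0 j))).
case: (unliftP ord0 i) => [j ->|->].
- by have := IH (fun j => a (lift ord0 j)) j (fun j => H _); have := H ord0; lra.
- by have := sumI_ge0 _ (fun j : 'I_n => a (lift ord0 j)) (fun j => H _); lra.
Qed.

Lemma upd_id {N} (y : Pt N) i : upd y i (y i) = y.
Proof. by apply: functional_extensionality => j; rewrite /upd; case: eqP => [->|]. Qed.

(** * Derivative tests at a minimum *)

Lemma interior_min_deriv0 (h : R -> R) x l :
  derivable_pt_lim h x l ->
  (exists delta, 0 < delta /\ forall s, Rabs (s - x) < delta -> h x <= h s) -> l = 0.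
Proof.
move=> hd [delta [d0 hm]].
case: (Req_dec l 0) => // l0; exfalso.
have l1 : 0 < Rabs l by apply: Rabs_pos_lt.
have [[e e0] /= He] := hd (Rabs l) l1.
pose k := Rmin delta e / 2.
have k0 : 0 < k by rewrite /k; have := Rmin_pos _ _ d0 e0; lra.
have kd : k < delta by rewrite /k; have := Rmin_l delta e; rewrite /k in k0; lra.
have ke : k < e by rewrite /k; have := Rmin_r delta e; rewrite /k in k0; lra.
case: (Rlt_dec 0 l) => lp.
- have H1 := He (- k) ltac:(lra) ltac:(rewrite Rabs_left; lra).
  have H2 := hm (x + - k) ltac:(rewrite Rabs_left; lra).
  rewrite (Rabs_right l) in H1; last lra.
  have H3 : (h (x + - k) - h x) / - k <= 0.
    have ? : / - k < 0 by apply: Rinv_lt_0_compat; lra.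
    rewrite /Rdiv; nra.
  rewrite Rabs_left in H1; last lra.
  lra.
- have H1 := He k ltac:(lra) ltac:(rewrite Rabs_right; lra).
  have H2 := hm (x + k) ltac:(rewrite Rabs_right; lra).
  rewrite (Rabs_left l) in H1; last lra.
  have H3 : 0 <= (h (x + k) - h x) / k.
    by apply: Rdiv_le_0_compat; lra.
  rewrite Rabs_right in H1; last lra.
  lra.
Qed.

(** The derivative [h'] vanishes at [x], so a negative [l] would make [h'] negative just to the
    right of [x]; by the mean value theorem [h] would drop below [h x] there. *)
Lemma second_deriv_min (h : R -> R) x l :
  second_deriv h x l ->
  (exists delta, 0 < delta /\ forall s, Rabs (s - x) < delta -> h x <= h s) -> 0 <= l.
Proof.
move=> [h' [[d1 [d10 hd1]] hl]] [d2 [d20 hm]].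
have h'x : h' x = 0.
  apply: (interior_min_deriv0 h x); last by exists d2.
  by apply: hd1; rewrite Rminus_diag Rabs_R0.
case: (Rle_dec 0 l) => // /Rnot_le_lt l0; exfalso.
have [[e e0] /= He] := hl (- l) ltac:(lra).
pose m := Rmin (Rmin d1 d2) e.
have m0 : 0 < m by rewrite /m; do 2 apply: Rmin_pos => //.
have [m1 [m2 m3]] : m <= d1 /\ m <= d2 /\ m <= e.
  rewrite /m; have := Rmin_l (Rmin d1 d2) e; have := Rmin_r (Rmin d1 d2) e.
  have := Rmin_l d1 d2; have := Rmin_r d1 d2; lra.
pose k := m / 2.
have k0 : 0 < k by rewrite /k; lra.
have km : k < m by rewrite /k; lra.
have [c [c1 c2]] := MVT_cor2 h h' x (x + k) ltac:(lra)
  ltac:(move=> s hs; apply: hd1; rewrite Rabs_right; lra).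
have H2 := hm (x + k) ltac:(rewrite Rabs_right; lra).
have h'c : 0 <= h' c by nra.
have H4 := He (c - x) ltac:(lra) ltac:(rewrite Rabs_right; lra).
rewrite (_ : x + (c - x) = c) in H4; last ring.
rewrite h'x in H4.
have H5 : 0 <= (h' c - 0) / (c - x) by apply: Rdiv_le_0_compat; lra.
rewrite Rabs_right in H4; lra.
Qed.

(** * Compactness of boxes, transported from iterated pairs to functions on ['I_n] *)

Fixpoint tuple_of_fun (n : nat) : ('I_n -> R) -> Tn n R :=
  match n with
  | O => fun _ => tt
  | S m => fun y => (y ord0, tuple_of_fun m (fun i => y (lift ord0 i)))
  end.

Fixpoint fun_of_tuple (n : nat) : Tn n R -> 'I_n -> R :=
  match n with
  | O => fun _ _ => 0
  | S m => fun x i => if unlift ord0 i is Some j then fun_of_tuple m x.2 j else x.1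
  end.

Lemma bounded_n_box n (M : R) (x : Tn n R) :
  bounded_n n (tuple_of_fun n (fun _ => - M)) (tuple_of_fun n (fun _ => M)) x <->
  forall i, Rabs (fun_of_tuple n x i) <= M.
Proof.
elim: n x => [|n IH] /= x; first by split => // _ [].
case: x => x1 x2 /=; rewrite IH; split.
- move=> [[h1 h2] h3] i; case: (unlift ord0 i) => [j|]; first exact: h3.
  exact: Rabs_le.
- move=> h; split.
    by have := h ord0; rewrite unlift_none => /Rabs_le_between.
  by move=> i; have := h (lift ord0 i); rewrite liftK.
Qed.

Lemma close_n_fun n d (x t : Tn n R) :
  close_n n d x t -> forall i, Rabs (fun_of_tuple n x i - fun_of_tuple n t i) < d.
Proof.
elim: n x t => [|n IH] x t; first by move=> _ [].
case: x => x1 x2; case: t => t1 t2 /= [h1 h2] i.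
by case: (unlift ord0 i) => [j|//]; apply: IH.
Qed.

Lemma tuple_of_funK n (y : 'I_n -> R) i : fun_of_tuple n (tuple_of_fun n y) i = y i.
Proof.
elim: n y i => [|n IH] y i /=; first by case: i.
by case: (unliftP ord0 i) => [j ->|-> //]; rewrite IH.
Qed.

Definition in_box {N} (M z1 z2 t1 t2 : R) (y : Pt N) (z t : R) : Prop :=
  (forall i, Rabs (y i) <= M) /\ z1 <= z <= z2 /\ t1 <= t <= t2.

Lemma list_min {T : Type} (Q : T -> Prop) (val : T -> R) (l : list T) x0 :
  In x0 l -> Q x0 ->
  exists x, In x l /\ Q x /\ forall x', In x' l -> Q x' -> val x <= val x'.
Proof.
elim: l x0 => [//|a l IH] x0 hin hq.
case: (classic (exists x, In x l /\ Q x)) => [[x [xl xq]]|hno].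
- have [m [ml [mq mm]]] := IH x xl xq.
  case: (classic (Q a /\ val a < val m)) => [[qa am]|na].
  + exists a; split; first by left.
    split=> // x' [<-|x'l] qx'; first lra.
    by have := mm x' x'l qx'; lra.
  + exists m; split; first by right.
    split=> // x' [ax'|x'l] qx'; last exact: mm.
    by apply: Rnot_lt_le => h; apply: na; rewrite ax'.
- exists a; case: hin => [ax0|hin]; last by case: hno; exists x0.
  rewrite ax0; split; first by left.
  split=> // x' [<-|x'l] qx'; first lra.
  by case: hno; exists x'.
Qed.

(** If no minimum were attained, each point of the box would have a neighbourhood on which [F]
    exceeds a smaller value that it takes elsewhere in the box. Finitely many neighbourhoods cover
    the box; the point that takes the least of the attached values lies in one of them, a
    contradiction. *)
Lemma box_min {N} (P : Pt N -> R -> R -> Prop) (F : Pt N -> R -> R -> R) M z1 z2 t1 t2 :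
  cont_on3 P F -> (forall y z t, in_box M z1 z2 t1 t2 y z t -> P y z t) ->
  0 <= M -> z1 <= z2 -> t1 <= t2 ->
  exists y0 z0 t0, in_box M z1 z2 t1 t2 y0 z0 t0 /\
    forall y z t, in_box M z1 z2 t1 t2 y z t -> F y0 z0 t0 <= F y z t.
Proof.
move=> Fc BP M0 z12 t12.
apply: NNPP => hno.
pose n := N.-1.
pose T := Tn n.+2 R.
pose dec (x : T) : Pt N * R * R := (fun_of_tuple n x.2.2, x.1, x.2.1).
pose B (x : T) := in_box M z1 z2 t1 t2 (dec x).1.1 (dec x).1.2 (dec x).2.
pose G (x : T) := F (dec x).1.1 (dec x).1.2 (dec x).2.
have pick (x : T) : exists p : posreal * R, B x ->
   (exists y z t, in_box M z1 z2 t1 t2 y z t /\ F y z t = p.2) /\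
   (forall y z t, in_box M z1 z2 t1 t2 y z t ->
      (forall i, Rabs (y i - (dec x).1.1 i) < p.1) -> Rabs (z - (dec x).1.2) < p.1 ->
      Rabs (t - (dec x).2) < p.1 -> p.2 < F y z t).
  (* Outside the box any pair will do: the choice function has to be total, and the guard [B x]
     discards these points. *)
  case: (classic (B x)) => [bx|nbx]; last by exists (mkposreal 1 Rlt_0_1, 0).
  have [y [z [t [b lt]]]] : exists y z t, in_box M z1 z2 t1 t2 y z t /\ F y z t < G x.
    apply: NNPP => hn; apply: hno; exists (dec x).1.1, (dec x).1.2, (dec x).2.
    split=> // y z t b; apply: Rnot_lt_le => lt; apply: hn; by exists y, z, t.
  have [d [d0 hd]] := Fc _ _ _ (BP _ _ _ bx) (G x - F y z t) ltac:(lra).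
  exists (mkposreal d d0, F y z t) => _ /=; split; first by exists y, z, t.
  move=> y' z' t' b' c1 c2 c3.
  have := hd y' z' t' (BP _ _ _ b') c1 c2 c3.
  by move/Rabs_lt_between => [h1 h2]; rewrite /G in h1 h2 lt *; lra.
have [p hp] := functional_choice _ pick.
apply: (compactness_list n.+2
   (z1, (t1, tuple_of_fun n (fun _ => - M))) (z2, (t2, tuple_of_fun n (fun _ => M)))
   (fun x => (p x).1)) => -[l hl].
have bnd (x : T) : bounded_n n.+2
   (z1, (t1, tuple_of_fun n (fun _ => - M))) (z2, (t2, tuple_of_fun n (fun _ => M))) x <-> B x.
  case: x => x1 [x2 x3] /=; rewrite bounded_n_box /B /in_box /=; tauto.
have cover y z t : in_box M z1 z2 t1 t2 y z t -> exists x, In x l /\ B x /\ (p x).2 < F y z t.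
  move=> b.
  have [|x [xl [/bnd xb /= xc]]] := hl (z, (t, tuple_of_fun n y)).
    apply/bnd; case: b => b1 b2; split=> //= i; by rewrite tuple_of_funK.
  exists x; split=> //; split=> //.
  case: x xl xb xc => x1 [x2 x3] xl xb [c1 [c2 c3]].
  apply: (proj2 (hp _ xb)) => //= i.
  by have := close_n_fun _ _ _ _ c3 i; rewrite tuple_of_funK.
have [x0 [x0l [x0b _]]] : exists x, In x l /\ B x /\ (p x).2 < F (fun _ => 0) z1 t1.
  apply: cover; split; first by move=> i; rewrite Rabs_R0.
  split; lra.
have [x [xl [xb xm]]] := list_min B (fun x => (p x).2) l x0 x0l x0b.
have [[y [z [t [b e]]]] _] := hp x xb.
have [x' [x'l [x'b lt]]] := cover y z t b.
by have := xm x' x'l x'b; lra.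
Qed.

(** * Comparison principle *)

Lemma second_deriv_minus (f g : R -> R) x a b :
  second_deriv f x a -> second_deriv g x b -> second_deriv (fun s => f s - g s) x (a - b).
Proof.
move=> [f' [[d1 [d10 h1]] hf]] [g' [[d2 [d20 h2]] hg]].
exists (fun s => f' s - g' s); split; last exact: derivable_pt_lim_minus.
exists (Rmin d1 d2); split; first exact: Rmin_pos.
move=> s hs; apply: derivable_pt_lim_minus.
- by apply: h1; apply: Rlt_le_trans hs (Rmin_l _ _).
- by apply: h2; apply: Rlt_le_trans hs (Rmin_r _ _).
Qed.

Lemma rderiv_minus (f g : R -> R) x a b :
  rderiv f x a -> rderiv g x b -> rderiv (fun s => f s - g s) x (a - b).
Proof.
move=> hf hg e e0.
have [d1 [d10 h1]] := hf (e / 2) ltac:(lra).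
have [d2 [d20 h2]] := hg (e / 2) ltac:(lra).
exists (Rmin d1 d2); split; first exact: Rmin_pos.
move=> k hk; have m1 := Rmin_l d1 d2; have m2 := Rmin_r d1 d2.
have := h1 k ltac:(lra); have := h2 k ltac:(lra).
have -> : (f (x + k) - g (x + k) - (f x - g x)) / k - (a - b) =
  ((f (x + k) - f x) / k - a) - ((g (x + k) - g x) / k - b) by field; lra.
by move=> q1 q2; rabs.
Qed.

Lemma rderiv_ge0 (f : R -> R) x l :
  rderiv f x l ->
  (exists delta, 0 < delta /\ forall k, 0 < k < delta -> f x <= f (x + k)) -> 0 <= l.
Proof.
move=> hf [d [d0 hm]]; apply: Rnot_lt_le => l0.
have [e [e0 he]] := hf (- l) ltac:(lra).
pose k := Rmin d e / 2.
have := Rmin_pos _ _ d0 e0; have := Rmin_l d e; have := Rmin_r d e => m1 m2 m3.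
have := he k ltac:(rewrite /k; lra).
have : 0 <= (f (x + k) - f x) / k.
  by apply: Rdiv_le_0_compat; [have := hm k ltac:(rewrite /k; lra); lra|rewrite /k; lra].
by move=> h /Rabs_lt_between; lra.
Qed.

(** Only earlier times are compared, since the minimum over a box may sit at its final time. The
    weighted function has derivative [exp (- lam t) (c - lam X)], which cannot be positive at a
    minimum from the left. *)
Lemma derivable_pt_lim_left_min (X : R -> R) lam t c :
  derivable_pt_lim X t c ->
  (exists delta, 0 < delta /\ forall s, t - delta < s < t ->
     exp (- lam * t) * X t <= exp (- lam * s) * X s) ->
  c <= lam * X t.
Proof.
move=> hX [d [d0 hm]].
have hE : derivable_pt_lim (fun s => exp (- lam * s) * X s) t
    (exp (- lam * t) * (c - lam * X t)).
  apply/is_derive_Reals.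
  have hX' : is_derive X t c by apply/is_derive_Reals.
  evar_last; first apply: (is_derive_mult (fun s => exp (- lam * s)) X t).
  - by auto_derive; [done | reflexivity].
  - exact: hX'.
  - by move=> *; apply: Rmult_comm.
  - by rewrite /plus /mult /=; ring.
apply: Rnot_lt_le => hc.
have ep := exp_pos (- lam * t).
have l0 : 0 < exp (- lam * t) * (c - lam * X t) by apply: Rmult_lt_0_compat; lra.
have [[e e0] /= he] := hE _ l0.
pose k := Rmin d e / 2.
have := Rmin_pos _ _ d0 e0; have := Rmin_l d e; have := Rmin_r d e => m1 m2 m3.
have k0 : 0 < k by rewrite /k; lra.
have := he (- k) ltac:(lra) ltac:(rewrite Rabs_left /k; lra).
have h1 := hm (t + - k) ltac:(rewrite /k; lra).
set Y := (_ / - k).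
have : Y <= 0.
  have -> : Y = - ((exp (- lam * (t + - k)) * X (t + - k) - exp (- lam * t) * X t) / k).
    by rewrite /Y; field; lra.
  have : 0 <= (exp (- lam * (t + - k)) * X (t + - k) - exp (- lam * t) * X t) / k.
    by apply: Rdiv_le_0_compat; lra.
  lra.
by move=> h2 /Rabs_lt_between; lra.
Qed.

Lemma cont_on3_const {N} (P : Pt N -> R -> R -> Prop) c : cont_on3 P (fun _ _ _ => c).
Proof.
move=> y z t _ e e0; exists 1; split; first lra.
by move=> *; rewrite Rminus_diag Rabs_R0.
Qed.

Lemma cont_on3_coord {N} (P : Pt N -> R -> R -> Prop) i : cont_on3 P (fun y _ _ => y i).
Proof. by move=> y z t _ e e0; exists e; split=> // y' z' t' _ h _ _; apply: h. Qed.

Lemma continuity_pt_delta (f : R -> R) x e : continuity_pt f x -> 0 < e ->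
  exists d, 0 < d /\ forall s, Rabs (s - x) < d -> Rabs (f s - f x) < e.
Proof.
move=> hf e0; have [d [d0 h]] := hf e e0; exists d; split=> // s hs.
case: (Req_dec x s) => [<-|ne]; first by rewrite Rminus_diag Rabs_R0.
by apply: (h s); split; first split.
Qed.

Lemma cont_on3_z {N} (P : Pt N -> R -> R -> Prop) f :
  continuity f -> cont_on3 P (fun _ z _ => f z).
Proof.
move=> hf y z t _ e e0; have [d [d0 h]] := continuity_pt_delta f z e (hf z) e0.
by exists d; split=> // y' z' t' _ _ hz _; apply: h.
Qed.

Lemma cont_on3_t {N} (P : Pt N -> R -> R -> Prop) f :
  continuity f -> cont_on3 P (fun _ _ t => f t).
Proof.
move=> hf y z t _ e e0; have [d [d0 h]] := continuity_pt_delta f t e (hf t) e0.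
by exists d; split=> // y' z' t' _ _ _ ht; apply: h.
Qed.

Lemma cont_on3_plus {N} (P : Pt N -> R -> R -> Prop) (F G : Pt N -> R -> R -> R) :
  cont_on3 P F -> cont_on3 P G -> cont_on3 P (fun y z t => F y z t + G y z t).
Proof.
move=> hf hg y z t p e e0.
have [d1 [d10 h1]] := hf y z t p (e / 2) ltac:(lra).
have [d2 [d20 h2]] := hg y z t p (e / 2) ltac:(lra).
exists (Rmin d1 d2); split; first exact: Rmin_pos.
move=> y' z' t' p' c1 c2 c3; have m1 := Rmin_l d1 d2; have m2 := Rmin_r d1 d2.
have := h1 y' z' t' p' (fun i => Rlt_le_trans _ _ _ (c1 i) m1) ltac:(lra) ltac:(lra).
have := h2 y' z' t' p' (fun i => Rlt_le_trans _ _ _ (c1 i) m2) ltac:(lra) ltac:(lra).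
by move=> q1 q2; rabs.
Qed.

Lemma cont_on3_mult {N} (P : Pt N -> R -> R -> Prop) (F G : Pt N -> R -> R -> R) :
  cont_on3 P F -> cont_on3 P G -> cont_on3 P (fun y z t => F y z t * G y z t).
Proof.
move=> hf hg y z t p e e0.
pose K := Rabs (F y z t) + 1; pose C := Rabs (G y z t) + 1.
have K0 : 0 < K by rewrite /K; have := Rabs_pos (F y z t); lra.
have C0 : 0 < C by rewrite /C; have := Rabs_pos (G y z t); lra.
have e1 : 0 < e / (2 * C) by apply: Rdiv_lt_0_compat; lra.
have e2 : 0 < e / (2 * K) by apply: Rdiv_lt_0_compat; lra.
have [d1 [d10 h1]] := hf y z t p (Rmin 1 (e / (2 * C))) ltac:(apply: Rmin_pos; lra).
have [d2 [d20 h2]] := hg y z t p (e / (2 * K)) ltac:(lra).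
exists (Rmin d1 d2); split; first exact: Rmin_pos.
move=> y' z' t' p' c1 c2 c3; have m1 := Rmin_l d1 d2; have m2 := Rmin_r d1 d2.
have := h1 y' z' t' p' (fun i => Rlt_le_trans _ _ _ (c1 i) m1) ltac:(lra) ltac:(lra).
have := h2 y' z' t' p' (fun i => Rlt_le_trans _ _ _ (c1 i) m2) ltac:(lra) ltac:(lra).
have n1 := Rmin_l 1 (e / (2 * C)); have n2 := Rmin_r 1 (e / (2 * C)) => h3 h4.
have -> : F y' z' t' * G y' z' t' - F y z t * G y z t =
   F y' z' t' * (G y' z' t' - G y z t) + (F y' z' t' - F y z t) * G y z t by ring.
apply: Rle_lt_trans (Rabs_triang _ _) _; rewrite !Rabs_mult.
have h5 : Rabs (F y' z' t') <= K.
  have := Rabs_triang (F y' z' t' - F y z t) (F y z t).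
  by rewrite /K (_ : F y' z' t' - F y z t + F y z t = F y' z' t'); [lra|ring].
have h6 : Rabs (F y' z' t') * Rabs (G y' z' t' - G y z t) <= e / 2.
  have -> : e / 2 = K * (e / (2 * K)) by field; lra.
  by apply: Rmult_le_compat; try exact: Rabs_pos; lra.
have h7 : Rabs (F y' z' t' - F y z t) * Rabs (G y z t) < e / 2.
  have -> : e / 2 = (e / (2 * C)) * C by field; lra.
  apply: Rle_lt_trans (_ : e / (2 * C) * Rabs (G y z t) < _); last first.
    by apply: Rmult_lt_compat_l; [lra|rewrite /C; lra].
  by apply: Rmult_le_compat_r; [exact: Rabs_pos|lra].
lra.
Qed.

Lemma cont_on3_sumI {N} (P : Pt N -> R -> R -> Prop) n (F : 'I_n -> Pt N -> R -> R -> R) :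
  (forall i, cont_on3 P (F i)) -> cont_on3 P (fun y z t => sumI (fun i => F i y z t)).
Proof.
elim: n F => [|n IH] F hF.
  by move=> y z t p e e0; exists 1; split=> [|y' z' t' *]; [lra|];
     rewrite /sumI !big_ord0 Rminus_diag Rabs_R0.
move=> y z t p e e0.
have [d [d0 hd]] := cont_on3_plus P _ _ (hF ord0) (IH (fun i => F (lift ord0 i)) (fun i => hF _))
  y z t p e e0.
by exists d; split=> // y' z' t' p' c1 c2 c3; rewrite /sumI !big_ord_recl; apply: hd.
Qed.

Lemma cont_on3_opp {N} (P : Pt N -> R -> R -> Prop) (F : Pt N -> R -> R -> R) :
  cont_on3 P F -> cont_on3 P (fun y z t => - F y z t).
Proof.
move=> hf y z t p e e0; have [d [d0 h]] := hf y z t p e e0.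
exists d; split=> // y' z' t' *.
by rewrite (_ : - _ - - _ = - (F y' z' t' - F y z t)); [rewrite Rabs_Ropp; apply: h|ring].
Qed.

Lemma cont_on3_minus {N} (P : Pt N -> R -> R -> Prop) (F G : Pt N -> R -> R -> R) :
  cont_on3 P F -> cont_on3 P G -> cont_on3 P (fun y z t => F y z t - G y z t).
Proof. by move=> hf hg; apply: cont_on3_plus => //; apply: cont_on3_opp. Qed.

Definition half_space_time {N} (_ : Pt N) (z t : R) : Prop := 0 <= z /\ 0 <= t.

(* Both half spaces are folded onto [0 <= z] and indexed by [bool]; after
   rescaling the two unknowns the exchange condition only involves their
   difference. *)
Record pair_solution {N} (D kap : bool -> R) (h : bool -> R -> R)
    (w : bool -> Pt N -> R -> R -> R) : Prop := {
  sol_cont : forall b, cont_on3 half_space_time (w b);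
  sol_pde : forall b y z t, 0 < z -> 0 < t -> exists c (a : 'I_(N.-1) -> R) a',
    derivable_pt_lim (fun s => w b y z s) t c /\
    (forall i, second_deriv (fun s => w b (upd y i s) z t) (y i) (a i)) /\
    second_deriv (fun s => w b y s t) z a' /\
    c - D b * (sumI a + a') = h b (w b y z t);
  sol_flux : forall b y t, 0 < t -> exists l,
    rderiv (fun s => w b y s t) 0 l /\ kap b * l = w b y 0 t - w (negb b) y 0 t }.

(** At a negative minimum of [exp (- lam t) (w - s)], the second-order and time derivative tests
    contradict the strict differential inequality, or, on the interface, the sign of the inward
    derivative contradicts the strict flux inequality. All requirements on [s] are restricted to
    points where [w < s]; these include being off the parabolic boundary of the box, so that
    barriers may be irregular wherever they lie below [w]. The term with [lam] absorbs the Lipschitz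
    dependence of [h]. *)
Lemma comparison {N} (D kap : bool -> R) h (w s : bool -> Pt N -> R -> R -> R) lam M T1 T2 :
  (forall b, 0 < D b) -> (forall b, 0 < kap b) -> pair_solution D kap h w ->
  (forall b, cont_on3 half_space_time (s b)) -> 0 <= M -> 0 <= T1 ->
  (forall b y z t, in_box M 0 M T1 T2 y z t -> w b y z t < s b y z t ->
     T1 < t /\ (forall i, Rabs (y i) < M) /\ z < M /\
     (0 < z -> exists c (a : 'I_(N.-1) -> R) a',
        derivable_pt_lim (fun r => s b y z r) t c /\
        (forall i, second_deriv (fun r => s b (upd y i r) z t) (y i) (a i)) /\
        second_deriv (fun r => s b y r t) z a' /\
        c - D b * (sumI a + a') < h b (w b y z t) + lam * (s b y z t - w b y z t)) /\
     (z = 0 -> exists l, rderiv (fun r => s b y r t) 0 l /\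
        s b y 0 t - s (negb b) y 0 t < kap b * l)) ->
  forall b y z t, in_box M 0 M T1 T2 y z t -> s b y z t <= w b y z t.
Proof.
move=> D0 k0 sol sc M0 T10 H b0 y0 z0 t0 B0.
have T12 : T1 <= T2 by case: B0 => _ [_]; lra.
pose E b y z t := exp (- lam * t) * (w b y z t - s b y z t).
have Ec b : cont_on3 half_space_time (E b).
  apply: cont_on3_mult; last by apply: cont_on3_minus; [exact: (sol_cont _ _ _ _ sol)|exact: sc].
  apply: (cont_on3_t _ (fun r => exp (- lam * r))) => r.
  apply: derivable_continuous_pt; exists (- lam * exp (- lam * r)).
  by apply/is_derive_Reals; auto_derive; [done|ring].
have sub (y : Pt N) z t : in_box M 0 M T1 T2 y z t -> half_space_time y z t.
  by move=> [_ [? ?]]; split; lra.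
have bm b := box_min half_space_time (E b) M 0 M T1 T2 (Ec b) sub M0 M0 T12.
(* Minimizing over both half spaces at once makes the value at an interface point comparable with
   the one on the opposite side, which is what the exchange condition involves. *)
have [b [y [z [t [B hm]]]]] : exists b y z t, in_box M 0 M T1 T2 y z t /\
    forall b' y' z' t', in_box M 0 M T1 T2 y' z' t' -> E b y z t <= E b' y' z' t'.
  have [y1 [z1 [t1 [B1 m1]]]] := bm true.
  have [y2 [z2 [t2 [B2 m2]]]] := bm false.
  case: (Rle_dec (E true y1 z1 t1) (E false y2 z2 t2)) => c.
  - exists true, y1, z1, t1; split=> // -[] y' z' t' B'; first exact: m1.
    by have := m2 _ _ _ B'; lra.
  - exists false, y2, z2, t2; split=> // -[] y' z' t' B'; last exact: m2.
    by have := m1 _ _ _ B'; lra.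
case: (Rle_dec 0 (E b y z t)) => [ge0|/Rnot_le_lt lt0].
  have h0 := Rle_trans _ _ _ ge0 (hm _ _ _ _ B0).
  have ep := exp_pos (- lam * t0); rewrite /E in h0.
  suff : 0 <= w b0 y0 z0 t0 - s b0 y0 z0 t0 by lra.
  by apply: (Rmult_le_reg_l _ _ _ ep); rewrite Rmult_0_r.
exfalso.
have ep := exp_pos (- lam * t).
have act : w b y z t < s b y z t.
  apply: Rnot_le_lt => le.
  have : 0 <= E b y z t by apply: Rmult_le_pos; lra.
  lra.
have hmt b' y' z' : in_box M 0 M T1 T2 y' z' t ->
    w b y z t - s b y z t <= w b' y' z' t - s b' y' z' t.
  move=> B'; have := hm b' _ _ _ B'; rewrite /E => hE.
  exact: (Rmult_le_reg_l _ _ _ ep hE).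
have [t1 [y1 [z1 [hin hbd]]]] := H b y z t B act.
have [By [Bz Bt]] := B.
case: (Req_dec z 0) => [ze|zne].
- rewrite ze in act B hbd hmt.
  have [l [hl flux]] := hbd erefl.
  have [l' [hl' flux']] := sol_flux _ _ _ _ sol b y t ltac:(lra).
  have ll : 0 <= l' - l.
    apply: (rderiv_ge0 _ 0 _ (rderiv_minus _ _ _ _ _ hl' hl)).
    exists M; split; first lra.
    by move=> k hk; rewrite Rplus_0_l; apply: hmt; split=> //; split; lra.
  have := hmt (negb b) y 0 B => h1.
  have : kap b * l <= kap b * l' by apply: Rmult_le_compat_l; [have := k0 b; lra|lra].
  lra.
have z0' : 0 < z by lra.
have [c [a [a' [hc [ha [ha' hs]]]]]] := hin z0'.
have [c1 [a1 [a1' [hc1 [ha1 [ha1' hw]]]]]] := sol_pde _ _ _ _ sol b y z t z0' ltac:(lra).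
have ct : c1 - c <= lam * (w b y z t - s b y z t).
  apply: (derivable_pt_lim_left_min (fun r => w b y z r - s b y z r) lam t).
    exact: derivable_pt_lim_minus.
  exists (t - T1); split; first lra.
  by move=> r hr; apply: (hm b y z r); split=> //; split; lra.
have az : 0 <= a1' - a'.
  apply: (second_deriv_min _ z _ (second_deriv_minus _ _ _ _ _ ha1' ha')).
  exists (Rmin z (M - z)); split; first by apply: Rmin_pos; lra.
  move=> r hr; apply: hmt; split=> //.
  have m1 := Rmin_l z (M - z); have m2 := Rmin_r z (M - z).
  by move/Rabs_lt_between: hr; lra.
have ai i : a i <= a1 i.
  suff : 0 <= a1 i - a i by lra.
  apply: (second_deriv_min _ (y i) _ (second_deriv_minus _ _ _ _ _ (ha1 i) (ha i))).
  exists (M - Rabs (y i)); split; first by have := y1 i; lra.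
  move=> r hr; rewrite upd_id; apply: hmt; split=> // j.
  rewrite /upd; case: eqP => // _.
  by have := Rabs_triang (r - y i) (y i); rewrite (_ : r - y i + y i = r); [lra|ring].
have sa := sumI_le _ _ _ ai.
have : D b * (sumI a + a') <= D b * (sumI a1 + a1').
  by apply: Rmult_le_compat_l; [have := D0 b; lra|lra].
lra.
Qed.

Lemma is_derive_continuity (f f' : R -> R) : (forall x, is_derive f x (f' x)) -> continuity f.
Proof.
by move=> h x; apply: derivable_continuous_pt; exists (f' x); apply/is_derive_Reals.
Qed.

Lemma is_derive_second_deriv (f f' : R -> R) x l :
  (forall s, is_derive f s (f' s)) -> is_derive f' x l -> second_deriv f x l.
Proof.
move=> h hl; exists f'; split; last by apply/is_derive_Reals.
by exists 1; split; [lra|move=> s _; apply/is_derive_Reals].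
Qed.

Lemma second_deriv_ext (f g : R -> R) x l :
  (forall s, f s = g s) -> second_deriv f x l -> second_deriv g x l.
Proof. by move=> h; rewrite (functional_extensionality _ _ h). Qed.

Lemma second_deriv_scal (c : R) (f : R -> R) x l :
  second_deriv f x l -> second_deriv (fun s => c * f s) x (c * l).
Proof.
move=> [f' [[d [d0 hd]] hl]]; exists (fun s => c * f' s); split.
- by exists d; split=> // s hs; apply: (derivable_pt_lim_scal f); apply: hd.
- exact: (derivable_pt_lim_scal f').
Qed.

Lemma rderiv_scal (c : R) (f : R -> R) x l :
  rderiv f x l -> rderiv (fun s => c * f s) x (c * l).
Proof.
move=> hf e e0.
have c0 := Rabs_pos c.
have e1 : 0 < e / (Rabs c + 1) by apply: Rdiv_lt_0_compat; lra.
have [d [d0 h]] := hf _ e1; exists d; split=> // k hk.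
have -> : (c * f (x + k) - c * f x) / k - c * l = c * ((f (x + k) - f x) / k - l).
  by field; lra.
rewrite Rabs_mult.
have h1 := h k hk.
apply: Rle_lt_trans (_ : Rabs c * (e / (Rabs c + 1)) < _).
  by apply: Rmult_le_compat_l; lra.
have {2}-> : e = (Rabs c + 1) * (e / (Rabs c + 1)) by field; lra.
by apply: Rmult_lt_compat_r; lra.
Qed.

Lemma is_derive_rderiv (f : R -> R) x l : is_derive f x l -> rderiv f x l.
Proof.
move/is_derive_Reals => h e e0; have [[d d0] /= hd] := h e e0.
by exists d; split=> // k hk; apply: hd; [lra|rewrite Rabs_right; lra].
Qed.

Lemma pair_solution_opp {N} D kap h (w : bool -> Pt N -> R -> R -> R) :
  pair_solution D kap h w ->
  pair_solution D kap (fun b r => - h b (- r)) (fun b y z t => - w b y z t).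
Proof.
case=> hc hp hf; split.
- by move=> b; apply: cont_on3_opp.
- move=> b y z t z0 t0; have [c [a [a' [h1 [h2 [h3 h4]]]]]] := hp b y z t z0 t0.
  exists (- c), (fun i => (-1) * a i), ((-1) * a'); split; last split; last split.
  + exact: (derivable_pt_lim_opp (fun s => w b y z s)).
  + move=> i; apply: second_deriv_ext (second_deriv_scal (-1) _ _ _ (h2 i)).
    by move=> s; ring.
  + by apply: second_deriv_ext (second_deriv_scal (-1) _ _ _ h3) => s; ring.
  + by rewrite sumI_scale Ropp_involutive -h4; ring.
- move=> b y t t0; have [l [h1 h2]] := hf b y t t0; exists (-1 * l); split.
  + have := rderiv_scal (-1) _ _ _ h1.
    rewrite (functional_extensionality (fun s => -1 * w b y s t) (fun s => - w b y s t)) //.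
    by move=> s; ring.
  + by rewrite (_ : kap b * (-1 * l) = - (kap b * l)); [rewrite h2; ring|ring].
Qed.

Definition sumsq {n} (y : 'I_n -> R) : R := sumI (fun i => y i * y i).

Lemma sumsq_ge0 n (y : 'I_n -> R) : 0 <= sumsq y.
Proof. by apply: sumI_ge0 => i; nra. Qed.

Lemma sumsq_ge_term n (y : 'I_n -> R) i : y i * y i <= sumsq y.
Proof. by apply: (sumI_ge_term _ (fun i => y i * y i)) => j; nra. Qed.

Lemma sumsq_le n (y : 'I_n -> R) M : (forall i, Rabs (y i) <= M) -> sumsq y <= INR n * (M * M).
Proof.
move=> h; rewrite -sumI_const; apply: sumI_le => i.
by have := h i; have := Rabs_pos (y i); rewrite -(Rabs_right (y i * y i)) ?Rabs_mult; nra.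
Qed.

Lemma sumsq_upd {N} (y : Pt N) i s : sumsq (upd y i s) = sumsq y - y i * y i + s * s.
Proof. exact: (sumI_upd (fun _ r => r * r)). Qed.

Lemma cont_on3_sumsq {N} (P : Pt N -> R -> R -> Prop) : cont_on3 P (fun y _ _ => sumsq y).
Proof. by apply: cont_on3_sumI => i; apply: cont_on3_mult; apply: cont_on3_coord. Qed.

Lemma loc_lipschitz_pair (h : bool -> R -> R) K :
  (forall b, loc_lipschitz (h b)) -> 0 < K ->
  exists L, 0 < L /\ forall b r s, Rabs r <= K -> Rabs s <= K ->
    Rabs (h b r - h b s) <= L * Rabs (r - s).
Proof.
move=> hl K0; have [L1 h1] := hl true K K0; have [L2 h2] := hl false K K0.
exists (Rabs L1 + Rabs L2 + 1).
have p1 := Rabs_pos L1; have p2 := Rabs_pos L2; split; first lra.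
move=> b r s hr hs; have p3 := Rabs_pos (r - s).
have q1 := Rle_abs L1; have q2 := Rle_abs L2.
case: b; [have := h1 r s hr hs|have := h2 r s hr hs] => q; apply: Rle_trans q _;
  apply: Rmult_le_compat_r; lra.
Qed.

(** Comparison with [c - eps exp (Lam t) q], where [q] grows quadratically, followed by [eps -> 0].
    Since [w] is bounded on bounded time intervals, the barrier can exceed it only on a compact
    set. *)
Lemma constant_lower_bound {N} D kap h (w : bool -> Pt N -> R -> R -> R) c :
  (forall b, 0 < D b) -> (forall b, 0 < kap b) -> (forall b, loc_lipschitz (h b)) ->
  pair_solution D kap h w ->
  (forall T, 0 < T -> exists K, forall b y z t, 0 <= z -> 0 <= t <= T -> Rabs (w b y z t) <= K) ->
  (forall b, 0 <= h b c) -> (forall b y z, 0 <= z -> c <= w b y z 0) ->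
  forall b y z t, 0 <= z -> 0 <= t -> c <= w b y z t.
Proof.
move=> D0 k0 hl sol bd hc init b0 y0 z0 t0 z00 t00.
have [K hK] := bd (t0 + 1) ltac:(lra).
have K0 : 0 <= K by apply: Rle_trans (Rabs_pos _) (hK b0 y0 z0 t0 z00 ltac:(lra)).
pose K1 := K + Rabs c + 1.
have c0 := Rabs_pos c.
have [L [L0 hL]] := loc_lipschitz_pair h K1 hl ltac:(rewrite /K1; lra).
pose n := N.-1.
pose Dm := D true + D false.
have n0 : 0 <= INR n by apply: pos_INR.
have DD b : 0 < D b <= Dm by rewrite /Dm; have := D0 true; have := D0 false; case: b; lra.
(* [Lam] beats the Lipschitz constant plus the Laplacian of [q], which is [2 (n + 1)]. *)
pose Lam := L + 2 * Dm * (INR n + 1) + 1.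
have Dm0 : 0 < Dm by have := DD true; lra.
have Lam0 : 0 < Lam by rewrite /Lam; nra.
(* This is [1 + |y|^2 + (z - 1)^2]: at least 1, and with slope [-2] at [z = 0], so the barrier has a
   positive inward derivative there while its two boundary values coincide. *)
pose q (y : Pt N) z := 2 + sumsq y + z * z - 2 * z.
have q1 y z : 1 <= q y z by rewrite /q; have := sumsq_ge0 _ y; have := Rle_0_sqr (z - 1); rewrite /Rsqr; lra.
suff main : forall eps, 0 < eps -> c - eps * (exp (Lam * t0) * q y0 z0) <= w b0 y0 z0 t0.
  apply: Rnot_lt_le => lt.
  have Q0 : 0 < exp (Lam * t0) * q y0 z0.
    by apply: Rmult_lt_0_compat; [exact: exp_pos|have := q1 y0 z0; lra].
  move: main Q0; set Q := exp _ * _ => main Q0.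
  have := main ((c - w b0 y0 z0 t0) / (2 * Q)) ltac:(apply: Rdiv_lt_0_compat; lra).
  have -> : (c - w b0 y0 z0 t0) / (2 * Q) * Q = (c - w b0 y0 z0 t0) / 2 by field; lra.
  lra.
move=> eps eps0.
(* Where the barrier exceeds [w] one has [eps q <= K1]; this [M] confines such points to the
   interior of the box, which also contains the given point. *)
pose M := 2 + sumI (fun i => Rabs (y0 i)) + z0 + K1 / eps.
have M1 : 0 <= K1 / eps by apply: Rdiv_le_0_compat; rewrite /K1; lra.
have M2 : 0 <= sumI (fun i => Rabs (y0 i)) by apply: sumI_ge0 => i; apply: Rabs_pos.
have Mq : K1 < eps * (1 + (M - 1) * (M - 1)).
  have -> : K1 = eps * (K1 / eps) by field; lra.
  by apply: Rmult_lt_compat_l => //; rewrite /M; nra.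
pose s (b : bool) (y : Pt N) z t := c - eps * (exp (Lam * t) * q y z).
have M0 : 2 <= M by rewrite /M; lra.
refine (comparison D kap h w s L M 0 t0 D0 k0 sol _ _ _ _ b0 y0 z0 t0 _); try lra; last first.
- split; last by rewrite /M; lra.
  by move=> i; have := sumI_ge_term _ (fun i => Rabs (y0 i)) i (fun _ => Rabs_pos _); rewrite /M; lra.
- move=> b y z t [By [Bz Bt]] act.
  have ea : 1 <= exp (Lam * t) by have := exp_ineq1_le (Lam * t); nra.
  have wK := hK b y z t ltac:(lra) ltac:(lra).
  have qact : eps * q y z <= c - s b y z t.
    have qE : 1 * q y z <= exp (Lam * t) * q y z.
      by apply: Rmult_le_compat_r; [have := q1 y z; lra|].
    by have := Rmult_le_compat_l eps _ _ ltac:(lra) qE; rewrite /s; lra.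
  have qK : eps * q y z <= K1.
    by rewrite /K1; have := Rle_abs c; move/Rabs_le_between: wK; lra.
  have qM : q y z < 1 + (M - 1) * (M - 1) by nra.
  have wc : w b y z t < c by have := q1 y z; nra.
  have tp : 0 < t.
    by case: (Req_dec t 0) => [te|]; [have := init b y z ltac:(lra); rewrite te in wc; lra|lra].
  split=> //; split.
    move=> i; apply: Rnot_le_lt => le; have := By i => By1.
    have : Rabs (y i) * Rabs (y i) = y i * y i by rewrite -Rabs_mult Rabs_right; nra.
    have := sumsq_ge_term _ y i; rewrite /q in qM.
    have : 2 <= M by rewrite /M; lra.
    nra.
  split.
    by apply: Rnot_le_lt => le; have := sumsq_ge0 _ y; rewrite /q in qM; nra.
  split.
    move=> zp.
    exists (- (eps * (Lam * exp (Lam * t) * q y z))), (fun _ => - (2 * eps * exp (Lam * t))),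
      (- (2 * eps * exp (Lam * t))); split.
      by apply/is_derive_Reals; rewrite /s; auto_derive; [done|ring].
    split.
      move=> i; apply: (second_deriv_ext
        (fun r => c - eps * (exp (Lam * t) * (2 + (sumsq y - y i * y i + r * r) + z * z - 2 * z)))).
        by move=> r; rewrite /s /q sumsq_upd.
      apply: (is_derive_second_deriv _ (fun r => - (2 * eps * exp (Lam * t)) * r)).
        by move=> r; auto_derive; [done|ring].
      by auto_derive; [done|ring].
    split.
      apply: (is_derive_second_deriv _ (fun r => - (2 * eps * exp (Lam * t)) * (r - 1))).
        by move=> r; rewrite /s /q; auto_derive; [done|ring].
      by auto_derive; [done|ring].
    rewrite sumI_const.
    have cK : Rabs c <= K1 by rewrite /K1; lra.
    have := hL b (w b y z t) c ltac:(rewrite /K1; lra) cK.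
    rewrite (Rabs_left (w b y z t - c)); last lra.
    move=> /Rabs_le_between [hw _]; have := hc b.
    have E0 : 0 < eps * exp (Lam * t) by nra.
    have key : D b * (2 * (INR n + 1)) < (Lam - L) * q y z.
      have := DD b => dd; have : D b * (2 * (INR n + 1)) <= Dm * (2 * (INR n + 1)).
        by apply: Rmult_le_compat_r; [lra|exact: (proj2 dd)].
      have : Lam - L <= (Lam - L) * q y z.
        rewrite -{1}(Rmult_1_r (Lam - L)); apply: Rmult_le_compat_l; last exact: q1.
        by have := Rmult_le_pos Dm (INR n + 1) ltac:(lra) ltac:(lra); rewrite /Lam; lra.
      rewrite /Lam; lra.
    have := Rmult_lt_compat_l _ _ _ E0 key.
    rewrite /s -/n; lra.
  move=> ze; exists (2 * eps * exp (Lam * t)); split; last first.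
    rewrite (_ : s b y 0 t - s (negb b) y 0 t = 0); last by rewrite /s; ring.
    by have := exp_pos (Lam * t) => ep; apply: Rmult_lt_0_compat; [exact: k0|nra].
  by apply: is_derive_rderiv; rewrite /s /q; auto_derive; [done|ring].
- move=> b; rewrite /s /q.
  apply: cont_on3_minus; first exact: cont_on3_const.
  apply: cont_on3_mult; first exact: cont_on3_const.
  apply: cont_on3_mult.
    apply: (cont_on3_t _ (fun t => exp (Lam * t))).
    by apply: (is_derive_continuity _ (fun t => Lam * exp (Lam * t))) => x; auto_derive; [done|ring].
  apply: cont_on3_minus; last first.
    by apply: (cont_on3_z _ (fun z => 2 * z)); apply: (is_derive_continuity _ (fun _ => 2)) => x;
      auto_derive; [done|ring].
  apply: cont_on3_plus; last first.
    by apply: (cont_on3_z _ (fun z => z * z)); apply: (is_derive_continuity _ (fun z => 2 * z)) => x;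
      auto_derive; [done|ring].
  by apply: cont_on3_plus; [exact: cont_on3_const|exact: cont_on3_sumsq].
Qed.

(** * Pushing stationary strict subsolutions *)

(** The cone may shrink from one use to the next: only the existence of some positive opening speed
    is recorded, which makes the property stable under finitely many pushes. *)
Definition eventually_above {N} (w : bool -> Pt N -> R -> R -> R) (A : bool -> R -> R) : Prop :=
  exists c T, 0 < c /\ 0 < T /\ forall b y z t, T <= t -> (forall i, Rabs (y i) <= c * t) ->
    0 <= z <= c * t -> A b z <= w b y z t.

Lemma eventually_above_le {N} (w : bool -> Pt N -> R -> R -> R) A B :
  eventually_above w A -> (forall b z, 0 <= z -> B b z <= A b z) -> eventually_above w B.
Proof.
move=> [c [T [c0 [T0 h]]]] hB; exists c, T; split=> //; split=> // b y z t Tt hy hz.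
by apply: Rle_trans (hB b z _) (h b y z t Tt hy hz); lra.
Qed.

Lemma eventually_above_max {N} (w : bool -> Pt N -> R -> R -> R) A B :
  eventually_above w A -> eventually_above w B ->
  eventually_above w (fun b z => Rmax (A b z) (B b z)).
Proof.
move=> [c [T [c0 [T0 h]]]] [c' [T' [c'0 [T'0 h']]]].
exists (Rmin c c'), (Rmax T T'); split; first exact: Rmin_pos.
have m1 := Rmin_l c c'; have m2 := Rmin_r c c'.
have m3 := Rmax_l T T'; have m4 := Rmax_r T T'.
split; first lra.
move=> b y z t Tt hy hz.
have q1 : Rmin c c' * t <= c * t by apply: Rmult_le_compat_r; lra.
have q2 : Rmin c c' * t <= c' * t by apply: Rmult_le_compat_r; lra.
apply: Rmax_lub.
- by apply: h; [lra|move=> i; have := hy i; lra|lra].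
- by apply: h'; [lra|move=> i; have := hy i; lra|lra].
Qed.

Lemma second_deriv_quadratic (A : R -> R) z a c g :
  second_deriv A z a -> second_deriv (fun r => A r - (c + g * (r * r))) z (a - 2 * g).
Proof.
move=> h; apply: (second_deriv_minus _ _ _ _ _ h).
apply: (is_derive_second_deriv _ (fun r => 2 * g * r)).
- by move=> r; auto_derive; [done|ring].
- by auto_derive; [done|ring].
Qed.

(* The barrier is [A - theta t - P x]: [theta] decreases slowly from [del] to
   [-del], and the paraboloid [P] exceeds [4 K] off the cone but is at most
   [del] on a thinner one. *)
Lemma strict_sub_push {N} D kap h (w : bool -> Pt N -> R -> R -> R) A m K L eta eps0 del :
  (forall b, 0 < D b) -> (forall b, 0 < kap b) -> pair_solution D kap h w ->
  0 < K -> (forall b y z t, 0 <= z -> 0 <= t -> Rabs (w b y z t) <= K) ->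
  (forall b, continuity (A b)) -> (forall b z, 0 <= z -> Rabs (A b z) <= K) ->
  0 < L -> (forall b r s, Rabs r <= K -> Rabs s <= K -> Rabs (h b r - h b s) <= L * Rabs (r - s)) ->
  0 < eta -> 0 < del -> del <= eps0 -> del <= K -> L * del <= eta / 4 ->
  eventually_above w m ->
  (forall b z, 0 < z -> m b z - eps0 <= A b z ->
     exists a, second_deriv (A b) z a /\ eta <= D b * a + h b (A b z)) ->
  (forall b, m b 0 - eps0 <= A b 0 ->
     exists l, rderiv (A b) 0 l /\ A b 0 - A (negb b) 0 < kap b * l) ->
  eventually_above w (fun b z => A b z - del) -> eventually_above w A.
Proof.
move=> D0 k0 sol K0 wK Ac AK L0 hL eta0 del0 dele delK Ldel wm hin hbd wA.
have [c [T [c0 [T0 hc]]]] := eventually_above_max _ _ _ wm wA.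
pose n := N.-1; have n0 : 0 <= INR n by apply: pos_INR.
pose Dm := D true + D false.
have DD b : 0 < D b <= Dm by rewrite /Dm; have := D0 true; have := D0 false; case: b; lra.
have Dm0 : 0 < Dm by have := DD true; lra.
(* [s] is the rate at which [theta] decreases, and [tau] the time that it needs for the total change
   [2 del]. *)
pose s := eta / 4; pose tau := 2 * del / s.
have s0 : 0 < s by rewrite /s; lra.
have tau0 : 0 < tau by apply: Rdiv_lt_0_compat; lra.
(* A paraboloid of curvature at most [g0] costs at most [eta / 8] of the margin. Once the cone has
   radius [X], the curvature [4 K / X^2] is below [g0]. *)
pose g0 := eta / (16 * Dm * (INR n + 1)).
have Dn : 0 < Dm * (INR n + 1) by apply: Rmult_lt_0_compat; lra.
have g00 : 0 < g0 by apply: Rdiv_lt_0_compat; lra.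
pose X := 1 + 4 * K / g0.
have X1 : 0 < 4 * K / g0 by apply: Rdiv_lt_0_compat; lra.
have Xc : 0 < X / c by apply: Rdiv_lt_0_compat; rewrite /X; lra.
(* On the cone thinned by [k] the paraboloid is at most [16 K (n + 1) k^2 <= del]; here
   [16 = 4 * 4], one factor from [4 K] and one from [t <= 2 T1]. *)
pose k := Rmin (1 / 2) (del / (16 * K * (INR n + 1))).
have Kn : 0 < K * (INR n + 1) by apply: Rmult_lt_0_compat; lra.
have k00 : 0 < del / (16 * K * (INR n + 1)) by apply: Rdiv_lt_0_compat; lra.
have kp : 0 < k by apply: Rmin_pos; lra.
have k1 : k <= 1 / 2 by exact: Rmin_l.
have k2 : 16 * K * (INR n + 1) * (k * k) <= del.
  have kk : k <= del / (16 * K * (INR n + 1)) by exact: Rmin_r.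
  have -> : del = 16 * K * (INR n + 1) * (del / (16 * K * (INR n + 1))) by field; lra.
  apply: Rmult_le_compat_l; first lra.
  have kk2 : k * k <= 1 * k by apply: Rmult_le_compat_r; lra.
  lra.
exists (c * k), (2 * tau + T + X / c); split; first exact: Rmult_lt_0_compat.
split; first lra.
move=> b y z t Tt hy hz.
pose T1 := t - tau.
have T1T : T <= T1 by rewrite /T1; lra.
have T1X : X <= c * T1.
  have -> : X = c * (X / c) by field; lra.
  by apply: Rmult_le_compat_l; rewrite /T1; lra.
have T1t : t <= 2 * T1 by rewrite /T1; lra.
have cT : 1 <= c * T1 by rewrite /X in T1X; lra.
pose g := 4 * K / ((c * T1) * (c * T1)).
have gp : 0 < g by apply: Rdiv_lt_0_compat; [lra|nra].
have gc : g * ((c * T1) * (c * T1)) = 4 * K by rewrite /g; field; lra.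
have gg : g <= g0.
  have : 4 * K <= g0 * ((c * T1) * (c * T1)).
    have -> : 4 * K = g0 * (4 * K / g0) by field; lra.
    by apply: Rmult_le_compat_l; [lra|rewrite /X in T1X; nra].
  by rewrite -gc => q; apply: Rmult_le_reg_r q; nra.
have small : Dm * (2 * g * (INR n + 1)) <= eta / 8.
  have -> : eta / 8 = Dm * (2 * g0 * (INR n + 1)) by rewrite /g0; field; lra.
  apply: Rmult_le_compat_l; first lra.
  by apply: Rmult_le_compat_r; lra.
pose P (y : Pt N) z := g * (sumsq y + z * z).
pose S b y z t := A b z - (del - s * (t - T1)) - P y z.
have Ppos y' z' : 0 <= P y' z'.
  by apply: Rmult_le_pos; [lra|have := sumsq_ge0 _ y'; nra].
have inside b' y' z' t' : 0 <= z' -> T1 <= t' <= t -> w b' y' z' t' < S b' y' z' t' ->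
    (forall i, Rabs (y' i) < c * T1) /\ z' < c * T1.
  move=> z'0 t'1 act.
  have P4 : P y' z' < 4 * K.
    have := AK b' z' z'0; have := wK b' y' z' t' z'0 ltac:(lra).
    have : 0 <= s * (t' - T1) <= 2 * del.
      have -> : 2 * del = s * tau by rewrite /tau; field; lra.
      by split; [apply: Rmult_le_pos; lra|apply: Rmult_le_compat_l; rewrite /T1; lra].
    rewrite /S in act => q1 q2 q3; rabs.
  rewrite -gc /P in P4; have {}P4 := Rmult_lt_reg_l _ _ _ gp P4.
  split.
  - move=> i; apply: Rnot_le_lt => le.
    have : Rabs (y' i) * Rabs (y' i) = y' i * y' i by rewrite -Rabs_mult Rabs_right; nra.
    by have := sumsq_ge_term _ y' i; nra.
  - by apply: Rnot_le_lt => le; have := sumsq_ge0 _ y'; nra.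
have : S b y z t <= w b y z t.
  have kt : c * k * t <= c * T1.
    by rewrite Rmult_assoc; apply: Rmult_le_compat_l; [lra|nra].
  refine (comparison D kap h w S L (c * T1 + 1) T1 t D0 k0 sol _ _ _ _ b y z t _); try lra; last first.
  - split; last by have : T1 <= t by [rewrite /T1; lra]; lra.
    by move=> i; have := hy i; lra.
  - move=> b' y' z' t' [By [Bz Bt]] act.
    have [iy iz] := inside b' y' z' t' ltac:(lra) Bt act.
    have tt : c * T1 <= c * t' by apply: Rmult_le_compat_l; lra.
    have := hc b' y' z' t' ltac:(lra) ltac:(move=> i; have := iy i; lra) ltac:(lra).
    move=> lw; have lm := Rle_trans _ _ _ (Rmax_l _ _) lw.
    have lA := Rle_trans _ _ _ (Rmax_r _ _) lw.
    have PP := Ppos y' z'.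
    have st : 0 <= s * (t' - T1) by apply: Rmult_le_pos; lra.
    have st2 : s * (t' - T1) <= 2 * del.
      have -> : 2 * del = s * tau by rewrite /tau; field; lra.
      by apply: Rmult_le_compat_l; rewrite /T1 in Bt *; lra.
    have mact : m b' z' - eps0 <= A b' z' by rewrite /S in act; lra.
    (* By the assumed bound [A - del <= w], the drift must exceed [P] at an active point; in
       particular the initial time is excluded. *)
    have gap : s * (t' - T1) > P y' z' by rewrite /S in act; lra.
    split; first by apply: Rnot_le_lt => le; have e : t' = T1 by [lra]; rewrite e in gap; lra.
    split; first by move=> i; have := iy i; lra.
    split; first lra.
    split.
    + move=> z'p; have [a [ha hsub]] := hin b' z' z'p mact.
      exists s, (fun _ => - (2 * g)), (a - 2 * g); split.
        by apply/is_derive_Reals; rewrite /S; auto_derive; [done|ring].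
      split.
        move=> i; apply: (second_deriv_ext (fun r => A b' z' - (del - s * (t' - T1)) -
             g * (sumsq y' - y' i * y' i + r * r + z' * z'))).
          by move=> r; rewrite /S /P sumsq_upd.
        apply: (is_derive_second_deriv _ (fun r => - (2 * g) * r)).
          by move=> r; auto_derive; [done|ring].
        by auto_derive; [done|ring].
      split.
        apply: (second_deriv_ext (fun r => A b' r -
            (del - s * (t' - T1) + g * sumsq y' + g * (r * r)))).
          by move=> r; rewrite /S /P; ring.
        exact: second_deriv_quadratic.
      rewrite sumI_const -/n.
      have dd := DD b'.
      have sm : D b' * (2 * g * (INR n + 1)) <= eta / 8.
        apply: Rle_trans small; apply: Rmult_le_compat_r; last exact: (proj2 dd).
        by apply: Rmult_le_pos; lra.
      (* The margin [eta] pays for the drift [s = eta / 4], for the paraboloid, [eta / 8], and for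
         evaluating [h] at [w] instead of [A], which costs [L * del <= eta / 4] beyond the term with
         [S - w] allowed by the comparison. *)
      have := hL b' _ _ (AK b' z' ltac:(lra)) (wK b' y' z' t' ltac:(lra) ltac:(lra)).
      have : Rabs (A b' z' - w b' y' z' t') <= (S b' y' z' t' - w b' y' z' t') + del.
        by apply: Rabs_le; rewrite /S in act *; lra.
      move=> q1 /Rabs_le_between [_ q2].
      have q3 := Rmult_le_compat_l L _ _ ltac:(lra) q1.
      by rewrite /s; lra.
    + move=> ze; rewrite ze in mact.
      have [l [hl hk]] := hbd b' mact.
      exists l; split; last by rewrite /S; lra.
      rewrite -[l]Rminus_0_r.
      rewrite (functional_extensionality (fun r => S b' y' r t') (fun r => A b' r -
            (del - s * (t' - T1) + g * sumsq y' + g * (r * r)))); last first.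
        by move=> r; rewrite /S /P /=; ring.
      apply: rderiv_minus => //; apply: is_derive_rderiv.
      by auto_derive; [done|ring].
  - move=> b'; rewrite /S /P; apply: cont_on3_minus; first apply: cont_on3_minus.
    + exact: cont_on3_z.
    + apply: (cont_on3_t _ (fun r => del - s * (r - T1))).
      by apply: (is_derive_continuity _ (fun _ => - s)) => r; auto_derive; [done|ring].
    + apply: cont_on3_mult; first exact: cont_on3_const.
      apply: cont_on3_plus; first exact: cont_on3_sumsq.
      by apply: (cont_on3_z _ (fun z => z * z)); apply: (is_derive_continuity _ (fun z => 2 * z)) => x;
        auto_derive; [done|ring].
move=> hS; apply: Rle_trans hS.
have : P y z <= del.
  have ct : 0 <= c * k * t by apply: Rmult_le_pos; [nra|lra].
  have q1 : sumsq y + z * z <= (INR n + 1) * ((c * k * t) * (c * k * t)).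
    by have := sumsq_le _ y _ hy; rewrite -/n; nra.
  apply: Rle_trans (Rmult_le_compat_l _ _ _ (Rlt_le _ _ gp) q1) _.
  have q2 : t * t <= 4 * (T1 * T1) by nra.
  have q3 : 0 <= g * (INR n + 1) * (c * k * (c * k)) by apply: Rmult_le_pos; nra.
  have := Rmult_le_compat_l _ _ _ q3 q2 => q4.
  have -> : g * ((INR n + 1) * (c * k * t * (c * k * t))) =
    g * (INR n + 1) * (c * k * (c * k)) * (t * t) by ring.
  apply: Rle_trans q4 _.
  have -> : g * (INR n + 1) * (c * k * (c * k)) * (4 * (T1 * T1)) =
    4 * (g * ((c * T1) * (c * T1))) * (INR n + 1) * (k * k) by ring.
  by rewrite gc; lra.
rewrite /S (_ : s * (t - T1) = 2 * del); first lra.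
by rewrite /T1 /tau; field; lra.
Qed.

(** The step [del] of one push depends only on [K], [eta], [eps0] and a Lipschitz constant, all
    uniform in [s], so finitely many pushes lead from [A 0] to [A 1]. The known bound [m] exempts
    the family from being a subsolution where it lies below [m - eps0]. *)
Lemma strict_sub_sweep {N} D kap h (w : bool -> Pt N -> R -> R -> R)
    (A : R -> bool -> R -> R) m K eta eps0 :
  (forall b, 0 < D b) -> (forall b, 0 < kap b) -> (forall b, loc_lipschitz (h b)) ->
  pair_solution D kap h w ->
  0 < K -> (forall b y z t, 0 <= z -> 0 <= t -> Rabs (w b y z t) <= K) ->
  (forall s b, 0 <= s <= 1 -> continuity (A s b)) ->
  (forall s b z, 0 <= s <= 1 -> 0 <= z -> Rabs (A s b z) <= K) ->
  (forall e, 0 < e -> exists d, 0 < d /\ forall s s' b z, 0 <= s <= 1 -> 0 <= s' <= 1 ->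
     Rabs (s - s') <= d -> 0 <= z -> Rabs (A s b z - A s' b z) <= e) ->
  0 < eta -> 0 < eps0 -> eventually_above w m ->
  (forall s b z, 0 <= s <= 1 -> 0 < z -> m b z - eps0 <= A s b z ->
     exists a, second_deriv (A s b) z a /\ eta <= D b * a + h b (A s b z)) ->
  (forall s b, 0 <= s <= 1 -> m b 0 - eps0 <= A s b 0 ->
     exists l, rderiv (A s b) 0 l /\ A s b 0 - A s (negb b) 0 < kap b * l) ->
  eventually_above w (A 0) -> eventually_above w (A 1).
Proof.
move=> D0 k0 hl sol K0 wK Ac AK Au eta0 e0 wm hin hbd w0.
have [L [L0 hL]] := loc_lipschitz_pair h K hl K0.
pose del := Rmin (Rmin eps0 K) (eta / (4 * L)).
have q0 : 0 < eta / (4 * L) by apply: Rdiv_lt_0_compat; lra.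
have del0 : 0 < del by rewrite /del; do 2 (apply: Rmin_pos => //).
have [d1 [d2 d3]] : del <= eps0 /\ del <= K /\ del <= eta / (4 * L).
  rewrite /del; have := Rmin_l (Rmin eps0 K) (eta / (4 * L)).
  have := Rmin_r (Rmin eps0 K) (eta / (4 * L)).
  have := Rmin_l eps0 K; have := Rmin_r eps0 K; lra.
have d4 : L * del <= eta / 4.
  have -> : eta / 4 = L * (eta / (4 * L)) by field; lra.
  by apply: Rmult_le_compat_l; lra.
have [d [dp hd]] := Au del del0.
have step s s' : 0 <= s <= 1 -> 0 <= s' <= 1 -> Rabs (s - s') <= d ->
    eventually_above w (A s) -> eventually_above w (A s').
  move=> hs hs' ss ws.
  apply: (strict_sub_push D kap h w (A s') m K L eta eps0 del) => //.
  - by move=> b; apply: Ac.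
  - by move=> b z; apply: AK.
  - by move=> b z; apply: hin.
  - by move=> b; apply: hbd.
  - apply: eventually_above_le ws _ => b z z0.
    by have := hd s s' b z hs hs' ss z0 => q; rabs.
have [k hk] := archimed_cor1 (Rmin d 1) ltac:(apply: Rmin_pos; lra).
have kp : 0 < INR k by apply: lt_0_INR; case: hk.
have k1 : / INR k <= d by have := Rmin_l d 1; lra.
have kk : INR k * / INR k = 1 by field; lra.
have ik : 0 < / INR k by apply: Rinv_0_lt_compat.
have all j : (j <= k)%coq_nat -> eventually_above w (A (INR j * / INR k)).
  elim: j => [|j IH] jk; first by rewrite Rmult_0_l.
  have h1 : INR j.+1 <= INR k by apply: le_INR.
  have h2 := pos_INR j; rewrite S_INR in h1 *.
  have h3 : (INR j + 1) * / INR k <= 1 by rewrite -kk; apply: Rmult_le_compat_r; lra.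
  have h4 : 0 <= INR j * / INR k by apply: Rmult_le_pos; lra.
  apply: (step (INR j * / INR k)); try lra; last by apply: IH; lia.
  by rewrite Rabs_left; lra.
by have := all k (le_n k); rewrite kk.
Qed.

Lemma loc_lipschitz_continuity (f : R -> R) : loc_lipschitz f -> continuity f.
Proof.
move=> hl x e e0.
have [L hL] := hl (Rabs x + 1) ltac:(have := Rabs_pos x; lra).
have L0 := Rabs_pos L.
exists (Rmin 1 (e / (Rabs L + 1))); split.
  by apply: Rmin_pos; [lra|apply: Rdiv_lt_0_compat; lra].
move=> y [_]; rewrite /= /Rdist => hy.
have m1 := Rmin_l 1 (e / (Rabs L + 1)); have m2 := Rmin_r 1 (e / (Rabs L + 1)).
have yx : Rabs y <= Rabs x + 1.
  by have := Rabs_triang (y - x) x; rewrite (_ : y - x + x = y); [lra|ring].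
have := hL y x yx ltac:(lra) => h1.
apply: Rle_lt_trans h1 _.
have p := Rabs_pos (y - x); have q := Rle_abs L.
apply: Rle_lt_trans (_ : Rabs L * Rabs (y - x) < _); first by apply: Rmult_le_compat_r.
have {1}-> : e = (Rabs L + 1) * (e / (Rabs L + 1)) by field; lra.
have e1 : 0 < e / (Rabs L + 1) by apply: Rdiv_lt_0_compat; lra.
apply: Rle_lt_trans (_ : Rabs L * (e / (Rabs L + 1)) < _); first by apply: Rmult_le_compat_l; lra.
by apply: Rmult_lt_compat_r; lra.
Qed.

Lemma positive_lower_bound (f : R -> R) a b : continuity f ->
  (forall r, a <= r <= b -> 0 < f r) -> exists c, 0 < c /\ forall r, a <= r <= b -> c <= f r.
Proof.
move=> hf hp; case: (Rle_dec a b) => ab; last by exists 1; split; [lra|move=> r; lra].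
have [x [h1 h2]] := continuity_ab_min f a b ab (fun c _ => hf c).
by exists (f x); split; [exact: hp|].
Qed.

(** Improves the constant bound [m] away from the interface. The profiles start at the common value
    [m0] on both sides, so the exchange condition only asks for a positive slope; stretching them by
    a large [k] makes [D A''] at most half of the minimum [c] of [h]. The amplitude [co] grows from
    [m - m0], where the profile is below [m], to [e b - m0]. *)
Lemma boundary_layer {N} D kap h (w : bool -> Pt N -> R -> R -> R) m0 m (e : bool -> R) K :
  (forall b, 0 < D b) -> (forall b, 0 < kap b) -> (forall b, loc_lipschitz (h b)) ->
  pair_solution D kap h w ->
  0 < K -> (forall b y z t, 0 <= z -> 0 <= t -> Rabs (w b y z t) <= K) ->
  Rabs m0 <= K -> (forall b, Rabs (e b) <= K) -> m0 < m -> (forall b, m < e b) ->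
  (forall b r, m0 <= r <= e b -> 0 < h b r) ->
  eventually_above w (fun _ _ => m) ->
  exists k, 0 < k /\ eventually_above w (fun b z => m0 + (e b - m0) * (1 - exp (- z / k))).
Proof.
move=> D0 k0 hl sol K0 wK mK eK m0m me hpos wm.
pose Dm := D true + D false.
have DD b : 0 < D b <= Dm by rewrite /Dm; have := D0 true; have := D0 false; case: b; lra.
have Dm0 : 0 < Dm by have := DD true; lra.
pose C := (e true - m0) + (e false - m0).
have CC b : 0 < e b - m0 <= C by rewrite /C; have := me true; have := me false; case: b; lra.
have C0 : 0 < C by have := CC true; lra.
have [c [c0 hc]] : exists c, 0 < c /\ forall b r, m0 <= r <= e b -> c <= h b r.
  have hcont b := loc_lipschitz_continuity _ (hl b).
  have [c1 [c10 h1]] := positive_lower_bound _ _ _ (hcont true) (hpos true).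
  have [c2 [c20 h2]] := positive_lower_bound _ _ _ (hcont false) (hpos false).
  exists (Rmin c1 c2); split; first exact: Rmin_pos.
  move=> b r hr; have := Rmin_l c1 c2; have := Rmin_r c1 c2.
  by case: b hr => hr; [have := h1 r hr|have := h2 r hr]; lra.
pose k := 1 + 2 * Dm * C / c.
have DC : 0 < Dm * C by apply: Rmult_lt_0_compat.
have k1 : 0 < 2 * Dm * C / c by apply: Rdiv_lt_0_compat; lra.
have kp : 0 < k by rewrite /k; lra.
have kk : Dm * C / (k * k) <= c / 2.
  have : 2 * Dm * C <= c * (k * k).
    have -> : 2 * Dm * C = c * (2 * Dm * C / c) by field; lra.
    by apply: Rmult_le_compat_l; [lra|rewrite /k; nra].
  move=> q; have k2 : 0 < k * k by nra.
  apply: (Rmult_le_reg_r (k * k)) => //.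
  by rewrite (_ : Dm * C / (k * k) * (k * k) = Dm * C); [lra|field; lra].
exists k; split=> //.
pose co s b := s * (e b - m) + (m - m0).
have coB s b : 0 <= s <= 1 -> 0 < co s b <= e b - m0.
  by move=> hs; rewrite /co; have := me b => q; split; nra.
pose A s b z := m0 + co s b * (1 - exp (- z / k)).
have E z : 0 <= z -> 0 < exp (- z / k) <= 1.
  move=> z0; split; first exact: exp_pos.
  rewrite -exp_0; case: (Req_dec z 0) => [->|zne].
    by rewrite (_ : - 0 / k = 0); [lra|field; lra].
  apply: Rlt_le; apply: exp_increasing.
  have : 0 < z / k by apply: Rdiv_lt_0_compat; lra.
  by rewrite /Rdiv; lra.
have AB s b z : 0 <= s <= 1 -> 0 <= z -> m0 <= A s b z <= e b.
  move=> hs /E hz; have := coB s b hs; rewrite /A => q.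
  split; nra.
have dA s b z : is_derive (A s b) z (co s b / k * exp (- z / k)).
  have : is_derive (fun z => m0 + co s b * (1 - exp (- z / k))) z (co s b / k * exp (- z / k)).
    by auto_derive; [lra|rewrite /Rdiv; field; lra].
  by [].
have d2A s b z : second_deriv (A s b) z (- (co s b / (k * k) * exp (- z / k))).
  apply: (is_derive_second_deriv _ _ _ _ (dA s b)).
  by auto_derive; [lra|rewrite /Rdiv; field; lra].
have := strict_sub_sweep D kap h w A (fun _ _ => m) K (c / 2) 1 D0 k0 hl sol K0 wK.
rewrite /A (_ : co 1 = fun b => e b - m0); last first.
  by apply: functional_extensionality => b; rewrite /co; ring.
apply=> //.
- by move=> s b _; apply: (is_derive_continuity _ _ (dA s b)).
- move=> s b z hs hz; have := AB s b z hs hz; rewrite /A => q.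
  by have := eK b => q2; rabs.
- move=> ep ep0; exists (ep / C); split; first by apply: Rdiv_lt_0_compat.
  move=> s s' b z hs hs' ss hz.
  have -> : m0 + co s b * (1 - exp (- z / k)) - (m0 + co s' b * (1 - exp (- z / k))) =
    (s - s') * ((e b - m) * (1 - exp (- z / k))) by rewrite /co; ring.
  rewrite Rabs_mult (_ : ep = ep / C * C); last by field; lra.
  apply: Rmult_le_compat => //; try exact: Rabs_pos.
  have [e1 e2] := E z hz; have := CC b; have := me b => q1 q2.
  by rewrite Rabs_right; nra.
- lra.
- lra.
- move=> s b z hs hz _; exists (- (co s b / (k * k) * exp (- z / k))); split; first exact: d2A.
  have := hc b _ (AB s b z hs (Rlt_le _ _ hz)); rewrite /A.
  suff : D b * (co s b / (k * k) * exp (- z / k)) <= Dm * C / (k * k) by lra.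
  have -> : Dm * C / (k * k) = Dm * (C / (k * k) * 1) by field; lra.
  have k2 : 0 < / (k * k) by apply: Rinv_0_lt_compat; nra.
  have [q1 q2] := coB s b hs; have [q3 q4] := E z (Rlt_le _ _ hz).
  have [q5 q6] := DD b; have [q7 q8] := CC b.
  have q9 : 0 <= co s b / (k * k) by apply: Rmult_le_pos; lra.
  apply: Rmult_le_compat; [lra|by apply: Rmult_le_pos; lra|lra|].
  by apply: Rmult_le_compat; [lra|lra|apply: Rmult_le_compat_r; lra|lra].
- move=> s b hs _; exists (co s b / k * exp (- 0 / k)); split.
    exact: (is_derive_rderiv _ _ _ (dA s b 0)).
  have -> : - 0 / k = 0 by field; lra.
  rewrite exp_0 Rminus_diag !Rmult_0_r Rminus_diag Rmult_1_r.
  apply: Rmult_lt_0_compat; first exact: k0.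
  by apply: Rdiv_lt_0_compat => //; have := coB s b hs; lra.
- apply: eventually_above_le wm _ => b z z0.
  by rewrite /co Rmult_0_l Rplus_0_l; have := E z z0; nra.
Qed.

(** * One-dimensional profiles *)

(** Global bounds and signs make [RInt h r e] a potential well with its bottom at [e], so that
    profiles exist for every boundary value; the given nonlinearities are clamped to reach this
    form. *)
Definition restoring (h : R -> R) (e L : R) : Prop :=
  0 < L /\ (forall r s, Rabs (h r - h s) <= L * Rabs (r - s)) /\ h e = 0 /\
  (forall r, r < e -> 0 < h r) /\ (forall r, e < r -> h r < 0).

Lemma lipschitz_loc (h : R -> R) L :
  (forall r s, Rabs (h r - h s) <= L * Rabs (r - s)) -> loc_lipschitz h.
Proof. by move=> hL K K0; exists L => r s _ _. Qed.

Lemma lipschitz_continuity (h : R -> R) L :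
  (forall r s, Rabs (h r - h s) <= L * Rabs (r - s)) -> continuity h.
Proof. by move=> hL; apply: loc_lipschitz_continuity; apply: lipschitz_loc hL. Qed.

Lemma is_derive_potential (h : R -> R) e r : continuity h ->
  is_derive (fun r => RInt h r e) r (- h r).
Proof.
move=> hc.
have cc x : continuous h x by apply/continuity_pt_filterlim; apply: hc.
apply: (is_derive_RInt' h (fun r => RInt h r e) r e) => //.
apply: filter_forall => x; apply: RInt_correct.
by apply: ex_RInt_continuous => z _.
Qed.

Lemma potential_mvt (h : R -> R) e a b : continuity h -> a < b ->
  exists c, a < c < b /\ RInt h b e - RInt h a e = - h c * (b - a).
Proof.
move=> hc ab.
have [c [h1 h2]] := MVT_cor2 (fun r => RInt h r e) (fun r => - h r) a b ab
  (fun c _ => proj1 (is_derive_Reals _ _ _) (is_derive_potential h e c hc)).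
by exists c.
Qed.

(* The profiles satisfy [A' = - speed (A)], which is the energy identity
   [D A'^2 / 2 = \int_A^e h]; the two square roots are never both nonzero. *)
Definition speed (D : R) (h : R -> R) (e r : R) : R :=
  sqrt (2 / D * RInt h (Rmax r e) e) - sqrt (2 / D * RInt h (Rmin r e) e).

Lemma potential_point (h : R -> R) e : RInt h e e = 0.
Proof. exact: RInt_point. Qed.

Lemma speed_left D h e r : r <= e -> speed D h e r = - sqrt (2 / D * RInt h r e).
Proof.
by move=> re; rewrite /speed Rmax_right // Rmin_left // potential_point Rmult_0_r sqrt_0; ring.
Qed.

Lemma speed_right D h e r : e <= r -> speed D h e r = sqrt (2 / D * RInt h r e).
Proof.
by move=> re; rewrite /speed Rmax_left // Rmin_right // potential_point Rmult_0_r sqrt_0; ring.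
Qed.

Lemma restoring_continuity h e L : restoring h e L -> continuity h.
Proof. by case=> _ [hL _]; apply: lipschitz_continuity hL. Qed.

Lemma potential_bounds h e L r : restoring h e L ->
  0 <= RInt h r e <= L * ((r - e) * (r - e)) /\ (r <> e -> 0 < RInt h r e).
Proof.
move=> hr; have hc := restoring_continuity _ _ _ hr.
case: hr => L0 [hL [he [h1 h2]]].
have hb c : Rabs (h c) <= L * Rabs (c - e) by rewrite -{1}[h c]Rminus_0_r -he.
case: (total_order_T r e) => [[lt|->]|gt].
- have [c [cr eq]] := potential_mvt h e r e hc lt.
  have := h1 c ltac:(lra); have := hb c.
  rewrite (Rabs_left (c - e)); last lra.
  rewrite potential_point in eq => q1 q2; rewrite Rabs_right in q1; last lra.
  have q3 : 0 < h c * (e - r) by apply: Rmult_lt_0_compat; lra.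
  have q4 : h c * (e - r) <= L * (e - r) * (e - r).
    apply: Rmult_le_compat_r; first lra.
    by apply: Rle_trans q1 _; apply: Rmult_le_compat_l; lra.
  by split; lra.
- by rewrite potential_point Rminus_diag !Rmult_0_r; split; [lra|].
- have [c [cr eq]] := potential_mvt h e e r hc gt.
  have := h2 c ltac:(lra); have := hb c.
  rewrite (Rabs_right (c - e)); last lra.
  rewrite potential_point in eq => q1 q2; rewrite Rabs_left in q1; last lra.
  have q3 : 0 < - h c * (r - e) by apply: Rmult_lt_0_compat; lra.
  have q4 : - h c * (r - e) <= L * (r - e) * (r - e).
    apply: Rmult_le_compat_r; first lra.
    by apply: Rle_trans q1 _; apply: Rmult_le_compat_l; lra.
  by split; lra.
Qed.

Lemma speed_at_zero D h e : speed D h e e = 0.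
Proof. by rewrite speed_left ?potential_point ?Rmult_0_r ?sqrt_0; lra. Qed.

Lemma speed_sign D h e L r : 0 < D -> restoring h e L ->
  (r < e -> speed D h e r < 0) /\ (e < r -> 0 < speed D h e r).
Proof.
move=> D0 hr; have [_ q] := potential_bounds h e L r hr.
have d2 : 0 < 2 / D by apply: Rdiv_lt_0_compat; lra.
split=> lt.
- rewrite speed_left; last lra.
  by have := sqrt_lt_R0 (2 / D * RInt h r e) ltac:(apply: Rmult_lt_0_compat; [|apply: q]; lra); lra.
- rewrite speed_right; last lra.
  by apply: sqrt_lt_R0; apply: Rmult_lt_0_compat; [|apply: q]; lra.
Qed.

Lemma speed_increasing D h e L r s : 0 < D -> restoring h e L -> r < s ->
  speed D h e r < speed D h e s.
Proof.
move=> D0 hr rs; have hc := restoring_continuity _ _ _ hr.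
have d2 : 0 < 2 / D by apply: Rdiv_lt_0_compat; lra.
have Q x := proj1 (proj1 (potential_bounds h e L x hr)).
have Qd x : 0 <= 2 / D * RInt h x e by apply: Rmult_le_pos; [lra|exact: Q].
have [s1 s2] := speed_sign D h e L r D0 hr.
have [s3 s4] := speed_sign D h e L s D0 hr.
have s0 := speed_at_zero D h e.
case: (total_order_T s e) => [[lt|se]|gt].
- rewrite !speed_left; try lra.
  suff : sqrt (2 / D * RInt h s e) < sqrt (2 / D * RInt h r e) by lra.
  apply: sqrt_lt_1_alt; split; first exact: Qd.
  apply: Rmult_lt_compat_l => //.
  have [c [cr eq]] := potential_mvt h e r s hc rs.
  case: hr => _ [_ [_ [h1 _]]]; have := h1 c ltac:(lra) => q.
  have : 0 < h c * (s - r) by apply: Rmult_lt_0_compat; lra.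
  lra.
- by rewrite se s0; apply: s1; lra.
- case: (Rle_dec r e) => re.
    have := s4 gt; case: (Req_dec r e) => [->|ne]; first lra.
    by have := s1 ltac:(lra); lra.
  rewrite !speed_right; try lra.
  apply: sqrt_lt_1_alt; split; first exact: Qd.
  apply: Rmult_lt_compat_l => //.
  have [c [cr eq]] := potential_mvt h e r s hc rs.
  case: hr => _ [_ [_ [_ h1]]]; have := h1 c ltac:(lra) => q.
  have : 0 < - h c * (s - r) by apply: Rmult_lt_0_compat; lra.
  lra.
Qed.

(** The potential is at most quadratic near [e]. This bound keeps a profile from reaching [e] at a
    finite [z]. *)
Lemma speed_linear_bound D h e L r : 0 < D -> restoring h e L ->
  Rabs (speed D h e r) <= sqrt (2 / D * L) * Rabs (r - e).
Proof.
move=> D0 hr; have [[q1 q2] _] := potential_bounds h e L r hr.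
have d2 : 0 < 2 / D by apply: Rdiv_lt_0_compat; lra.
have L0 : 0 < L by case: hr.
have : sqrt (2 / D * RInt h r e) <= sqrt (2 / D * L) * Rabs (r - e).
  rewrite -sqrt_Rsqr_abs -sqrt_mult; [|by apply: Rmult_le_pos; lra|exact: Rle_0_sqr].
  apply: sqrt_le_1_alt; rewrite Rmult_assoc; apply: Rmult_le_compat_l; first lra.
  exact: q2.
move=> q3; have p := sqrt_pos (2 / D * RInt h r e).
case: (Rle_dec r e) => re.
- by rewrite speed_left // Rabs_Ropp Rabs_right //; lra.
- by rewrite speed_right; last lra; rewrite Rabs_right; lra.
Qed.

Lemma speed_continuity D h e L : 0 < D -> restoring h e L -> continuity (speed D h e).
Proof.
move=> D0 hr x; have hc := restoring_continuity _ _ _ hr.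
have d2 : 0 < 2 / D by apply: Rdiv_lt_0_compat; lra.
have cP f : continuity_pt f x -> continuity_pt (fun r => sqrt (2 / D * RInt h (f r) e)) x.
  move=> hf; apply: (continuity_pt_comp (fun r => 2 / D * RInt h (f r) e) sqrt).
    apply: (continuity_pt_scal (fun r => RInt h (f r) e)).
    apply: (continuity_pt_comp f (fun r => RInt h r e)) => //.
    by apply: (is_derive_continuity _ _ (fun r => is_derive_potential h e r hc)).
  apply: continuity_pt_sqrt; apply: Rmult_le_pos; first lra.
  by have := proj1 (potential_bounds h e L (f x) hr); lra.
have cmax : continuity_pt (fun r => Rmax r e) x.
  apply: (lipschitz_continuity _ 1) => r s; rewrite Rmult_1_l.
  rewrite /Rmax; do 2 case: Rle_dec => ? /=; apply: Rabs_le;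
    by have := Rle_abs (r - s); have := Rle_abs (- (r - s)); rewrite Rabs_Ropp; lra.
have cmin : continuity_pt (fun r => Rmin r e) x.
  apply: (lipschitz_continuity _ 1) => r s; rewrite Rmult_1_l.
  rewrite /Rmin; do 2 case: Rle_dec => ? /=; apply: Rabs_le;
    by have := Rle_abs (r - s); have := Rle_abs (- (r - s)); rewrite Rabs_Ropp; lra.
exact: (continuity_pt_minus _ _ _ (cP _ cmax) (cP _ cmin)).
Qed.

(** Separation of variables, which works for merely continuous [k]. The travel time [T], a primitive
    of [/ k], has slope at least [/ C], hence is onto with a Lipschitz inverse [J]; then
    [J' = k (J)], and [Y z = J (- z)]. *)
Lemma autonomous_ode (k : R -> R) C y0 : continuity k -> (forall y, 0 < k y <= C) ->
  exists Y, Y 0 = y0 /\ forall z, is_derive Y z (- k (Y z)).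
Proof.
move=> kc kb.
have C0 : 0 < C by have := kb 0; lra.
have ic : continuity (fun y => / k y).
  by move=> y; apply: continuity_pt_inv => //; have := kb y; lra.
pose T y := - RInt (fun y => / k y) y y0.
have dT y : is_derive T y (/ k y).
  rewrite -[/ k y]Ropp_involutive; apply: (is_derive_opp (fun y => RInt (fun y => / k y) y y0)).
  exact: (is_derive_potential (fun y => / k y)).
have T0 : T y0 = 0 by rewrite /T potential_point; ring.
have Tinc y1 y2 : y1 < y2 -> (y2 - y1) / C <= T y2 - T y1.
  move=> lt; have [c [eq cr]] := MVT_cor2 T (fun y => / k y) y1 y2 lt
    (fun c _ => proj1 (is_derive_Reals _ _ _) (dT c)).
  rewrite eq /Rdiv (Rmult_comm (y2 - y1)); apply: Rmult_le_compat_r; first lra.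
  by apply: Rinv_le_contravar; have := kb c; lra.
have Tc : continuity T := is_derive_continuity _ _ dT.
have surj x : exists y, T y = x.
  pose a := y0 - C * (Rabs x + 1); pose b := y0 + C * (Rabs x + 1).
  have xp := Rabs_pos x; have Cx : 0 < C * (Rabs x + 1) by apply: Rmult_lt_0_compat; lra.
  have h1 := Tinc a y0 ltac:(rewrite /a; lra); have h2 := Tinc y0 b ltac:(rewrite /b; lra).
  rewrite T0 (_ : (y0 - a) / C = Rabs x + 1) in h1; last by rewrite /a; field; lra.
  rewrite T0 (_ : (b - y0) / C = Rabs x + 1) in h2; last by rewrite /b; field; lra.
  have h3 := Rle_abs x; have h4 := Rle_abs (- x); rewrite Rabs_Ropp in h4.
  have [y [_ hy]] := IVT_gen T a b x Tc
    ltac:(split; [apply: Rle_trans (Rmin_l _ _) _|apply: Rle_trans _ (Rmax_r _ _)]; lra).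
  by exists y.
have [J hJ] := functional_choice _ surj.
have Jlip x x' : Rabs (J x - J x') <= C * Rabs (x - x').
  have key u v : u < v -> v - u <= C * (T v - T u).
    move=> lt; have := Rmult_le_compat_l C _ _ (Rlt_le _ _ C0) (Tinc u v lt).
    by rewrite (_ : C * ((v - u) / C) = v - u); [lra|field; lra].
  case: (total_order_T (J x) (J x')) => [[lt|->]|gt].
  - have := key _ _ lt; rewrite !hJ => q; rewrite (Rabs_left (_ - _)); last lra.
    apply: Rle_trans (_ : C * (x' - x) <= _); first lra.
    by apply: Rmult_le_compat_l; [lra|rewrite Rabs_minus_sym; exact: Rle_abs].
  - by rewrite Rminus_diag Rabs_R0; apply: Rmult_le_pos; [lra|exact: Rabs_pos].
  - have := key _ _ gt; rewrite !hJ => q; rewrite (Rabs_right (_ - _)); last lra.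
    apply: Rle_trans (_ : C * (x - x') <= _); first lra.
    by apply: Rmult_le_compat_l; [lra|exact: Rle_abs].
have Jinj x x' : J x = J x' -> x = x' by rewrite -{2}(hJ x) -{2}(hJ x') => ->.
have dJ x : derivable_pt_lim J x (k (J x)).
  move=> ep ep0.
  have [kp kC] := kb (J x).
  have Ck : 0 < C * k (J x) by apply: Rmult_lt_0_compat.
  have ep1 : 0 < ep / (C * k (J x)) by apply: Rdiv_lt_0_compat.
  have [[d d0] /= hd] := proj1 (is_derive_Reals _ _ _) (dT (J x)) _ ep1.
  have d1 : 0 < d / C by apply: Rdiv_lt_0_compat.
  exists (mkposreal _ d1) => r rne /= rd.
  have ne : J (x + r) - J x <> 0.
    by move=> q; have := Jinj (x + r) x ltac:(lra); lra.
  have jl := Jlip (x + r) x; rewrite (_ : x + r - x = r) in jl; last ring.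
  have small : Rabs (J (x + r) - J x) < d.
    apply: Rle_lt_trans jl _; rewrite (_ : d = C * (d / C)); last by field; lra.
    by apply: Rmult_lt_compat_l.
  have := hd _ ne small.
  rewrite (_ : J x + (J (x + r) - J x) = J (x + r)); last ring.
  rewrite !hJ (_ : x + r - x = r); last ring.
  move=> h1.
  have -> : (J (x + r) - J x) / r - k (J x) =
     - ((J (x + r) - J x) / r * k (J x) * (r / (J (x + r) - J x) - / k (J x))).
    by field; lra.
  rewrite Rabs_Ropp Rabs_mult (Rabs_mult ((J (x + r) - J x) / r)) (Rabs_right (k _)); last lra.
  have q1 : Rabs ((J (x + r) - J x) / r) <= C.
    have rp : 0 < Rabs r by apply: Rabs_pos_lt.
    rewrite Rabs_div //; apply: (Rmult_le_reg_r (Rabs r)) => //.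
    rewrite (_ : _ / Rabs r * Rabs r = Rabs (J (x + r) - J x)); first lra.
    by field; lra.
  apply: Rle_lt_trans (_ : C * k (J x) * Rabs (r / (J (x + r) - J x) - / k (J x)) < _).
    apply: Rmult_le_compat_r; first exact: Rabs_pos.
    by apply: Rmult_le_compat_r; lra.
  apply: Rlt_le_trans (Rmult_lt_compat_l _ _ _ Ck h1) _.
  by apply: Req_le; field; lra.
have J0 : J 0 = y0.
  have key u v : u < v -> T u < T v.
    by move=> lt; have := Tinc u v lt; have : 0 < (v - u) / C by [apply: Rdiv_lt_0_compat; lra]; lra.
  have := hJ 0; rewrite -{2}T0.
  by case: (total_order_T (J 0) y0) => [[/key|//]|/key]; lra.
exists (fun z => J (- z)); split; first by rewrite Ropp_0.
move=> z; evar_last.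
  apply: (is_derive_comp J Ropp); first by apply/is_derive_Reals; exact: dJ.
  by apply: (is_derive_opp (fun z => z)); apply: is_derive_id.
by rewrite /scal /= /mult /= /opp /one /=; ring.
Qed.

(** If [X z1 > 0], subtract [X] from the line of slope [c = X z1 / (2 z1)]. The minimum of the
    difference on [[0, z1]] is negative, so it lies at a positive abscissa where [X > 0]; there the
    left test gives [X' >= c > 0]. *)
Lemma nonpositive_of_derive (X X' : R -> R) Z :
  (forall z, is_derive X z (X' z)) -> X 0 <= 0 ->
  (forall z, 0 <= z <= Z -> 0 < X z -> X' z <= 0) -> forall z, 0 <= z <= Z -> X z <= 0.
Proof.
move=> dX X0 hX z1 hz1; apply: Rnot_lt_le => pos.
have z1p : 0 < z1 by case: (Req_dec z1 0) => [q|]; [rewrite q in pos; lra|lra].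
pose c := X z1 / (2 * z1).
have c0 : 0 < c by apply: Rdiv_lt_0_compat; lra.
have cz : c * z1 = X z1 / 2 by rewrite /c; field; lra.
pose G z := c * z - X z.
have dG z : is_derive G z (c - X' z).
  apply: (is_derive_minus (fun z => c * z) X); last exact: dX.
  by auto_derive; [done|ring].
have [x [h1 h2]] := continuity_ab_min G 0 z1 ltac:(lra) (fun r _ => is_derive_continuity _ _ dG r).
have h3 := h1 z1 ltac:(lra).
have Xx : 0 < X x.
  have : 0 <= c * x by apply: Rmult_le_pos; lra.
  by rewrite /G in h3; lra.
have xp : 0 < x by case: (Req_dec x 0) => [q|]; [rewrite q in Xx; lra|lra].
have := derivable_pt_lim_left_min G 0 x _ (proj1 (is_derive_Reals _ _ _) (dG x)).
have := hX x ltac:(lra) Xx.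
move=> q1 q2; have : c - X' x <= 0 * G x; last lra.
apply: q2; exists x; split=> // s hs.
by rewrite Ropp_0 !Rmult_0_l exp_0 !Rmult_1_l; apply: h1; lra.
Qed.

(** Where [A] is ahead of [B], monotonicity of [psi] makes [A] decrease at least as fast as [B], up
    to the discrepancy [ep]. The error is therefore linear in [z], without the exponential of a
    Gronwall estimate. *)
Lemma flow_le (phi psi A B : R -> R) d ep Z :
  (forall r s, r <= s -> psi r <= psi s) ->
  (forall z, is_derive A z (- phi (A z))) -> (forall z, is_derive B z (- psi (B z))) ->
  (forall z, 0 <= z <= Z -> psi (A z) - ep <= phi (A z)) ->
  0 <= ep -> 0 <= d -> A 0 <= B 0 + d ->
  forall z, 0 <= z <= Z -> A z <= B z + d + ep * z.
Proof.
move=> mono dA dB hph ep0 d0 h0 z hz.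
pose X z := A z - B z - (d + ep * z).
have dX r : is_derive X r (- phi (A r) - - psi (B r) - ep).
  apply: (is_derive_minus (fun z => A z - B z) (fun z => d + ep * z)).
    by apply: (is_derive_minus A B).
  by auto_derive; [done|ring].
suff : X z <= 0 by rewrite /X; lra.
apply: (nonpositive_of_derive X _ Z dX) => //; first by rewrite /X; lra.
move=> r hr Xr.
have er : 0 <= ep * r by apply: Rmult_le_pos; lra.
have := mono (B r) (A r) ltac:(rewrite /X in Xr; lra); have := hph r hr; lra.
Qed.

Lemma flow_ge (phi psi A B : R -> R) d ep Z :
  (forall r s, r <= s -> psi r <= psi s) ->
  (forall z, is_derive A z (- phi (A z))) -> (forall z, is_derive B z (- psi (B z))) ->
  (forall z, 0 <= z <= Z -> phi (A z) <= psi (A z) + ep) ->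
  0 <= ep -> 0 <= d -> B 0 - d <= A 0 ->
  forall z, 0 <= z <= Z -> B z - d - ep * z <= A z.
Proof.
move=> mono dA dB hph ep0 d0 h0 z hz.
have dopp (F f : R -> R) r : is_derive F r (- f (F r)) ->
    is_derive (fun z => - F z) r (- (fun q => - f (- q)) (- F r)).
  by move=> hF /=; rewrite (Ropp_involutive (F r)); apply: (is_derive_opp F).
have := flow_le (fun q => - phi (- q)) (fun q => - psi (- q)) (fun z => - A z) (fun z => - B z)
  d ep Z.
move=> H; suff : - A z <= - B z + d + ep * z by lra.
apply: H => //.
- by move=> r s rs; have := mono (- s) (- r) ltac:(lra); lra.
- by move=> r; apply: dopp.
- by move=> r; apply: dopp.
- by move=> r hr /=; rewrite Ropp_involutive; have := hph r hr; lra.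
- lra.
Qed.

(** The last clause is [D A'' + h (A) = 0]. It is not derived from the first-order equation by the
    chain rule because [speed] is not known to be differentiable at [e]. *)
Definition is_profile (D : R) (h : R -> R) (e p : R) (A : R -> R) : Prop :=
  A 0 = p /\ (forall z, is_derive A z (- speed D h e (A z))) /\
  (forall z, is_derive (fun s => - speed D h e (A s)) z (- h (A z) / D)).

Lemma speed_monotone D h e L : 0 < D -> restoring h e L ->
  forall r s, r <= s -> speed D h e r <= speed D h e s.
Proof.
move=> D0 hr r s [lt|->]; last lra.
by apply: Rlt_le; apply: speed_increasing hr lt.
Qed.

(** The logarithm [Y] of the distance to [e] solves an autonomous equation with rate in [(0, C]], so
    the profile never reaches [e] and approaches it at most exponentially fast. The explicit upper
    bound serves to put profiles with very negative boundary values below a given constant on a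
    given interval. *)
Lemma profile_exists D h e L p : 0 < D -> restoring h e L -> exists A, is_profile D h e p A /\
  (p < e -> forall z, 0 <= z -> A z <= e - (e - p) * exp (- (sqrt (2 / D * L) * z))).
Proof.
move=> D0 hr.
pose C := sqrt (2 / D * L).
have d2 : 0 < 2 / D by apply: Rdiv_lt_0_compat; lra.
have L0 : 0 < L by case: hr.
have C0 : 0 < C by apply: sqrt_lt_R0; apply: Rmult_lt_0_compat; lra.
have hc := restoring_continuity _ _ _ hr.
have branch sg q : (sg = 1 \/ sg = -1) -> 0 < sg * q ->
    exists A, A 0 = e + q /\ (forall z, is_derive A z (- speed D h e (A z))) /\
      (forall z, 0 < sg * (A z - e)) /\
      (forall z, 0 <= z -> sg * q * exp (- (C * z)) <= sg * (A z - e)).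
  move=> hs hq.
  (* From [A = e + sg exp (Y)] and [A' = - speed (A)]; the sign [sg] tells on which side of [e] the
     profile runs. *)
  pose k y := sg * speed D h e (e + sg * exp y) * exp (- y).
  have kb y : 0 < k y <= C.
    have ep := exp_pos y; have ep' := exp_pos (- y).
    have ee : exp y * exp (- y) = 1 by rewrite -exp_plus Rplus_opp_r exp_0.
    have [s1 s2] := speed_sign D h e L (e + sg * exp y) D0 hr.
    have := speed_linear_bound D h e L (e + sg * exp y) D0 hr.
    rewrite -/C (_ : e + sg * exp y - e = sg * exp y); last ring.
    rewrite Rabs_mult (Rabs_right (exp y)); last lra.
    rewrite (_ : Rabs sg = 1) ?Rmult_1_l => [lb|]; last first.
      by case: hs => ->; [rewrite Rabs_R1|rewrite Rabs_left; lra].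
    have sS : 0 < sg * speed D h e (e + sg * exp y) <= C * exp y.
      by case: hs => sE; subst sg; [have := s2 ltac:(lra)|have := s1 ltac:(lra)] => q0; rabs.
    rewrite /k; have {1}-> : C = C * exp y * exp (- y) by rewrite Rmult_assoc ee; ring.
    by split; [apply: Rmult_lt_0_compat; lra|apply: Rmult_le_compat_r; lra].
  have kc : continuity k.
    move=> y; apply: continuity_pt_mult; last first.
      apply: (is_derive_continuity (fun y => exp (- y)) (fun y => - exp (- y))) => x.
      by auto_derive; [done|ring].
    apply: (continuity_pt_scal (fun y => speed D h e (e + sg * exp y))).
    apply: (continuity_pt_comp (fun y => e + sg * exp y) (speed D h e)).
      apply: (is_derive_continuity (fun y => e + sg * exp y) (fun y => sg * exp y)) => x.
      by auto_derive; [done|ring].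
    exact: (speed_continuity D h e L).
  have [Y [Y0 dY]] := autonomous_ode k C (ln (sg * q)) kc kb.
  exists (fun z => e + sg * exp (Y z)); split; last split; last split.
  - by rewrite Y0 exp_ln //; case: hs => ->; ring.
  - move=> z; evar_last.
      apply: (is_derive_plus (fun _ => e) (fun z => sg * exp (Y z))).
        exact: is_derive_const.
      apply: (is_derive_scal (fun z => exp (Y z)) z sg).
      apply: (is_derive_comp exp Y); last exact: dY.
      by apply/is_derive_Reals; exact: derivable_pt_lim_exp.
    rewrite /plus /zero /scal /= /mult /= /k.
    have ee : exp (Y z) * exp (- Y z) = 1 by rewrite -exp_plus Rplus_opp_r exp_0.
    have ss : sg * sg = 1 by case: hs => ->; ring.
    set S := speed D h e _.
    have -> : 0 + sg * (- (sg * S * exp (- Y z)) * exp (Y z)) =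
      - (sg * sg * S * (exp (Y z) * exp (- Y z))) by ring.
    by rewrite ss ee; ring.
  - move=> z; have := exp_pos (Y z) => ep.
    by case: hs => ->; lra.
  - move=> z z0.
    have -> : sg * (e + sg * exp (Y z) - e) = exp (Y z) by case: hs => ->; ring.
    have {1}-> : sg * q = exp (Y 0) by rewrite Y0 exp_ln.
    rewrite -exp_plus.
    have : Y 0 + - (C * z) <= Y z.
      case: (Req_dec z 0) => [->|zne]; first lra.
      have [c [eq _]] := MVT_cor2 Y (fun r => - k (Y r)) 0 z ltac:(lra)
        (fun r _ => proj1 (is_derive_Reals _ _ _) (dY r)).
      have := kb (Y c) => -[_ q1].
      by have := Rmult_le_compat_r z _ _ z0 q1; lra.
    by case=> [lt|->]; [left; apply: exp_increasing|right].
(* Off [e] the speed is, up to sign, the square root of a positive differentiable function; along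
   [A] the root in the denominator cancels against [A']. *)
have second (A : R -> R) : (forall z, is_derive A z (- speed D h e (A z))) ->
    forall s2, (s2 = 1 \/ s2 = -1) ->
    (forall r, 0 < s2 * (r - e) -> speed D h e r = s2 * sqrt (2 / D * RInt h r e)) ->
    (forall z, 0 < s2 * (A z - e)) ->
    forall z, is_derive (fun s => - speed D h e (A s)) z (- h (A z) / D).
  move=> dA s2 hs2 sp pos z.
  apply: (is_derive_ext (fun s => - s2 * sqrt (2 / D * RInt h (A s) e))).
    by move=> t; rewrite (sp (A t) (pos t)) /=; ring.
  have Q0 : 0 < 2 / D * RInt h (A z) e.
    apply: Rmult_lt_0_compat => //; apply: (proj2 (potential_bounds h e L (A z) hr)).
    by move=> q; have := pos z; rewrite q Rminus_diag; lra.
  have sq := sqrt_lt_R0 _ Q0.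
  evar_last.
    apply: (is_derive_scal (fun s => sqrt (2 / D * RInt h (A s) e)) z (- s2)).
    apply: (is_derive_comp sqrt (fun s => 2 / D * RInt h (A s) e)).
      by apply/is_derive_Reals; exact: derivable_pt_lim_sqrt.
    apply: (is_derive_scal (fun s => RInt h (A s) e) z (2 / D)).
    apply: (is_derive_comp (fun r => RInt h r e) A); last exact: dA.
    exact: is_derive_potential.
  rewrite /scal /= /mult /= (sp (A z) (pos z)).
  have ss : s2 * s2 = 1 by case: hs2 => ->; ring.
  set S := sqrt _ in sq *.
  have -> : - s2 * (2 / D * (- (s2 * S) * - h (A z)) * / (2 * S)) = - (s2 * s2) * h (A z) / D.
    by field; lra.
  by rewrite ss; field; lra.
case: (total_order_T p e) => [[lt|pe]|gt].
- have [A [h1 [h2 [h3 h4]]]] := branch (-1) (p - e) ltac:(right; lra) ltac:(lra).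
  exists A; split; last by move=> _ z z0; have := h4 z z0; rewrite -/C; lra.
  split; first lra; split=> //.
  apply: (second A h2 (-1)) => //; first by right.
  by move=> r hr'; rewrite speed_left; lra.
- exists (fun _ => e); split; last lra.
  have s0 := speed_at_zero D h e.
  split; first lra; split=> z; rewrite s0.
  + by rewrite Ropp_0; apply: is_derive_const.
  + have -> : h e = 0 by case: hr => _ [_ [-> _]].
    by rewrite (_ : - 0 / D = 0); [apply: is_derive_const|field; lra].
- have [A [h1 [h2 [h3 h4]]]] := branch 1 (p - e) ltac:(left; lra) ltac:(lra).
  exists A; split; last lra.
  split; first lra; split=> //.
  apply: (second A h2 1) => //; first by left.
  by move=> r hr'; rewrite speed_right; lra.
Qed.

Lemma profile_between D h e L p A : 0 < D -> restoring h e L -> is_profile D h e p A ->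
  forall z, 0 <= z -> Rmin p e <= A z <= Rmax p e.
Proof.
move=> D0 hr [A0 [dA _]] z z0.
have mono := speed_monotone D h e L D0 hr.
have de z' : is_derive (fun _ : R => e) z' (- speed D h e e).
  by rewrite speed_at_zero Ropp_0; apply: is_derive_const.
have m1 := Rmin_l p e; have m2 := Rmin_r p e; have m3 := Rmax_l p e; have m4 := Rmax_r p e.
have := flow_le (speed D h e) (speed D h e) A (fun _ => e) (Rmax p e - e) 0 z mono dA de
  ltac:(move=> *; lra) ltac:(lra) ltac:(lra) ltac:(lra) z ltac:(lra).
have := flow_ge (speed D h e) (speed D h e) A (fun _ => e) (e - Rmin p e) 0 z mono dA de
  ltac:(move=> *; lra) ltac:(lra) ltac:(lra) ltac:(lra) z ltac:(lra).
lra.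
Qed.

Lemma profile_contraction D h e L p q A B : 0 < D -> restoring h e L ->
  is_profile D h e p A -> is_profile D h e q B ->
  forall z, 0 <= z -> Rabs (A z - B z) <= Rabs (p - q).
Proof.
move=> D0 hr [A0 [dA _]] [B0 [dB _]] z z0.
have mono := speed_monotone D h e L D0 hr.
have m1 := Rle_abs (p - q); have m2 := Rle_abs (- (p - q)); rewrite Rabs_Ropp in m2.
have := flow_le (speed D h e) (speed D h e) A B (Rabs (p - q)) 0 z mono dA dB
  ltac:(move=> *; lra) ltac:(lra) (Rabs_pos _) ltac:(lra) z ltac:(lra).
have := flow_ge (speed D h e) (speed D h e) A B (Rabs (p - q)) 0 z mono dA dB
  ltac:(move=> *; lra) ltac:(lra) (Rabs_pos _) ltac:(lra) z ltac:(lra).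
by move=> q1 q2; apply: Rabs_le; lra.
Qed.

(** * Perturbed nonlinearities *)

Definition lipschitz (L : R) (f : R -> R) : Prop :=
  forall r s, Rabs (f r - f s) <= L * Rabs (r - s).

Lemma lipschitz_max L f g : lipschitz L f -> lipschitz L g ->
  lipschitz L (fun r => Rmax (f r) (g r)).
Proof.
move=> hf hg r s; have := hf r s; have := hg r s => q1 q2.
by rewrite /Rmax; do 2 case: Rle_dec => ? /=; rabs.
Qed.

Lemma lipschitz_min L f g : lipschitz L f -> lipschitz L g ->
  lipschitz L (fun r => Rmin (f r) (g r)).
Proof.
move=> hf hg r s; have := hf r s; have := hg r s => q1 q2.
by rewrite /Rmin; do 2 case: Rle_dec => ? /=; rabs.
Qed.

Lemma lipschitz_weaken L L' f : L <= L' -> lipschitz L f -> lipschitz L' f.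
Proof.
by move=> le hf r s; apply: Rle_trans (hf r s) _; apply: Rmult_le_compat_r; [exact: Rabs_pos|].
Qed.

Lemma lipschitz_const L c : 0 <= L -> lipschitz L (fun _ => c).
Proof. by move=> L0 r s; rewrite Rminus_diag Rabs_R0; apply: Rmult_le_pos; [|exact: Rabs_pos]. Qed.

Lemma lipschitz_id : lipschitz 1 (fun r => r).
Proof. by move=> r s; lra. Qed.

Lemma lipschitz_comp1 L f g : 0 <= L -> lipschitz L f -> lipschitz 1 g ->
  lipschitz L (fun r => f (g r)).
Proof.
move=> L0 hf hg r s; apply: Rle_trans (hf _ _) _; apply: Rmult_le_compat_l => //.
by have := hg r s; lra.
Qed.

Lemma lipschitz_plus L L' f g : lipschitz L f -> lipschitz L' g ->
  lipschitz (L + L') (fun r => f r + g r).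
Proof.
move=> hf hg r s; have := hf r s; have := hg r s => q1 q2.
rewrite (_ : _ - _ = (f r - f s) + (g r - g s)); last ring.
by apply: Rle_trans (Rabs_triang _ _) _; lra.
Qed.

Definition clamp (a b r : R) : R := Rmax a (Rmin r b).

Lemma clamp_id a b r : a <= r <= b -> clamp a b r = r.
Proof. by move=> h; rewrite /clamp Rmin_left ?Rmax_right; lra. Qed.

Lemma clamp_in a b r : a <= b -> a <= clamp a b r <= b.
Proof.
move=> ab; rewrite /clamp; split; first exact: Rmax_l.
by apply: Rmax_lub => //; exact: Rmin_r.
Qed.

Lemma clamp_lipschitz a b : lipschitz 1 (clamp a b).
Proof.
apply: (lipschitz_max 1 (fun _ => a)); first by apply: lipschitz_const; lra.
by apply: (lipschitz_min 1 (fun r => r)); [exact: lipschitz_id|apply: lipschitz_const; lra].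
Qed.

Lemma clamp_below a b e r : a < e -> e <= b -> r < e -> clamp a b r < e.
Proof.
move=> ae eb re; rewrite /clamp; apply: Rmax_lub_lt => //.
by apply: Rle_lt_trans (Rmin_l _ _) re.
Qed.

Lemma clamp_above a b e r : a <= e -> e < b -> e < r -> e < clamp a b r.
Proof.
move=> ae eb er; apply: Rlt_le_trans (Rmax_r _ _).
by apply: Rmin_glb_lt.
Qed.

Lemma loc_lipschitz_clamp h a b : loc_lipschitz h -> a <= b ->
  exists L, 0 < L /\ lipschitz L (fun r => h (clamp a b r)).
Proof.
move=> hl ab.
have [L hL] := hl (Rabs a + Rabs b + 1) ltac:(have := Rabs_pos a; have := Rabs_pos b; lra).
exists (Rabs L + 1); have p := Rabs_pos L; split; first lra.
have bd r : Rabs (clamp a b r) <= Rabs a + Rabs b + 1.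
  have := clamp_in a b r ab.
  have := Rle_abs b; have := Rle_abs (- a); rewrite Rabs_Ropp => q1 q2 q3.
  by have := Rabs_pos a; have := Rabs_pos b => q4 q5; apply: Rabs_le; lra.
move=> r s; apply: Rle_trans (hL _ _ (bd r) (bd s)) _.
have := clamp_lipschitz a b r s; have := Rabs_pos (clamp a b r - clamp a b s).
have := Rle_abs L => q1 q2 q3.
apply: Rle_trans (_ : (Rabs L + 1) * Rabs (clamp a b r - clamp a b s) <= _).
  by apply: Rmult_le_compat_r; lra.
by apply: Rmult_le_compat_l; lra.
Qed.

Definition sign_changing (h : R -> R) (a e b : R) : Prop :=
  a < e < b /\ h e = 0 /\ (forall r, a <= r < e -> 0 < h r) /\ (forall r, e < r <= b -> h r < 0).

Lemma restoring_clamp h a e b : loc_lipschitz h -> sign_changing h a e b ->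
  exists L, restoring (fun r => h (clamp a b r)) e L.
Proof.
move=> hl [[ae eb] [he [h1 h2]]].
have [L [L0 hL]] := loc_lipschitz_clamp h a b hl ltac:(lra).
exists L; split=> //; split=> //; split; first by rewrite clamp_id //; lra.
split=> r hr.
- apply: h1; split; first by apply: (proj1 (clamp_in a b r _)); lra.
  by apply: clamp_below; lra.
- apply: h2; split; last by apply: (proj2 (clamp_in a b r _)); lra.
  by apply: clamp_above; lra.
Qed.

(* A nonlinearity strictly below [h] with its own zero at a given [e' < e]: to
   the left of [e'] subtract [h e'] without falling below a positive function,
   to the right subtract [h e'] and cap by a negative one; both pieces vanish at [e']. *)
Lemma restoring_strict_minorant h a e b : loc_lipschitz h -> sign_changing h a e b ->
  exists C, 0 < C /\ forall e', a < e' < e -> exists h' L eta, restoring h' e' L /\ 0 < eta /\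
    (forall r, a <= r <= b -> h' r <= h r - eta) /\
    (forall r, a <= r <= b -> h r - h' r <= C * (e - e')).
Proof.
move=> hl [[ae eb] [he [h1 h2]]].
have [L [L0 hL]] := loc_lipschitz_clamp h a b hl ltac:(lra).
exists (L + (b - a)); split; first lra.
move=> e' [ae' e'e].
pose hc r := h (clamp a b r).
have hcE r : a <= r <= b -> hc r = h r by move=> hr; rewrite /hc clamp_id.
(* The slope [q] of the auxiliary linear function shrinks with [e - e']; this keeps [h - h'] of
   order [e - e'] on all of [[a, b]]. *)
pose eta0 := h e'; pose q := e - e'.
have eta0p : 0 < eta0 by apply: h1; lra.
have q0 : 0 < q by rewrite /q; lra.
pose f1 r := Rmax (hc r - eta0) (Rmin (hc r / 2) (q * (e' - r))).
pose f2 r := Rmin (hc r - eta0) (q * (e' - r)).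
have hce : hc e' = eta0 by rewrite hcE //; lra.
have f1e : f1 e' = 0.
  by rewrite /f1 hce !Rminus_diag Rmult_0_r Rmin_right ?Rmax_left; lra.
have f2e : f2 e' = 0 by rewrite /f2 hce !Rminus_diag Rmult_0_r Rmin_left; lra.
(* Both pieces vanish at [e'], so this sum glues them there and inherits a Lipschitz constant from
   each. *)
pose h' r := f1 (Rmin (clamp a b r) e') + f2 (Rmax (clamp a b r) e').
have hl1 : lipschitz (L + q) (fun r => hc r - eta0).
  move=> r s; rewrite (_ : _ - _ - _ = hc r - hc s); last ring.
  by apply: (lipschitz_weaken L (L + q)) => //; lra.
have hl2 : lipschitz (L + q) (fun r => hc r / 2).
  move=> r s; have := hL r s; rewrite -/(hc r) -/(hc s).
  rewrite (_ : _ / 2 - _ = / 2 * (hc r - hc s)); last field.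
  rewrite Rabs_mult (Rabs_right (/ 2)); last lra.
  have := Rabs_pos (r - s); have := Rabs_pos (hc r - hc s) => p1 p2 p3.
  have := Rmult_le_pos q _ ltac:(lra) p2; lra.
have hl3 : lipschitz (L + q) (fun r => q * (e' - r)).
  move=> r s; rewrite (_ : _ - _ = - (q * (r - s))); last ring.
  rewrite Rabs_Ropp Rabs_mult (Rabs_right q); last lra.
  by apply: Rmult_le_compat_r; [exact: Rabs_pos|lra].
have hmin : lipschitz 1 (fun r => Rmin (clamp a b r) e').
  by apply: lipschitz_min; [exact: clamp_lipschitz|apply: lipschitz_const; lra].
have hmax : lipschitz 1 (fun r => Rmax (clamp a b r) e').
  by apply: lipschitz_max; [exact: clamp_lipschitz|apply: lipschitz_const; lra].
have left r : a <= r <= e' -> h' r = f1 r.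
  by move=> hr; rewrite /h' clamp_id ?Rmin_left ?Rmax_right ?f2e; lra.
have right r : e' <= r <= b -> h' r = f2 r.
  by move=> hr; rewrite /h' clamp_id ?Rmin_right ?Rmax_left ?f1e; lra.
have h'c r : h' (clamp a b r) = h' r.
  by rewrite /h' (clamp_id a b (clamp a b r)) //; apply: clamp_in; lra.
have [c [c0 hcl]] : exists c, 0 < c /\ forall r, a <= r <= e' -> c <= h r.
  apply: positive_lower_bound; first exact: loc_lipschitz_continuity.
  by move=> r hr; apply: h1; lra.
have hLr r : a <= r <= b -> h r <= L * Rabs (r - e).
  move=> hr; have := hL r e; rewrite !clamp_id ?he ?Rminus_0_r; try lra.
  by have := Rle_abs (h r); lra.
exists h', (L + q + (L + q)), (Rmin eta0 (c / 2)); split; last split; last split.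
- split; first lra; split.
    by apply: lipschitz_plus; apply: lipschitz_comp1; try lra; try exact: hmin; try exact: hmax;
      [apply: lipschitz_max => //; apply: lipschitz_min|apply: lipschitz_min].
  split; first by rewrite left ?f1e; lra.
  have cin r := clamp_in a b r ltac:(lra).
  split=> r hr.
  + have := clamp_below a b e' r ltac:(lra) ltac:(lra) hr => lt.
    have := cin r; rewrite -h'c; move: (clamp a b r) lt => x lt hx.
    rewrite left; last lra.
    apply: Rlt_le_trans (Rmax_r _ _); apply: Rmin_glb_lt; last by apply: Rmult_lt_0_compat; lra.
    by rewrite hcE; last lra; have := h1 x ltac:(lra); lra.
  + have := clamp_above a b e' r ltac:(lra) ltac:(lra) hr => lt.
    have := cin r; rewrite -h'c; move: (clamp a b r) lt => x lt hx.
    rewrite right; last lra.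
    apply: Rle_lt_trans (Rmin_r _ _) _.
    by have := Rmult_lt_0_compat q (x - e') ltac:(lra) ltac:(lra); lra.
- by apply: Rmin_pos; lra.
- move=> r hr; have m1 := Rmin_l eta0 (c / 2); have m2 := Rmin_r eta0 (c / 2).
  case: (Rle_dec r e') => re.
  + rewrite left; last lra; rewrite /f1 hcE //.
    apply: Rmax_lub; first lra.
    by apply: Rle_trans (Rmin_l _ _) _; have := hcl r ltac:(lra); lra.
  + rewrite right; last lra; rewrite /f2 hcE //.
    by apply: Rle_trans (Rmin_l _ _) _; lra.
- move=> r hr.
  have eb' : eta0 <= L * (e - e').
    by have := hLr e' ltac:(lra); rewrite Rabs_left /eta0; lra.
  have Cq : (L + (b - a)) * (e - e') = L * (e - e') + q * (b - a) by rewrite /q; ring.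
  rewrite Cq; have qb : 0 <= q * (b - a) by apply: Rmult_le_pos; lra.
  case: (Rle_dec r e') => re.
  + rewrite left; last lra; rewrite /f1 hcE //.
    by have := Rmax_l (h r - eta0) (Rmin (h r / 2) (q * (e' - r))); lra.
  + rewrite right; last lra; rewrite /f2 hcE // /Rmin.
    case: Rle_dec => _; first lra.
    have q1 : q * (r - e') <= q * (b - a) by apply: Rmult_le_compat_l; lra.
    have q2 : h r <= L * (e - e').
      case: (Rle_dec r e) => re2.
      * apply: Rle_trans (hLr r hr) _; apply: Rmult_le_compat_l; first lra.
        by rewrite Rabs_left1; lra.
      * by have := h2 r ltac:(lra); have := Rmult_lt_0_compat L (e - e') ltac:(lra) ltac:(lra); lra.
    by lra.
Qed.

Lemma sqrt_diff_le x y : 0 <= x -> 0 <= y -> Rabs (sqrt x - sqrt y) <= sqrt (Rabs (x - y)).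
Proof.
move=> x0 y0.
have key u v : 0 <= u -> u <= v -> sqrt v - sqrt u <= sqrt (v - u).
  move=> u0 uv; have s1 := sqrt_pos u; have s2 := sqrt_pos (v - u).
  suff : sqrt v <= sqrt u + sqrt (v - u) by lra.
  rewrite -[sqrt u + _]sqrt_square; last lra.
  apply: sqrt_le_1_alt.
  have := sqrt_sqrt u u0; have := sqrt_sqrt (v - u) ltac:(lra); nra.
case: (Rle_dec x y) => xy.
- have := sqrt_le_1_alt x y xy => q.
  rewrite Rabs_left1; last lra; rewrite Rabs_left1; last lra.
  by have := key x y x0 xy; rewrite (_ : - (x - y) = y - x); [lra|ring].
- have := sqrt_le_1_alt y x ltac:(lra) => q.
  rewrite Rabs_right; last lra; rewrite Rabs_right; last lra.
  by apply: key; lra.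
Qed.

(** The square root is 1/2-Hölder, so closeness of the potentials passes to the speeds even near
    their zeros. One [B * Rabs (e - e')] comes from the different base points of the potentials, the
    other from [Rmax r e] and [Rmin r e] changing with [e]; the outer factor 2 counts the two
    roots. *)
Lemma speed_close D h h' e e' L L' a b tau B r : 0 < D ->
  restoring h e L -> restoring h' e' L' -> a <= e <= b -> a <= e' <= b -> a <= r <= b ->
  (forall s, a <= s <= b -> Rabs (h s - h' s) <= tau) ->
  (forall s, a <= s <= b -> Rabs (h s) <= B) ->
  Rabs (speed D h e r - speed D h' e' r) <=
    2 * sqrt (2 / D * (tau * (b - a) + 2 * B * Rabs (e - e'))).
Proof.
move=> D0 hr hr' he he' hrr ht hB.
have hc := restoring_continuity _ _ _ hr; have hc' := restoring_continuity _ _ _ hr'.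
have d2 : 0 < 2 / D by apply: Rdiv_lt_0_compat; lra.
pose Q x := RInt h x e; pose Q' x := RInt h' x e'.
have B0 : 0 <= B by apply: Rle_trans (Rabs_pos _) (hB e he).
have mvt (F F' : R -> R) M x y : (forall z, is_derive F z (F' z)) -> a <= x <= b -> a <= y <= b ->
    (forall z, a <= z <= b -> Rabs (F' z) <= M) -> Rabs (F x - F y) <= M * Rabs (x - y).
  move=> dF hx hy hM.
  have key u v : a <= u <= b -> a <= v <= b -> u < v -> Rabs (F v - F u) <= M * Rabs (v - u).
    move=> hu hv lt.
    have [c [-> cr]] := MVT_cor2 F F' u v lt (fun c _ => proj1 (is_derive_Reals _ _ _) (dF c)).
    by rewrite Rabs_mult; apply: Rmult_le_compat_r; [exact: Rabs_pos|apply: hM; lra].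
  case: (total_order_T x y) => [[lt|->]|gt].
  - by rewrite Rabs_minus_sym (Rabs_minus_sym x); apply: key.
  - by rewrite !Rminus_diag Rabs_R0; lra.
  - exact: key.
have dQ z := is_derive_potential h e z hc.
have dQ' z := is_derive_potential h' e' z hc'.
have QQ' x : a <= x <= b -> Rabs (Q x - Q' x) <= tau * (b - a) + B * Rabs (e - e').
  move=> hx.
  have h1 := mvt (fun x => Q x - Q' x) (fun x => - h x - - h' x) tau x e'
    (fun z => is_derive_minus _ _ z _ _ (dQ z) (dQ' z)) hx he'
    ltac:(move=> z hz; have := ht z hz; rewrite (_ : - h z - - h' z = - (h z - h' z));
          [by rewrite Rabs_Ropp|ring]).
  have h2 := mvt Q (fun x => - h x) B e' e dQ he' he
    ltac:(move=> z hz; rewrite Rabs_Ropp; exact: hB).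
  have t0 : 0 <= tau by apply: Rle_trans (Rabs_pos _) (ht e he).
  have h3 : tau * Rabs (x - e') <= tau * (b - a).
    by apply: Rmult_le_compat_l => //; apply: Rabs_le; lra.
  rewrite /Q' /Q !potential_point in h1 h2 *; rewrite (Rabs_minus_sym e' e) in h2.
  by move: h1 h2; set u := B * _; set v := tau * Rabs _ in h3 *; move=> h1 h2; rabs.
have side x x' : a <= x <= b -> a <= x' <= b -> Rabs (x - x') <= Rabs (e - e') ->
    Rabs (sqrt (2 / D * Q x) - sqrt (2 / D * Q' x')) <=
    sqrt (2 / D * (tau * (b - a) + 2 * B * Rabs (e - e'))).
  move=> hx hx' xx.
  apply: Rle_trans (sqrt_diff_le _ _ _ _) _.
  - by apply: Rmult_le_pos; [lra|apply: (proj1 (proj1 (potential_bounds h e L x hr)))].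
  - by apply: Rmult_le_pos; [lra|apply: (proj1 (proj1 (potential_bounds h' e' L' x' hr')))].
  apply: sqrt_le_1_alt.
  rewrite -Rmult_minus_distr_l Rabs_mult (Rabs_right (2 / D)); last lra.
  apply: Rmult_le_compat_l; first lra.
  have h1 := QQ' x' hx'.
  have h2 := mvt Q (fun x => - h x) B x x' dQ hx hx'
    ltac:(move=> z hz; rewrite Rabs_Ropp; exact: hB).
  have h3 : B * Rabs (x - x') <= B * Rabs (e - e') by apply: Rmult_le_compat_l.
  have -> : Q x - Q' x' = (Q x - Q x') + (Q x' - Q' x') by ring.
  by apply: Rle_trans (Rabs_triang _ _) _; lra.
have hmax : Rabs (Rmax r e - Rmax r e') <= Rabs (e - e').
  have q1 := Rle_abs (e - e'); have q2 := Rle_abs (- (e - e')); rewrite Rabs_Ropp in q2.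
  by rewrite /Rmax; do 2 case: Rle_dec => ? /=; apply: Rabs_le; lra.
have hmin : Rabs (Rmin r e - Rmin r e') <= Rabs (e - e').
  have q1 := Rle_abs (e - e'); have q2 := Rle_abs (- (e - e')); rewrite Rabs_Ropp in q2.
  by rewrite /Rmin; do 2 case: Rle_dec => ? /=; apply: Rabs_le; lra.
have inmax s : a <= s <= b -> a <= Rmax r s <= b by rewrite /Rmax; case: Rle_dec => _; lra.
have inmin s : a <= s <= b -> a <= Rmin r s <= b by rewrite /Rmin; case: Rle_dec => _; lra.
have s1 := side _ _ (inmax e he) (inmax e' he') hmax.
have s2 := side _ _ (inmin e he) (inmin e' he') hmin.
rewrite /speed -/(Q _) -/(Q _) -/(Q' _) -/(Q' _).
move: s1 s2; set s := sqrt (_ * (_ + _)); move=> s1 s2; rabs.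
Qed.

(** * Convergence from below *)

Lemma minorant_speed_close D h ht e Lt m0 M0 m lo hi ep : 0 < D -> loc_lipschitz h ->
  sign_changing h m0 e M0 -> restoring ht e Lt -> m0 <= lo -> hi <= M0 -> lo < e < hi ->
  (forall r, lo <= r <= hi -> ht r = h r) -> m < e -> 0 < ep ->
  exists e' h' L eta, m < e' < e /\ lo < e' /\ restoring h' e' L /\ 0 < eta /\
    (forall r, m0 <= r <= M0 -> h' r <= h r - eta) /\
    (forall r, lo <= r <= hi -> Rabs (speed D h' e' r - speed D ht e r) <= ep).
Proof.
move=> D0 hl hs hrt ml hM [loe ehi] hth me ep0.
have [C [C0 hC]] := restoring_strict_minorant h m0 e M0 hl hs.
have Lt0 : 0 < Lt by case: hrt.
pose Y := C * (hi - lo) + 2 * (Lt * (hi - lo)).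
have Y0 : 0 < Y.
  have := Rmult_lt_0_compat C (hi - lo) C0 ltac:(lra).
  by have := Rmult_lt_0_compat Lt (hi - lo) Lt0 ltac:(lra); rewrite /Y; lra.
(* The last entry solves [2 sqrt (2 / D * del * Y) = ep], where [del * Y] bounds the change of the
   potentials. *)
pose del := Rmin (Rmin ((e - m) / 2) ((e - lo) / 2)) (D * (ep * ep) / (8 * Y)).
have p0 : 0 < D * (ep * ep) / (8 * Y).
  by apply: Rdiv_lt_0_compat; [apply: Rmult_lt_0_compat => //; nra|lra].
have del0 : 0 < del by rewrite /del; do 2 (apply: Rmin_pos; try lra).
have [d1 [d2 d3]] : del <= (e - m) / 2 /\ del <= (e - lo) / 2 /\ del <= D * (ep * ep) / (8 * Y).
  rewrite /del; set x := (e - m) / 2; set y := (e - lo) / 2; set z := _ / (8 * Y).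
  by have := Rmin_l (Rmin x y) z; have := Rmin_r (Rmin x y) z; have := Rmin_l x y;
     have := Rmin_r x y; lra.
have [h' [L [eta [hr' [eta0 [h1 h2]]]]]] := hC (e - del) ltac:(lra).
exists (e - del), h', L, eta; do 5 (split; first by [lra|exact: hr'|exact: h1]).
move=> r hr.
rewrite Rabs_minus_sym.
have ht0 s : lo <= s <= hi -> Rabs (ht s) <= Lt * (hi - lo).
  move=> hs'; case: hrt => _ [q1 [q2 _]]; have := q1 s e; rewrite q2 Rminus_0_r => q3.
  apply: Rle_trans q3 _; apply: Rmult_le_compat_l; first lra.
  by apply: Rabs_le; lra.
apply: Rle_trans (speed_close D ht h' e (e - del) Lt L lo hi (C * del) (Lt * (hi - lo)) r D0 hrt hr'
  ltac:(lra) ltac:(lra) hr _ ht0) _.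
  move=> s hs'; rewrite hth //; have := h1 s ltac:(lra); have := h2 s ltac:(lra).
  by rewrite (_ : e - (e - del) = del); [move=> q1 q2; apply: Rabs_le; lra|ring].
rewrite (_ : e - (e - del) = del); last ring.
rewrite (Rabs_right del); last lra.
rewrite (_ : C * del * (hi - lo) + 2 * (Lt * (hi - lo)) * del = del * Y); last by rewrite /Y; ring.
have -> : ep = 2 * sqrt ((ep / 2) * (ep / 2)) by rewrite sqrt_square; lra.
apply: Rmult_le_compat_l; first lra.
apply: sqrt_le_1_alt.
have -> : ep / 2 * (ep / 2) = 2 / D * (D * (ep * ep) / (8 * Y) * Y) by field; lra.
apply: Rmult_le_compat_l; first by apply: Rlt_le; apply: Rdiv_lt_0_compat; lra.
by apply: Rmult_le_compat_r; lra.
Qed.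

(** Profiles for [h'] are strict subsolutions for [h], so only the exchange condition restricts the
    boundary values. Prescribing the value on side [true] as [G] of the value on side [false]
    settles one half of it; the other half is an inequality whose left side increases along the
    curve, so it is needed at [pf] only. The resulting bound is the last member of the family, which
    is close to [A] since its speed and its boundary values are. *)
Lemma lower_convergence {N} D kap h (w : bool -> Pt N -> R -> R -> R) (e : bool -> R)
    m0 M0 m K (ht : bool -> R -> R) (Lt : bool -> R) lo hi (p : bool -> R) (A : bool -> R -> R) :
  (forall b, 0 < D b) -> (forall b, 0 < kap b) -> (forall b, loc_lipschitz (h b)) ->
  pair_solution D kap h w ->
  0 < K -> (forall b y z t, 0 <= z -> 0 <= t -> Rabs (w b y z t) <= K) ->
  (forall b, sign_changing (h b) m0 (e b) M0) -> m0 < m -> (forall b, m < e b) ->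
  eventually_above w (fun _ _ => m) ->
  (forall b, restoring (ht b) (e b) (Lt b)) -> m0 <= lo -> hi <= M0 ->
  (forall b, lo < e b < hi) -> (forall b, lo < p b < hi) ->
  (forall b r, lo <= r <= hi -> ht b r = h b r) ->
  (forall b, p (negb b) = p b + kap b * speed (D b) (ht b) (e b) (p b)) ->
  (forall b, is_profile (D b) (ht b) (e b) (p b) (A b)) ->
  forall tau Z, 0 < tau -> 0 < Z -> exists B, eventually_above w B /\
    forall b z, 0 <= z <= Z -> A b z - tau <= B b z.
Proof.
move=> D0 k0 hl sol K0 wK hs m0m me wm hrt ml hM he hp hth hflux hA tau Z tau0 Z0.
pose phi b := speed (D b) (ht b) (e b).
pose kF := kap false; pose kT := kap true.
have kF0 : 0 < kF by exact: k0.
have kT0 : 0 < kT by exact: k0.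
have phi_inc b r s : r < s -> phi b r < phi b s.
  exact: (speed_increasing (D b) (ht b) (e b) (Lt b)).
have phi_c b : continuity (phi b) by exact: (speed_continuity (D b) (ht b) (e b) (Lt b)).
have pT : p true = p false + kF * phi false (p false) by exact: (hflux false).
have pF : p false = p true + kT * phi true (p true) by exact: (hflux true).
pose Q r := r + kF * phi false r.
have Qc : continuity Q.
  move=> x; apply: continuity_pt_plus; first exact: derivable_continuous_pt (derivable_pt_id x).
  exact: (continuity_pt_scal (phi false) kF x (phi_c false x)).
(* [pf] will be [p false] lowered by [r3], and [q] the value then prescribed on the other side by
   the limiting flux condition; [r1] and [r2] keep [q] within [tau / 8] of [p true] and above
   [lo]. *)
pose r1 := Rmin (tau / 8) (p true - lo).
have r10 : 0 < r1 by apply: Rmin_pos; have := hp true; lra.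
have [r2 [r20 hr2]] := continuity_pt_delta Q (p false) r1 (Qc _) r10.
pose r3 := Rmin (Rmin (r2 / 2) (tau / 8)) ((p false - lo) / 2).
have [r30 [r31 [r32 r33]]] : 0 < r3 /\ r3 <= r2 / 2 /\ r3 <= tau / 8 /\ r3 <= (p false - lo) / 2.
  have pl := hp false; rewrite /r3.
  set x := r2 / 2; set y := tau / 8; set z := _ / 2.
  have h1 := Rmin_l (Rmin x y) z; have h2 := Rmin_r (Rmin x y) z.
  have h3 := Rmin_l x y; have h4 := Rmin_r x y.
  by split; [do 2 (apply: Rmin_pos; try (rewrite /x /y /z; lra))|lra].
pose pf := p false - r3.
pose q := Q pf.
have [r4 r5] : r1 <= tau / 8 /\ r1 <= p true - lo by split; [exact: Rmin_l|exact: Rmin_r].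
have qpT : Rabs (q - p true) < r1.
  rewrite pT; apply: hr2; rewrite /pf (_ : _ - _ = - r3); last ring.
  by rewrite Rabs_left; lra.
have qlt : q < p true.
  have := phi_inc false pf (p false) ltac:(rewrite /pf; lra) => h1.
  have := Rmult_lt_compat_l kF _ _ kF0 h1; rewrite pT /q /Q /pf; lra.
have qlo : lo < q by rabs.
(* The sum in parentheses vanishes at the steady boundary values, and both speeds are strictly
   increasing, so lowering both values makes it negative. The gain [4 gam] pays for the slack [sig]
   and for replacing [phi] by [psi]. *)
pose gam := - (kF * phi false pf + kT * phi true q) / 4.
have gam0 : 0 < gam.
  have h1 := phi_inc false pf (p false) ltac:(rewrite /pf; lra).
  have h2 := phi_inc true q (p true) qlt.
  have h3 := Rmult_lt_compat_l kF _ _ kF0 h1; have h4 := Rmult_lt_compat_l kT _ _ kT0 h2.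
  rewrite /gam; lra.
have [r6 [r60 hr6]] := continuity_pt_delta (phi true) q (gam / kT) (phi_c true q)
  ltac:(apply: Rdiv_lt_0_compat; lra).
pose sig := Rmin (Rmin (gam / 2) (r6 / 4)) (Rmin (tau / 16) ((p true - q) / 2)).
have [sig0 [sig1 [sig2 [sig3 sig4]]]] : 0 < sig /\ sig <= gam / 2 /\ sig <= r6 / 4 /\
    sig <= tau / 16 /\ sig <= (p true - q) / 2.
  rewrite /sig; set x := gam / 2; set y := r6 / 4; set z := tau / 16; set u := _ / 2.
  have h1 := Rmin_l (Rmin x y) (Rmin z u); have h2 := Rmin_r (Rmin x y) (Rmin z u).
  have h3 := Rmin_l x y; have h4 := Rmin_r x y; have h5 := Rmin_l z u; have h6 := Rmin_r z u.
  split; last lra.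
  by do 2 (apply: Rmin_pos; try (rewrite /x /y /z /u; lra)).
pose ep := Rmin (Rmin (sig / (2 * kF)) (sig / (2 * kT))) (tau / (2 * Z)).
have [ep0 [ep1 [ep2 ep3]]] : 0 < ep /\ kF * ep <= sig / 2 /\ kT * ep <= sig / 2 /\ ep * Z <= tau / 2.
  rewrite /ep; set x := sig / _; set y := sig / _; set z := tau / _.
  have h1 := Rmin_l (Rmin x y) z; have h2 := Rmin_r (Rmin x y) z.
  have h3 := Rmin_l x y; have h4 := Rmin_r x y.
  have x0 : 0 < x by apply: Rdiv_lt_0_compat; lra.
  have y0 : 0 < y by apply: Rdiv_lt_0_compat; lra.
  have z0 : 0 < z by apply: Rdiv_lt_0_compat; lra.
  split; first by do 2 (apply: Rmin_pos => //).
  split; last split.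
  - have -> : sig / 2 = kF * x by rewrite /x; field; lra.
    by apply: Rmult_le_compat_l; lra.
  - have -> : sig / 2 = kT * y by rewrite /y; field; lra.
    by apply: Rmult_le_compat_l; lra.
  - have -> : tau / 2 = z * Z by rewrite /z; field; lra.
    by apply: Rmult_le_compat_r; lra.
have pick b := minorant_speed_close (D b) (h b) (ht b) (e b) (Lt b) m0 M0 m lo hi ep (D0 b) (hl b)
  (hs b) (hrt b) ml hM (he b) (hth b) (me b) ep0.
have [e' he'] := functional_choice _ pick.
have [h' hh'] := functional_choice _ he'.
have [L hL] := functional_choice _ hh'.
have [eta heta] := functional_choice _ hL => {pick he' hh' hL}.
have me' b : m < e' b < e b by case: (heta b).
have loe' b : lo < e' b by case: (heta b) => _ [].
have hr' b : restoring (h' b) (e' b) (L b) by case: (heta b) => _ [_ []].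
have eta0 b : 0 < eta b by case: (heta b) => _ [_ [_ []]].
have marg b : forall r, m0 <= r <= M0 -> h' b r <= h b r - eta b.
  by case: (heta b) => _ [_ [_ [_ []]]].
pose psi b := speed (D b) (h' b) (e' b).
have close b : forall r, lo <= r <= hi -> Rabs (psi b r - phi b r) <= ep.
  by case: (heta b) => _ [_ [_ [_ []]]].
have psi_le b r s : r <= s -> psi b r <= psi b s.
  exact: (speed_monotone (D b) (h' b) (e' b) (L b)).
have psi_c b : continuity (psi b) by exact: (speed_continuity (D b) (h' b) (e' b) (L b)).
(* the admissible boundary values: the flux condition holds with slack on the
   first side along this curve, and on the second one up to the endpoint [pf] *)
pose G r := r + kF * psi false r + sig.
have Gc : continuity G.
  move=> x; apply: (continuity_pt_plus (fun r => r + kF * psi false r) (fun _ => sig)).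
    apply: continuity_pt_plus; first exact: derivable_continuous_pt (derivable_pt_id x).
    exact: (continuity_pt_scal (psi false) kF x (psi_c false x)).
  exact: continuity_pt_const.
have G_le r s : r <= s -> G r <= G s.
  move=> rs; have := Rmult_le_compat_l kF _ _ (Rlt_le _ _ kF0) (psi_le false _ _ rs).
  by rewrite /G; lra.
have pfin : lo <= pf <= hi by rewrite /pf; have := hp false; lra.
have cpf := close false pf pfin.
have kcpf : Rabs (kF * psi false pf - kF * phi false pf) <= sig / 2.
  rewrite -Rmult_minus_distr_l Rabs_mult (Rabs_right kF); last lra.
  by apply: Rle_trans ep1; apply: Rmult_le_compat_l; lra.
have Gpf : q < G pf <= q + 3 / 2 * sig by rewrite /G /q /Q; move: kcpf => kcpf0; split; rabs.
have Gin : lo <= G pf <= hi by have := hp true; lra.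
have second : G pf - pf + kT * psi true (G pf) < 0.
  have h1 := hr6 (G pf) ltac:(rewrite Rabs_right; lra).
  have h2 := close true (G pf) Gin.
  have h3 : kT * psi true (G pf) <= kT * phi true q + gam + sig / 2.
    have h4 : psi true (G pf) <= phi true q + gam / kT + ep by rabs.
    have := Rmult_le_compat_l kT _ _ (Rlt_le _ _ kT0) h4.
    rewrite !Rmult_plus_distr_l (_ : kT * (gam / kT) = gam); last by field; lra.
    lra.
  have h5 : kF * phi false pf + kT * phi true q = - (4 * gam) by rewrite /gam; field.
  have h6 : q = pf + kF * phi false pf by [].
  lra.
have profs bp : exists F, is_profile (D bp.1) (h' bp.1) (e' bp.1) bp.2 F /\
   (bp.2 < e' bp.1 -> forall z, 0 <= z -> F z <= e' bp.1 - (e' bp.1 - bp.2) *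
      exp (- (sqrt (2 / D bp.1 * L bp.1) * z))).
  exact: (profile_exists (D bp.1) (h' bp.1) (e' bp.1) (L bp.1)).
have [F hF] := functional_choice _ profs => {profs}.
pose cb b := sqrt (2 / D b * L b).
(* The layer tends to the midpoint of [e' b] and [e b]: below it [h] is still positive, and far from
   the interface it exceeds [e' b], hence every profile that starts below [e' b]. *)
have [k [kp layer]] := boundary_layer D kap h w m0 m (fun b => (e' b + e b) / 2)
  (K + Rabs m0 + Rabs (e true) + Rabs (e false) + Rabs m) D0 k0 hl sol
  ltac:(have := Rabs_pos m0; have := Rabs_pos (e true); have := Rabs_pos (e false);
        have := Rabs_pos m; lra)
  ltac:(move=> b y z t z0 t0; have := wK b y z t z0 t0; have := Rabs_pos m0;
        have := Rabs_pos (e true); have := Rabs_pos (e false); have := Rabs_pos m; lra)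
  ltac:(have := Rabs_pos (e true); have := Rabs_pos (e false); have := Rabs_pos m; lra)
  ltac:(move=> b; have := me' b; have := Rabs_pos m0; have := Rle_abs (- m);
        rewrite Rabs_Ropp; have := Rle_abs (e true); have := Rle_abs (e false);
        have := Rabs_pos (e true); have := Rabs_pos (e false); have := Rabs_pos m;
        case: b => *; apply: Rabs_le; lra)
  m0m ltac:(move=> b; have := me' b; lra)
  ltac:(move=> b r hr; case: (hs b) => _ [_ [h1 _]]; apply: h1; have := me' b; lra) wm.
have [Z1 [Z10 hZ1]] : exists Z1, 0 < Z1 /\ forall b z, Z1 <= z ->
    e' b <= m0 + ((e' b + e b) / 2 - m0) * (1 - exp (- z / k)).
  have one b : exists X, 0 < X /\ forall z, X <= z ->
      e' b <= m0 + ((e' b + e b) / 2 - m0) * (1 - exp (- z / k)).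
    pose a := (e' b + e b) / 2 - m0; pose d := (e b - e' b) / 2.
    have a0 : 0 < a by rewrite /a; have := me' b; lra.
    have d0 : 0 < d by rewrite /d; have := me' b; lra.
    have ad0 : 0 < a / d by apply: Rdiv_lt_0_compat.
    exists (k * (a / d)); split; first exact: Rmult_lt_0_compat.
    move=> z hz; rewrite -/a.
    have zk : a / d <= z / k.
      apply: (Rmult_le_reg_l k) => //.
      by rewrite (_ : k * (z / k) = z); [|field; lra].
    have ez : a / d <= exp (z / k) by have := exp_ineq1_le (z / k); lra.
    have ee : exp (z / k) * exp (- z / k) = 1.
      by rewrite -exp_plus (_ : z / k + - z / k = 0); [exact: exp_0|field; lra].
    have en := exp_pos (- z / k).
    have : a * exp (- z / k) <= d.
      have := Rmult_le_compat_r (exp (- z / k)) _ _ (Rlt_le _ _ en) ez; rewrite ee => h1.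
      have := Rmult_le_compat_l d _ _ (Rlt_le _ _ d0) h1.
      by rewrite (_ : d * (a / d * _) = a * exp (- z / k)); [lra|field; lra].
    by rewrite /a /d; lra.
  have [X1 [X10 h1]] := one true; have [X2 [X20 h2]] := one false.
  exists (Rmax X1 X2); have q1 := Rmax_l X1 X2; have q2 := Rmax_r X1 X2; split; first lra.
  by case=> z hz; [apply: h1|apply: h2]; lra.
(* A profile with boundary value at most [st b] stays below [m] on [[0, Z1]], by the exponential
   bound. At [ps] the speed on side [false] is negative, so [G ps <= ps + sig], which the choice of
   [ps] puts below [st true]. *)
pose st b := e' b - (e' b - m) * exp (cb b * Z1).
pose ps := Rmin (Rmin (st false) (st true - sig)) (Rmin (pf - 1) (e' false - 1)).
have [ps1 [ps2 [ps3 ps4]]] : ps <= st false /\ ps <= st true - sig /\ ps <= pf - 1 /\ ps <= e' false - 1.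
  rewrite /ps; set x := st false; set y := _ - sig; set z := pf - 1; set u := _ - 1.
  have h1 := Rmin_l (Rmin x y) (Rmin z u); have h2 := Rmin_r (Rmin x y) (Rmin z u).
  have h3 := Rmin_l x y; have h4 := Rmin_r x y; have h5 := Rmin_l z u; have h6 := Rmin_r z u.
  lra.
have st_lt b : st b < e' b.
  have := Rmult_lt_0_compat _ _ (Rlt_Rminus _ _ (proj1 (me' b))) (exp_pos (cb b * Z1)).
  by rewrite /st; lra.
have Gps : G ps <= st true.
  have [h1 _] := speed_sign (D false) (h' false) (e' false) (L false) ps (D0 false) (hr' false).
  have := h1 ltac:(lra) => h2; have := Rmult_lt_compat_l kF _ _ kF0 h2.
  by rewrite /G /psi; lra.
pose par s := ps + s * (pf - ps).
have par0 : par 0 = ps by rewrite /par; ring.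
have par1 : par 1 = pf by rewrite /par; ring.
pose bv s b := if b then G (par s) else par s.
have par_in s : 0 <= s <= 1 -> ps <= par s <= pf.
  move=> hs1; have h1 := Rmult_le_pos s (pf - ps) ltac:(lra) ltac:(lra).
  have := Rmult_le_compat_r (pf - ps) s 1 ltac:(lra) ltac:(lra).
  by rewrite /par; lra.
have bv_in s b : 0 <= s <= 1 -> bv 0 b <= bv s b <= bv 1 b /\ bv 1 b <= hi.
  move=> hs1; have [h1 h2] := par_in s hs1.
  rewrite /bv par0 par1; case: b; last lra.
  by have := G_le _ _ h1; have := G_le _ _ h2; lra.
pose fam s b := F (b, bv s b).
have famP s b : is_profile (D b) (h' b) (e' b) (bv s b) (fam s b) by exact: (proj1 (hF (b, bv s b))).
have fam_upper s b z : 0 <= s <= 1 -> 0 <= z -> fam s b z <= hi.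
  move=> hs1 hz.
  have [_ h1] := profile_between _ _ _ _ _ _ (D0 b) (hr' b) (famP s b) z hz.
  apply: Rle_trans h1 _; apply: Rmax_lub; first by have := bv_in s b hs1; lra.
  by have := me' b; have := he b; lra.
have fam_lower s b z : 0 <= s <= 1 -> 0 <= z -> Rmin (bv 0 b) m <= fam s b z.
  move=> hs1 hz.
  have [h1 _] := profile_between _ _ _ _ _ _ (D0 b) (hr' b) (famP s b) z hz.
  apply: Rle_trans _ h1.
  have h2 := Rmin_l (bv 0 b) m; have h3 := Rmin_r (bv 0 b) m.
  by apply: Rmin_glb; [have := bv_in s b hs1; lra|have := me' b; lra].
pose K1 := K + Rabs hi + Rabs m + Rabs (bv 0 true) + Rabs (bv 0 false).
have K1K : K <= K1.
  rewrite /K1; have := Rabs_pos hi; have := Rabs_pos m.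
  by have := Rabs_pos (bv 0 true); have := Rabs_pos (bv 0 false); lra.
pose etam := Rmin (eta true) (eta false).
have etam0 : 0 < etam by exact: Rmin_pos.
have etamb b : etam <= eta b by case: b; [exact: Rmin_l|exact: Rmin_r].
have main : eventually_above w (fam 1).
  apply: (strict_sub_sweep D kap h w fam (fun _ _ => m) K1 etam (m - m0)) => //.
  - lra.
  - by move=> b y z t z0 t0; have := wK b y z t z0 t0; lra.
  - move=> s b _; have [_ [dF _]] := famP s b; exact: is_derive_continuity dF.
  - move=> s b z hs1 hz; have h1 := fam_upper s b z hs1 hz; have h2 := fam_lower s b z hs1 hz.
    have q1 := Rle_abs hi; have q2 := Rle_abs (- m); rewrite Rabs_Ropp in q2.
    have q3 := Rle_abs (- bv 0 b); rewrite Rabs_Ropp in q3.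
    have q4 : Rabs (bv 0 b) <= Rabs (bv 0 true) + Rabs (bv 0 false).
      by have := Rabs_pos (bv 0 true); have := Rabs_pos (bv 0 false); case: (b); lra.
    have q5 := Rabs_pos hi; have q6 := Rabs_pos m; have q7 := Rabs_pos (bv 0 true).
    have q8 := Rabs_pos (bv 0 false).
    apply: Rabs_le; rewrite /K1; split; last lra.
    by apply: Rle_trans _ h2; apply: Rmin_glb; lra.
  - move=> x x0.
    have [d hd] := Heine_cor2 (fun c _ => Gc c) (mkposreal x x0) (a := ps) (b := pf).
    pose d1 := Rmin x (d / 2).
    have d10 : 0 < d1 by apply: Rmin_pos => //; have := cond_pos d; lra.
    have len : 0 < pf - ps by lra.
    exists (d1 / (pf - ps)); split; first exact: Rdiv_lt_0_compat.
    move=> s s' b z hs1 hs2 ss hz.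
    apply: Rle_trans (profile_contraction _ _ _ _ _ _ _ _ (D0 b) (hr' b) (famP s b) (famP s' b) z hz) _.
    have pp : Rabs (par s - par s') <= d1.
      rewrite (_ : par s - par s' = (s - s') * (pf - ps)); last by rewrite /par; ring.
      rewrite Rabs_mult (Rabs_right (pf - ps)); last lra.
      rewrite (_ : d1 = d1 / (pf - ps) * (pf - ps)); last by field; lra.
      by apply: Rmult_le_compat_r; lra.
    case: b; rewrite /bv; last by apply: Rle_trans pp (Rmin_l _ _).
    apply: Rlt_le; apply: (hd _ _ (par_in s hs1) (par_in s' hs2)).
    by have := Rmin_r x (d / 2); have := cond_pos d; rewrite -/d1; lra.
  - lra.
  (* The tolerance [m - m0] leaves only values of the profile at least [m0], the range where [h'] is
     below [h] by a margin. *)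
  - move=> s b z hs1 hz; rewrite (_ : m - (m - m0) = m0); last ring.
    move=> act; have [_ [dF d2F]] := famP s b.
    exists (- h' b (fam s b z) / D b); split; first exact: (is_derive_second_deriv _ _ _ _ dF).
    have := marg b (fam s b z) ltac:(have := fam_upper s b z hs1 ltac:(lra); lra).
    have -> : D b * (- h' b (fam s b z) / D b) = - h' b (fam s b z) by field; have := D0 b; lra.
    by have := etamb b; lra.
  - move=> s b hs1 _; have [F0 [dF _]] := famP s b; have [F0' _] := famP s (negb b).
    exists (- psi b (fam s b 0)); split; first exact: is_derive_rderiv.
    rewrite F0 F0'; have [h1 h2] := par_in s hs1.
    case: b {dF F0 F0'} => /=; rewrite -/kT -/kF.
    + have := Rmult_le_compat_l kT _ _ (Rlt_le _ _ kT0) (psi_le true _ _ (G_le _ _ h2)).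
      have := Rmult_le_compat_l kF _ _ (Rlt_le _ _ kF0) (psi_le false _ _ h2).
      have GE r : G r = r + kF * psi false r + sig by [].
      by move: second (GE pf) (GE (par s)); lra.
    + by rewrite /G; lra.
  (* The first profile is below [e' b], hence below the layer, beyond [Z1], and below [m] before
     [Z1]. *)
  - apply: eventually_above_le (eventually_above_max _ _ _ wm layer) _ => b z z0.
    have bst : bv 0 b <= st b.
      by rewrite /bv par0; case: (b); lra.
    have be : bv 0 b < e' b by have := st_lt b; lra.
    case: (Rle_dec Z1 z) => hz.
    + apply: Rle_trans _ (Rmax_r _ _); apply: Rle_trans _ (hZ1 b z hz).
      have [_ h1] := profile_between _ _ _ _ _ _ (D0 b) (hr' b) (famP 0 b) z z0.
      by rewrite Rmax_right in h1; lra.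
    + apply: Rle_trans _ (Rmax_l _ _).
      have := proj2 (hF (b, bv 0 b)) be z z0; rewrite /= -/(cb b) -/(fam 0 b z) => h1.
      apply: Rle_trans h1 _.
      have cb0 : 0 <= cb b by exact: sqrt_pos.
      have h2 : exp (- (cb b * Z1)) <= exp (- (cb b * z)).
        have : - (cb b * Z1) <= - (cb b * z).
          by have := Rmult_le_compat_l (cb b) z Z1 cb0 ltac:(lra); lra.
        by case=> [lt|->]; [left; apply: exp_increasing|right].
      have h3 : (e' b - m) * exp (cb b * Z1) <= e' b - bv 0 b by rewrite /st in bst; lra.
      have ee : exp (cb b * Z1) * exp (- (cb b * Z1)) = 1 by rewrite -exp_plus Rplus_opp_r exp_0.
      have := Rmult_le_compat_r _ _ _ (Rlt_le _ _ (exp_pos (- (cb b * Z1)))) h3.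
      rewrite Rmult_assoc ee Rmult_1_r.
      have := Rmult_le_compat_l (e' b - bv 0 b) _ _ ltac:(lra) h2; lra.
exists (fam 1); split=> // b z hz.
have [F0 [dF _]] := famP 1 b; have [A0 [dA _]] := hA b.
have bv1 : Rabs (bv 1 b - p b) <= tau / 2.
  rewrite /bv par1.
  case: b {F0 dF A0 dA}; first by rabs.
  by rewrite /pf (_ : _ - _ = - r3); [rewrite Rabs_left; lra|ring].
have bvlo : lo <= bv 1 b.
  by rewrite /bv par1; case: (b); lra.
have range r : 0 <= r -> lo <= fam 1 b r <= hi.
  move=> r0; split; last by apply: fam_upper; lra.
  have [h1 _] := profile_between _ _ _ _ _ _ (D0 b) (hr' b) (famP 1 b) r r0.
  by apply: Rle_trans _ h1; apply: Rmin_glb => //; have := loe' b; lra.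
(* The boundary values differ by at most [tau / 2] and the speeds by [ep], with
   [ep * Z <= tau / 2]. *)
have := flow_ge (psi b) (phi b) (fam 1 b) (A b) (tau / 2) ep Z
  (speed_monotone _ _ _ _ (D0 b) (hrt b)) dF dA
  ltac:(move=> r hr; have h1 := close b _ (range r ltac:(lra)); rabs)
  ltac:(lra) ltac:(lra) ltac:(rewrite F0 A0; rabs) z hz.
have : ep * z <= ep * Z by apply: Rmult_le_compat_l; lra.
lra.
Qed.

(** * Hair-trigger effect *)

(** For [B = R^2], positive exactly in the ball of radius [R] whose centre leaves [(xi, z0)] at time
    [T1] with velocity [(v, vz)]. *)
Definition moving_quad {N} (B : R) (xi : Pt N) z0 (v : Pt N) vz T1 (y : Pt N) (z t : R) : R :=
  B - sumsq (fun i => y i - xi i - v i * (t - T1)) -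
  (z - z0 - vz * (t - T1)) * (z - z0 - vz * (t - T1)).

Lemma sumsq_affine {n} (a v : 'I_n -> R) s :
  sumsq (fun i => a i - v i * s) =
  sumsq a - 2 * s * sumI (fun i => a i * v i) + s * s * sumsq v.
Proof.
rewrite /sumsq.
rewrite (sumI_ext _ _ (fun i => a i * a i + (- (2 * s) * (a i * v i)) + s * s * (v i * v i))).
  rewrite sumI_plus sumI_plus sumI_scale sumI_scale; ring.
by move=> i; ring.
Qed.

Lemma moving_quad_dt {N} B xi z0 (v : Pt N) vz T1 y z t :
  is_derive (fun r => moving_quad B xi z0 v vz T1 y z r) t
    (2 * sumI (fun i => (y i - xi i - v i * (t - T1)) * v i) + 2 * ((z - z0 - vz * (t - T1)) * vz)).
Proof.
apply: (is_derive_ext (fun r => B - (sumsq (fun i => y i - xi i) -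
   2 * (r - T1) * sumI (fun i => (y i - xi i) * v i) + (r - T1) * (r - T1) * sumsq v) -
   (z - z0 - vz * (r - T1)) * (z - z0 - vz * (r - T1)))).
  by move=> r; rewrite /moving_quad sumsq_affine.
auto_derive; first done.
rewrite (sumI_ext _ (fun i => (y i - xi i - v i * (t - T1)) * v i)
  (fun i => (y i - xi i) * v i + (- (t - T1)) * (v i * v i))); last by move=> i; ring.
rewrite sumI_plus sumI_scale /sumsq; ring.
Qed.

Lemma moving_quad_upd {N} B xi z0 (v : Pt N) vz T1 y z t i r :
  moving_quad B xi z0 v vz T1 (upd y i r) z t =
  moving_quad B xi z0 v vz T1 y z t +
    (y i - xi i - v i * (t - T1)) * (y i - xi i - v i * (t - T1)) -
    (r - (xi i + v i * (t - T1))) * (r - (xi i + v i * (t - T1))).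
Proof.
rewrite /moving_quad /sumsq.
rewrite (sumI_upd (fun j s => (s - xi j - v j * (t - T1)) * (s - xi j - v j * (t - T1)))).
ring.
Qed.

Lemma second_deriv_cube_quad E c be x :
  second_deriv (fun r => E * ((c - (r - be) * (r - be)) * (c - (r - be) * (r - be)) *
     (c - (r - be) * (r - be)))) x
   (E * (24 * (c - (x - be) * (x - be)) * ((x - be) * (x - be)) -
     6 * ((c - (x - be) * (x - be)) * (c - (x - be) * (x - be))))).
Proof.
apply: (is_derive_second_deriv _ (fun r => - 6 * E * ((c - (r - be) * (r - be)) *
   (c - (r - be) * (r - be))) * (r - be))).
- by move=> r; auto_derive; [done|ring].
- by auto_derive; [done|ring].
Qed.

Lemma cont_on3_moving_quad {N} (P : Pt N -> R -> R -> Prop) B xi z0 v vz T1 :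
  cont_on3 P (moving_quad B xi z0 v vz T1).
Proof.
have ct c : continuity (fun t => c * (t - T1)).
  by apply: (is_derive_continuity _ (fun _ => c)) => x; auto_derive; [done|ring].
have cz : cont_on3 P (fun (_ : Pt N) z t => z - z0 - vz * (t - T1)).
  apply: cont_on3_minus; last exact: (cont_on3_t _ (fun t => vz * (t - T1))).
  apply: (cont_on3_z _ (fun z => z - z0)).
  by apply: (is_derive_continuity _ (fun _ => 1)) => x; auto_derive; [done|ring].
apply: cont_on3_minus; last exact: cont_on3_mult.
apply: cont_on3_minus; first exact: cont_on3_const.
apply: (cont_on3_sumI P _ (fun i y z t => (y i - xi i - v i * (t - T1)) * (y i - xi i - v i * (t - T1)))) => i.
have cy : cont_on3 P (fun y _ t => y i - xi i - v i * (t - T1)).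
  apply: cont_on3_minus; last exact: (cont_on3_t _ (fun t => v i * (t - T1))).
  by apply: cont_on3_minus; [exact: cont_on3_coord|exact: cont_on3_const].
exact: cont_on3_mult.
Qed.

Lemma sq_lt_abs x r : 0 < r -> x * x < r * r -> Rabs x < r.
Proof. by move=> r0 h; apply: Rabs_def1; nra. Qed.

(* The cube of the quadratic is smooth, positive inside the ball and negative
   outside, where a nonnegative solution needs no comparison. *)
Lemma moving_ball {N} D kap h (w : bool -> Pt N -> R -> R -> R) b gam s0
    (xi v : Pt N) z0 vz Rr eps kk V al T1 T2 :
  (forall b, 0 < D b) -> (forall b, 0 < kap b) -> pair_solution D kap h w ->
  (forall b y z t, 0 <= z -> 0 <= t -> 0 <= w b y z t) ->
  (forall r, 0 <= r <= s0 -> gam * r <= h b r) ->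
  0 < eps -> 0 < Rr -> 0 <= kk -> eps * ((Rr * Rr) * (Rr * Rr) * (Rr * Rr)) <= s0 ->
  sumsq v + vz * vz <= V -> 0 < al ->
  (forall q, 0 < q <= Rr * Rr ->
     3 * q * (al * (Rr * Rr) + V / al) + 6 * D b * (INR (N.-1) + 1) * q <
     (kk + gam) * (q * q) + 24 * D b * (Rr * Rr - q)) ->
  0 <= T1 -> (forall t, T1 <= t <= T2 -> Rr <= z0 + vz * (t - T1)) ->
  (forall y z, 0 <= z -> 0 < moving_quad (Rr * Rr) xi z0 v vz T1 y z T1 ->
     eps * ((Rr * Rr) * (Rr * Rr) * (Rr * Rr)) <= w b y z T1) ->
  forall y z t, 0 <= z -> T1 <= t <= T2 ->
    let q := moving_quad (Rr * Rr) xi z0 v vz T1 y z t in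
    eps * exp (- kk * (t - T1)) * (q * q * q) <= w b y z t.
Proof.
move=> D0 k0 sol w0 hgam eps0 R0 kk0 epss hV al0 poly T10 hcen init y1 z1 t1 z10 ht1.
pose B := Rr * Rr; have B0 : 0 < B by rewrite /B; nra.
pose q := moving_quad B xi z0 v vz T1.
pose E t := eps * exp (- kk * (t - T1)).
(* On the other side the constant [-1] lies below the nonnegative [w], hence is never active. *)
pose S b' y z t := if b' == b then E t * (q y z t * q y z t * q y z t) else -1.
pose n := N.-1; pose tau := T2 - T1.
have tau0 : 0 <= tau by rewrite /tau; lra.
have av : 0 <= sumI (fun i => Rabs (v i)) by apply: sumI_ge0 => i; exact: Rabs_pos.
have ax : 0 <= sumI (fun i => Rabs (xi i)) by apply: sumI_ge0 => i; exact: Rabs_pos.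
have ay : 0 <= sumI (fun i => Rabs (y1 i)) by apply: sumI_ge0 => i; exact: Rabs_pos.
have avz := Rabs_pos vz; have az := Rabs_pos z0.
have avt : 0 <= sumI (fun i => Rabs (v i)) * tau by exact: Rmult_le_pos.
have avzt : 0 <= Rabs vz * tau by exact: Rmult_le_pos.
pose M := 1 + sumI (fun i => Rabs (xi i)) + sumI (fun i => Rabs (v i)) * tau + Rabs z0 +
  Rabs vz * tau + Rr + sumI (fun i => Rabs (y1 i)) + z1.
have qB y z t : q y z t <= B.
  have := Rle_0_sqr (z - z0 - vz * (t - T1)); rewrite /Rsqr /q /moving_quad.
  by have := sumsq_ge0 _ (fun i => y i - xi i - v i * (t - T1)); lra.
have Epos t : 0 < E t by apply: Rmult_lt_0_compat => //; exact: exp_pos.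
have Ele t : T1 <= t -> E t <= eps.
  move=> ht; rewrite /E -{2}(Rmult_1_r eps); apply: Rmult_le_compat_l; first lra.
  rewrite -exp_0; have : - kk * (t - T1) <= 0 by have := Rmult_le_pos kk (t - T1) kk0; lra.
  by case=> [lt|->]; [left; apply: exp_increasing|right].
have inner y z t : 0 < q y z t ->
   (forall i, Rabs (y i - xi i - v i * (t - T1)) < Rr) /\ Rabs (z - z0 - vz * (t - T1)) < Rr.
  rewrite /q /moving_quad /B => pos; have := Rle_0_sqr (z - z0 - vz * (t - T1)).
  rewrite /Rsqr => sz; split.
  - move=> i; apply: sq_lt_abs => //.
    by have := sumsq_ge_term _ (fun i => y i - xi i - v i * (t - T1)) i; lra.
  - by apply: sq_lt_abs => //; have := sumsq_ge0 _ (fun i => y i - xi i - v i * (t - T1)); lra.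
have cube r : 0 < r * r * r -> 0 < r.
  by move=> hr; apply: Rnot_le_lt => le; have : r * r * r <= 0 by [nra]; lra.
have box1 : in_box M 0 M T1 T2 y1 z1 t1.
  split; last by rewrite /M; lra.
  by move=> i; have := sumI_ge_term _ (fun i => Rabs (y1 i)) i (fun _ => Rabs_pos _); rewrite /M; lra.
have := comparison D kap h w S (Rabs gam) M T1 T2 D0 k0 sol.
move=> cmp; have : S b y1 z1 t1 <= w b y1 z1 t1; last by rewrite /S eq_refl.
apply: cmp box1 => //; last first.
- move=> b' y z t [By [Bz Bt]] act.
  case: (eqVneq b' b) => [bb|nbb]; last first.
    by exfalso; move: act; rewrite /S (negbTE nbb); have := w0 b' y z t; lra.
  subst b'; have wp := w0 b y z t ltac:(lra) ltac:(lra).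
  have SE z' : S b y z' t = E t * (q y z' t * q y z' t * q y z' t) by rewrite /S eq_refl.
  have qp : 0 < q y z t.
    apply: cube; apply: (Rmult_lt_reg_l (E t)); first exact: Epos.
    by rewrite Rmult_0_r; rewrite SE in act; lra.
  have [iy iz] := inner y z t qp.
  have cen := hcen t Bt.
  (* The centre stays at height at least [Rr], so the ball does not meet the interface and no flux
     condition has to be checked. *)
  have zp : 0 < z by rabs.
  have qle := qB y z t.
  have tt : 0 <= t - T1 <= tau by rewrite /tau; lra.
  have q3 : 0 < q y z t * q y z t * q y z t <= B * B * B.
    have q2 : 0 < q y z t * q y z t by apply: Rmult_lt_0_compat.
    split; first exact: Rmult_lt_0_compat.
    by apply: Rmult_le_compat; try lra; apply: Rmult_le_compat; lra.
  have Sle : S b y z t <= eps * (B * B * B).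
    by rewrite SE; apply: Rmult_le_compat; try lra; [exact: Rlt_le (Epos t)|apply: Ele; lra].
  split.
    case: (Req_dec t T1) => [te|]; last lra.
    have := init y z ltac:(lra); rewrite te in act qp Sle; rewrite -/B -/(q y z T1) => h1.
    by have := h1 qp; lra.
  split.
    move=> i; have h1 := sumI_ge_term _ (fun i => Rabs (v i)) i (fun _ => Rabs_pos _).
    have h2 := sumI_ge_term _ (fun i => Rabs (xi i)) i (fun _ => Rabs_pos _).
    have h3 : Rabs (v i * (t - T1)) <= sumI (fun i => Rabs (v i)) * tau.
      rewrite Rabs_mult (Rabs_right (t - T1)); last lra.
      by apply: Rmult_le_compat; try lra; exact: Rabs_pos.
    have h4 := Rabs_triang (y i - xi i - v i * (t - T1)) (xi i + v i * (t - T1)).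
    have h5 := Rabs_triang (xi i) (v i * (t - T1)).
    rewrite (_ : _ + (xi i + v i * (t - T1)) = y i) in h4; last ring.
    by have := iy i; rewrite /M; lra.
  split.
    have h3 : Rabs (vz * (t - T1)) <= Rabs vz * tau.
      rewrite Rabs_mult (Rabs_right (t - T1)); last lra.
      by apply: Rmult_le_compat; try lra; exact: Rabs_pos.
    have h4 := Rle_abs z0; have h5 := Rle_abs (vz * (t - T1)).
    by move/Rabs_def2: iz => [i1 i2]; rewrite /M; lra.
  split; last by lra.
  move=> _.
  pose X i := y i - xi i - v i * (t - T1); pose Zc := z - z0 - vz * (t - T1).
  pose qt := 2 * sumI (fun i => X i * v i) + 2 * (Zc * vz).
  exists (E t * (3 * (q y z t * q y z t) * qt - kk * (q y z t * q y z t * q y z t))),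
    (fun i => E t * (24 * q y z t * (X i * X i) - 6 * (q y z t * q y z t))),
    (E t * (24 * q y z t * (Zc * Zc) - 6 * (q y z t * q y z t))).
  split.
    apply/is_derive_Reals; rewrite /S eq_refl.
    have dq := moving_quad_dt B xi z0 v vz T1 y z t.
    have dE : is_derive E t (- kk * E t) by rewrite /E; auto_derive; [done|rewrite /Rminus; ring].
    evar_last.
      apply: (is_derive_mult E (fun r => q y z r * q y z r * q y z r)).
      - exact: dE.
      - apply: (is_derive_mult (fun r => q y z r * q y z r) (fun r => q y z r)).
        + by apply: (is_derive_mult (fun r => q y z r) (fun r => q y z r) _ _ _ dq dq); move=> *; apply: Rmult_comm.
        + exact: dq.
        + by move=> *; apply: Rmult_comm.
      - by move=> *; apply: Rmult_comm.
    by rewrite /plus /mult /= /qt /X /Zc /q; ring.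
  split.
    move=> i; pose be := xi i + v i * (t - T1); pose c := q y z t + X i * X i.
    apply: (second_deriv_ext (fun r => E t * ((c - (r - be) * (r - be)) * (c - (r - be) * (r - be)) *
       (c - (r - be) * (r - be))))).
      by move=> r; rewrite /S eq_refl /q moving_quad_upd.
    have := second_deriv_cube_quad (E t) c be (y i).
    rewrite (_ : y i - be = X i); last by rewrite /be /X; ring.
    by rewrite (_ : c - X i * X i = q y z t); [|rewrite /c; ring].
  split.
    pose be := z0 + vz * (t - T1); pose c := q y z t + Zc * Zc.
    apply: (second_deriv_ext (fun r => E t * ((c - (r - be) * (r - be)) * (c - (r - be) * (r - be)) *
       (c - (r - be) * (r - be))))).
      move=> r; rewrite /S eq_refl (_ : c - (r - be) * (r - be) = q y r t) //.
      by rewrite /c /be /Zc /q /moving_quad; ring.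
    have := second_deriv_cube_quad (E t) c be z.
    rewrite (_ : z - be = Zc); last by rewrite /be /Zc; ring.
    by rewrite (_ : c - Zc * Zc = q y z t); [|rewrite /c; ring].
  have sX : sumsq X + Zc * Zc = B - q y z t by rewrite /q /moving_quad -/X /Zc; ring.
  have -> : sumI (fun i => E t * (24 * q y z t * (X i * X i) - 6 * (q y z t * q y z t))) =
      E t * (24 * q y z t * sumsq X - 6 * INR n * (q y z t * q y z t)).
    rewrite sumI_scale (sumI_ext _ _ (fun i => 24 * q y z t * (X i * X i) + - (6 * (q y z t * q y z t)))).
      by rewrite sumI_plus sumI_scale sumI_const -/n /sumsq; ring.
    by move=> i; ring.
  (* Young's inequality with weight [al], coordinate by coordinate, together with
     [sumsq X + Zc * Zc <= B]. *)
  have qtb : qt <= al * B + V / al.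
    have h1 : 2 * sumI (fun i => X i * v i) <= al * sumsq X + sumsq v / al.
      rewrite /sumsq /Rdiv (Rmult_comm _ (/ al)) -!sumI_scale -sumI_plus.
      apply: sumI_le => i.
      have : 0 <= (al * X i - v i) * (al * X i - v i) / al.
        by apply: Rdiv_le_0_compat => //; exact: Rle_0_sqr.
      rewrite (_ : _ / al = al * (X i * X i) - 2 * (X i * v i) + / al * (v i * v i)); first lra.
      by field; lra.
    have h2 : 2 * (Zc * vz) <= al * (Zc * Zc) + vz * vz / al.
      have : 0 <= (al * Zc - vz) * (al * Zc - vz) / al.
        by apply: Rdiv_le_0_compat => //; exact: Rle_0_sqr.
      rewrite (_ : _ / al = al * (Zc * Zc) - 2 * (Zc * vz) + vz * vz / al); first lra.
      by field; lra.
    have h3 : al * (sumsq X + Zc * Zc) <= al * B by apply: Rmult_le_compat_l; lra.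
    have h4 : (sumsq v + vz * vz) / al <= V / al.
      by apply: Rmult_le_compat_r => //; apply: Rlt_le; apply: Rinv_0_lt_compat.
    by rewrite /qt; rewrite /Rdiv Rmult_plus_distr_r in h4; rewrite /Rdiv in h1 h2 *; lra.
  have p := poly (q y z t) (conj qp qle).
  have q3t : 3 * q y z t * qt <= 3 * q y z t * (al * B + V / al).
    by apply: Rmult_le_compat_l; lra.
  have hw := hgam (w b y z t) ltac:(rewrite -/B in epss; lra).
  have hw2 : gam * S b y z t <= h b (w b y z t) + Rabs gam * (S b y z t - w b y z t).
    have : gam * (S b y z t - w b y z t) <= Rabs gam * (S b y z t - w b y z t).
      by apply: Rmult_le_compat_r; [lra|exact: Rle_abs].
    lra.
  apply: Rlt_le_trans hw2; rewrite SE.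
  (* Divided by [E t * q], the differential inequality for the cube becomes the polynomial one; its
     term [24 D (R^2 - q)] comes from the squared gradient. *)
  have Eq : 0 < E t * q y z t by apply: Rmult_lt_0_compat.
  have := Rmult_lt_compat_l _ _ _ Eq (Rle_lt_trans _ _ _
    (Rplus_le_compat_r (6 * D b * (INR n + 1) * q y z t) _ _ q3t) p).
  rewrite -/B -sX; move: (sumsq X) (Zc * Zc) => sx zz.
  lra.
- rewrite /M; lra.
- move=> b'; rewrite /S; case: eqP => _; last exact: cont_on3_const.
  apply: cont_on3_mult.
    apply: (cont_on3_t _ E).
    by apply: (is_derive_continuity _ (fun t => eps * (- kk * exp (- kk * (t - T1))))) => x;
      rewrite /E; auto_derive; [done|rewrite /Rminus; ring].
  by apply: cont_on3_mult; [apply: cont_on3_mult|]; exact: cont_on3_moving_quad.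
Qed.

Lemma am_gm_strict c mu q : 0 < mu -> 0 < q ->
  c * q < (c * c / (4 * mu) + 1) * (q * q) + mu.
Proof.
move=> m0 q0.
have : 0 <= (c * q / 2 - mu) * (c * q / 2 - mu) / mu.
  by apply: Rdiv_le_0_compat => //; exact: Rle_0_sqr.
rewrite (_ : _ / mu = c * c / (4 * mu) * (q * q) + mu - c * q); last by field; lra.
have := Rmult_lt_0_compat q q q0 q0; lra.
Qed.

Lemma moving_quad_center {N} B (xi : Pt N) z0 v vz T1 y z t :
  (forall i, y i = xi i + v i * (t - T1)) -> z = z0 + vz * (t - T1) ->
  moving_quad B xi z0 v vz T1 y z t = B.
Proof.
move=> hy hz; rewrite /moving_quad /sumsq (sumI_ext _ _ (fun _ => 0)).
  by rewrite sumI_const hz; ring.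
by move=> i; rewrite hy; ring.
Qed.

Lemma moving_quad_inside {N} Rr (xi : Pt N) z0 v vz T1 y z :
  0 < Rr -> 0 < moving_quad (Rr * Rr) xi z0 v vz T1 y z T1 ->
  (forall i, Rabs (y i - xi i) < Rr) /\ Rabs (z - z0) < Rr.
Proof.
move=> R0; rewrite /moving_quad !Rminus_diag => pos.
have := Rle_0_sqr (z - z0 - vz * 0); rewrite /Rsqr => sz.
have h1 := sumsq_ge0 _ (fun i => y i - xi i - v i * 0).
split.
- move=> i; apply: sq_lt_abs => //.
  have := sumsq_ge_term _ (fun i => y i - xi i - v i * 0) i.
  by rewrite Rmult_0_r Rminus_0_r; lra.
- by apply: sq_lt_abs => //; rewrite Rmult_0_r Rminus_0_r in sz pos; lra.
Qed.

(** Takes the place of a strong maximum principle: a small ball on which the datum is positive moves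
    in a straight line so that its centre is at [(y, z)] at time [t], while its amplitude decays at
    a sufficiently large rate [kk]. Its radius is at most both end heights, which keeps the ball off
    the interface. *)
Lemma positivity {N} D kap h (w : bool -> Pt N -> R -> R -> R) K L b y0 z0 :
  (forall b, 0 < D b) -> (forall b, 0 < kap b) -> pair_solution D kap h w ->
  (forall b y z t, 0 <= z -> 0 <= t -> 0 <= w b y z t) -> 0 < K -> 0 < L ->
  (forall r, 0 <= r <= K -> - L * r <= h b r) ->
  0 < z0 -> 0 < w b y0 z0 0 -> forall y z t, 0 < z -> 0 < t -> 0 < w b y z t.
Proof.
move=> D0 k0 sol w0 K0 L0 hh z00 wp y z t zp tp.
have [d [d0 hd]] := sol_cont _ _ _ _ sol b y0 z0 0 ltac:(split; lra) (w b y0 z0 0 / 2) ltac:(lra).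
pose Rr := Rmin (Rmin d z0) z.
have [R0 [R1 [R2 R3]]] : 0 < Rr /\ Rr <= d /\ Rr <= z0 /\ Rr <= z.
  have h1 := Rmin_l (Rmin d z0) z; have h2 := Rmin_r (Rmin d z0) z.
  have h3 := Rmin_l d z0; have h4 := Rmin_r d z0; rewrite -/Rr in h1 h2.
  by split; [do 2 (apply: Rmin_pos => //)|lra].
pose B := Rr * Rr; have B0 : 0 < B by rewrite /B; nra.
have B3 : 0 < B * B * B by do 2 (apply: Rmult_lt_0_compat => //).
pose mn := Rmin (w b y0 z0 0 / 2) K.
have mn0 : 0 < mn by apply: Rmin_pos; lra.
pose eps := mn / (B * B * B).
have eps0 : 0 < eps by apply: Rdiv_lt_0_compat.
have epsB : eps * (B * B * B) = mn by rewrite /eps; field; lra.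
pose v i := (y i - y0 i) / t; pose vz := (z - z0) / t.
pose V := sumsq v + vz * vz.
have V0 : 0 <= V by rewrite /V; have := sumsq_ge0 _ v; have := Rle_0_sqr vz; rewrite /Rsqr; lra.
have Db := D0 b.
(* [c] collects the terms linear in [q] of the polynomial inequality for [al = 1]; the decay rate
   then dominates [c q] by the arithmetic-geometric mean inequality against [24 D B]. *)
pose c := 3 * (B + V) + 6 * D b * (INR (N.-1) + 1) + 24 * D b.
pose kk := L + (c * c / (4 * (24 * D b * B)) + 1).
have DB : 0 < 24 * D b * B by apply: Rmult_lt_0_compat; lra.
have kk0 : 0 <= kk.
  have : 0 <= c * c / (4 * (24 * D b * B)).
    by apply: Rdiv_le_0_compat; [exact: Rle_0_sqr|lra].
  by rewrite /kk; lra.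
have := moving_ball D kap h w b (- L) K y0 v z0 vz Rr eps kk V 1 0 t D0 k0 sol w0 hh eps0 R0 kk0.
move=> mb.
have := mb _ (Rle_refl _) Rlt_0_1 _ (Rle_refl _) _ _ y z t ltac:(lra) ltac:(lra).
rewrite moving_quad_center; first last.
- by rewrite Rminus_0_r /vz; field; lra.
- by move=> i; rewrite Rminus_0_r /v; field; lra.
rewrite -/B => fin; apply: Rlt_le_trans (fin _ _ _ _).
- by do 2 (apply: Rmult_lt_0_compat => //); exact: exp_pos.
- by rewrite epsB; exact: Rmin_r.
- move=> q [q0 qB]; rewrite (_ : V / 1 = V); last by field.
  have := am_gm_strict c (24 * D b * B) q DB q0; rewrite -/B (_ : kk + - L = c * c / (4 * (24 * D b * B)) + 1); last by rewrite /kk; ring.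
  by rewrite {1}/c; lra.
- move=> r hr; rewrite Rminus_0_r /vz.
  have e1 : z0 + (z - z0) / t * r - Rr = (z0 - Rr) * ((t - r) / t) + (z - Rr) * (r / t).
    by field; lra.
  have h1 : 0 <= (z0 - Rr) * ((t - r) / t).
    by apply: Rmult_le_pos; [lra|apply: Rdiv_le_0_compat; lra].
  have h2 : 0 <= (z - Rr) * (r / t) by apply: Rmult_le_pos; [lra|apply: Rdiv_le_0_compat; lra].
  lra.
- move=> y' z' z'0 pos; rewrite epsB.
  have [iy iz] := moving_quad_inside Rr y0 z0 v vz 0 y' z' R0 pos.
  have := hd y' z' 0 ltac:(split; lra) (fun i => Rlt_le_trans _ _ _ (iy i) R1) ltac:(lra)
    ltac:(rewrite Rminus_diag Rabs_R0; lra).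
  by have := Rmin_l (w b y0 z0 0 / 2) K; rewrite -/mn => q1 q2; rabs.
Qed.

(** In a large ball the linear growth [gam] outweighs diffusion and a slow motion, so a small
    amplitude is transported without decay. Steering the ball from [(xi, z0)] to each point at
    height at least [Rr] gives a lower bound on a cone; elsewhere the bound 0 is recorded. *)
Lemma spreading {N} (D kap : bool -> R) h (b : bool) gam s0 :
  (forall b, 0 < D b) -> (forall b, 0 < kap b) -> 0 < gam -> 0 < s0 ->
  (forall r, 0 <= r <= s0 -> gam * r <= h b r) ->
  exists Rr, 0 < Rr /\ forall (w : bool -> Pt N -> R -> R -> R) (xi : Pt N) z0 T1 e0,
    pair_solution D kap h w -> (forall b y z t, 0 <= z -> 0 <= t -> 0 <= w b y z t) ->
    Rr <= z0 -> 0 <= T1 -> 0 < e0 ->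
    (forall y z, 0 <= z -> (forall i, Rabs (y i - xi i) < Rr) -> Rabs (z - z0) < Rr ->
       e0 <= w b y z T1) ->
    exists del, 0 < del /\
      eventually_above w (fun b' z => if (b' == b) && (if Rle_dec Rr z then true else false)
                                      then del else 0).
Proof.
move=> D0 k0 gam0 s00 hh; have Db := D0 b.
pose n := N.-1; have n0 : 0 <= INR n by apply: pos_INR.
have Dg : 0 < 24 * D b * gam by apply: Rmult_lt_0_compat; lra.
(* The terms [gam q^2 + 24 D R^2] are at least [2 s R q]. A quarter of this pays for motion at speed
   [c], and [s R = c1 + 1] lets another part pay for the linear terms [c1 q]. *)
pose s := sqrt (24 * D b * gam).
have s_pos : 0 < s by exact: sqrt_lt_R0.
have ss : s * s = 24 * D b * gam by apply: sqrt_sqrt; lra.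
pose c := s / (6 * (INR n + 2)).
have c0 : 0 < c by apply: Rdiv_lt_0_compat; lra.
pose c1 := 6 * D b * (INR n + 1) + 24 * D b.
have c10 : 0 < c1 by rewrite /c1; have := Rmult_le_pos (D b) (INR n) ltac:(lra) n0; lra.
pose Rr := (c1 + 1) / s.
have R0 : 0 < Rr by apply: Rdiv_lt_0_compat; lra.
have Rs : s * Rr = c1 + 1 by rewrite /Rr; field; lra.
exists Rr; split=> // w xi z0 T1 e0 sol w0 z0R T10 e00 init.
pose B := Rr * Rr; have B0 : 0 < B by rewrite /B; nra.
have B3 : 0 < B * B * B by do 2 (apply: Rmult_lt_0_compat => //).
pose del := Rmin e0 s0; have del0 : 0 < del by apply: Rmin_pos.
exists del; split=> //.
have ax : 0 <= sumI (fun i => Rabs (xi i)) by apply: sumI_ge0 => i; exact: Rabs_pos.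
pose X := sumI (fun i => Rabs (xi i)) + Rabs z0 + 1.
have X0 : 0 < X by rewrite /X; have := Rabs_pos z0; lra.
(* Half of the admissible speed is kept for the cone; the other half makes up for the delay [T1] and
   the offset [X] of the starting point. *)
exists (c / 2), (2 * (T1 + X / c) + 1).
have Xc : 0 < X / c by apply: Rdiv_lt_0_compat.
split; first lra; split; first lra.
move=> b' y z t Tt hy hz.
have tp : 0 <= t by lra.
case: (eqVneq b' b) => [->|_]; last by apply: w0; lra.
case: Rle_dec => hRz /=; last by apply: w0; lra.
have tT : 0 < t - T1 by lra.
have ct : c / 2 * t + X <= c * (t - T1).
  have -> : X = c * (X / c) by field; lra.
  have : c * (T1 + X / c + t / 2) <= c * t by apply: Rmult_le_compat_l; lra.
  lra.
pose v i := (y i - xi i) / (t - T1); pose vz := (z - z0) / (t - T1).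
have quot a : Rabs a <= c * (t - T1) -> (a / (t - T1)) * (a / (t - T1)) <= c * c.
  move=> ha.
  have h1 : Rabs (a / (t - T1)) <= c.
    rewrite /Rdiv Rabs_mult (Rabs_right (/ (t - T1))); last first.
      by apply: Rle_ge; apply: Rlt_le; apply: Rinv_0_lt_compat.
    apply: (Rmult_le_reg_r (t - T1)) => //.
    by rewrite Rmult_assoc Rinv_l; lra.
  have : Rabs (a / (t - T1)) * Rabs (a / (t - T1)) <= c * c.
    by apply: Rmult_le_compat => //; exact: Rabs_pos.
  by rewrite -Rabs_mult Rabs_right //; apply: Rle_ge; exact: Rle_0_sqr.
have vi i : v i * v i <= c * c.
  apply: quot; have := hy i.
  have := sumI_ge_term _ (fun i => Rabs (xi i)) i (fun _ => Rabs_pos _) => h1.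
  have := Rabs_triang (y i) (- xi i); rewrite Rabs_Ropp -/(Rminus (y i) (xi i)).
  have := Rabs_pos z0; rewrite /X in ct; lra.
have vzc : vz * vz <= c * c.
  apply: quot; have := Rabs_triang z (- z0); rewrite Rabs_Ropp -/(Rminus z z0).
  by rewrite (Rabs_right z); rewrite /X in ct; lra.
pose V := (INR n + 1) * (c * c).
have hV : sumsq v + vz * vz <= V.
  have : sumsq v <= INR n * (c * c) by rewrite -sumI_const; apply: sumI_le.
  by rewrite /V; lra.
(* With this weight both terms of Young's inequality are multiples of [c * Rr], with sum
   [(n + 2) c Rr]. *)
have al0 : 0 < c / Rr by apply: Rdiv_lt_0_compat.
have epsB : del / (B * B * B) * (B * B * B) = del by field; lra.
have := moving_ball D kap h w b gam s0 xi v z0 vz Rr (del / (B * B * B)) 0 V (c / Rr) T1 t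
  D0 k0 sol w0 hh ltac:(apply: Rdiv_lt_0_compat; lra) R0 (Rle_refl _).
move=> mb; have := mb _ hV al0 _ T10 _ _ y z t ltac:(lra) ltac:(lra).
rewrite moving_quad_center; first last.
- by rewrite /vz; field; lra.
- by move=> i; rewrite /v; field; lra.
rewrite -/B => fin; apply: Rle_trans (fin _ _ _ _).
- by rewrite Ropp_0 Rmult_0_l exp_0 Rmult_1_r epsB; lra.
- by rewrite epsB; exact: Rmin_r.
- move=> q [q0 qB].
  have -> : c / Rr * B + V / (c / Rr) = (INR n + 2) * c * Rr by rewrite /B /V; field; lra.
  have -> : 3 * q * ((INR n + 2) * c * Rr) = q * (s * Rr) / 2 by rewrite /c; field; lra.
  rewrite Rplus_0_l -/n.
  have h1 : 2 * (s * Rr) * q <= gam * (q * q) + 24 * D b * B.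
    have := Rle_0_sqr (gam * q - s * Rr); rewrite /Rsqr.
    rewrite (_ : _ * _ = gam * (gam * (q * q) - 2 * (s * Rr) * q) + (s * s) * B); last by rewrite /B; ring.
    rewrite ss => h2.
    have h3 : 0 <= gam * (gam * (q * q) + 24 * D b * B - 2 * (s * Rr) * q) by lra.
    have := Rmult_le_reg_l gam 0 _ gam0 ltac:(rewrite Rmult_0_r; exact: h3); lra.
  have h4 : (c1 + 1) * q = s * Rr * q by rewrite Rs.
  have h5 : 0 < (c1 + 1) * q by apply: Rmult_lt_0_compat; lra.
  have h6 : (6 * D b * (INR n + 1) * q) = c1 * q - 24 * D b * q by rewrite /c1; ring.
  rewrite h6 -/B; lra.
- move=> r hr; rewrite /vz.
  have e1 : z0 + (z - z0) / (t - T1) * (r - T1) - Rr =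
     (z0 - Rr) * ((t - r) / (t - T1)) + (z - Rr) * ((r - T1) / (t - T1)) by field; lra.
  have h1 : 0 <= (z0 - Rr) * ((t - r) / (t - T1)).
    by apply: Rmult_le_pos; [lra|apply: Rdiv_le_0_compat; lra].
  have h2 : 0 <= (z - Rr) * ((r - T1) / (t - T1)).
    by apply: Rmult_le_pos; [lra|apply: Rdiv_le_0_compat; lra].
  lra.
- move=> y' z' z'0 pos; rewrite -/B epsB.
  have [iy iz] := moving_quad_inside Rr xi z0 v vz T1 y' z' R0 pos.
  by have := init y' z' z'0 iy iz; have := Rmin_l e0 s0; rewrite -/del; lra.
Qed.

(** * Carrying positivity across the interface *)

Lemma derivable_pt_lim_local (f g : R -> R) x l d : 0 < d ->
  (forall s, Rabs (s - x) < d -> f s = g s) -> derivable_pt_lim g x l -> derivable_pt_lim f x l.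
Proof.
move=> d0 fg hg e e0; have [[d1 d10] /= h] := hg e e0.
have dd : 0 < Rmin d d1 by apply: Rmin_pos.
exists (mkposreal _ dd) => k k0 /= kd; have m1 := Rmin_l d d1; have m2 := Rmin_r d d1.
rewrite !fg; first by apply: h => //; lra.
- by rewrite Rminus_diag Rabs_R0.
- by rewrite (_ : x + k - x = k); [lra|ring].
Qed.

Lemma second_deriv_local (f g : R -> R) x l d : 0 < d ->
  (forall s, Rabs (s - x) < d -> f s = g s) -> second_deriv g x l -> second_deriv f x l.
Proof.
move=> d0 fg [g' [[d1 [d10 h1]] h2]]; exists g'; split=> //.
exists (Rmin d d1 / 2); have dd : 0 < Rmin d d1 by apply: Rmin_pos.
have m1 := Rmin_l d d1; have m2 := Rmin_r d d1; split; first lra.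
move=> s hs; apply: (derivable_pt_lim_local f g s _ (Rmin d d1 / 2)); first lra.
- move=> r hr; apply: fg.
  by have := Rabs_triang (r - s) (s - x); rewrite (_ : r - s + (s - x) = r - x); [lra|ring].
- by apply: h1; lra.
Qed.

(** Truncation keeps the barrier bounded. Its kink at [l] will lie where the barrier is already
    below a known lower bound of the solution, so a second derivative is needed for [z < l] only. *)
Lemma truncated_quadratic a0 a1 a2 l : 0 < l ->
  let f z := a0 + a1 * Rmin z l + a2 * (Rmin z l * Rmin z l) in
  continuity f /\ (forall z, z < l -> second_deriv f z (2 * a2)) /\ rderiv f 0 a1.
Proof.
move=> l0 f.
pose g z := a0 + a1 * z + a2 * (z * z).
have dg z : is_derive g z (a1 + 2 * a2 * z) by rewrite /g; auto_derive; [done|ring].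
have loc x : x < l -> forall s, Rabs (s - x) < l - x -> f s = g s.
  by move=> xl s hs; rewrite /f Rmin_left //; rabs.
split.
  have mc : continuity (fun z => Rmin z l).
    apply: (lipschitz_continuity _ 1); apply: lipschitz_min; first exact: lipschitz_id.
    by apply: lipschitz_const; lra.
  move=> x; apply: (continuity_pt_comp (fun z => Rmin z l) g); first exact: mc.
  exact: (is_derive_continuity _ _ dg).
split.
  move=> z zl; apply: (second_deriv_local f g z _ (l - z)); [lra|exact: loc|].
  apply: (is_derive_second_deriv _ _ _ _ dg).
  by auto_derive; [done|ring].
apply: is_derive_rderiv; apply/is_derive_Reals.
apply: (derivable_pt_lim_local f g 0 _ (l - 0)); [lra|exact: loc|].
by apply/is_derive_Reals; have := dg 0; rewrite Rmult_0_r Rplus_0_r.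
Qed.

(** The datum may vanish on one side entirely. Positivity first spreads on side [b] down to height
    [R1]; a barrier held up by this bound then fills the gap to the interface and reaches into side
    [b'], where it feeds a second spreading ball. The layer and the two spreading bounds leave no
    gap. *)
Lemma hair_trigger {N} D kap h (w : bool -> Pt N -> R -> R -> R) K gam s0 :
  (forall b, 0 < D b) -> (forall b, 0 < kap b) -> (forall b, loc_lipschitz (h b)) ->
  pair_solution D kap h w -> 0 < K ->
  (forall b y z t, 0 <= z -> 0 <= t -> 0 <= w b y z t <= K) ->
  (forall b, h b 0 = 0) -> 0 < gam -> 0 < s0 ->
  (forall b r, 0 <= r <= s0 -> gam * r <= h b r) ->
  (exists b y z, 0 <= z /\ w b y z 0 <> 0) ->
  exists m, 0 < m /\ eventually_above w (fun _ _ => m).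
Proof.
move=> D0 k0 hl sol K0 wK h0 gam0 s00 hh [b [y0 [z0 [z00 wne]]]].
have w0 b' y z t : 0 <= z -> 0 <= t -> 0 <= w b' y z t by move=> z1 t1; have := wK b' y z t z1 t1; lra.
have [L [L0 hL]] := loc_lipschitz_pair h K hl K0.
have hneg b' r : Rabs r <= K -> - L * Rabs r <= h b' r.
  move=> hr; have := hL b' r 0 hr ltac:(rewrite Rabs_R0; lra).
  by rewrite h0 !Rminus_0_r => q; rabs.
(* The given point may lie on the interface; continuity moves it inside. *)
have [z1 [z10 wz1]] : exists z1, 0 < z1 /\ 0 < w b y0 z1 0.
  have wp : 0 < w b y0 z0 0 by have := w0 b y0 z0 0 z00 (Rle_refl 0); lra.
  have [d [d0 hd]] := sol_cont _ _ _ _ sol b y0 z0 0 ltac:(split; lra) (w b y0 z0 0) wp.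
  exists (z0 + d / 2); split; first lra.
  have := hd y0 (z0 + d / 2) 0 ltac:(split; lra)
    (fun i => ltac:(rewrite Rminus_diag Rabs_R0; lra)) ltac:(rewrite Rabs_right; lra)
    ltac:(rewrite Rminus_diag Rabs_R0; lra).
  by move=> q; rabs.
have pos := positivity D kap h w K L b y0 z1 D0 k0 sol w0 K0 L0
  ltac:(move=> r hr; have := hneg b r; rewrite Rabs_right; [move=> q; apply: q; lra|lra]) z10 wz1.
pose b' := negb b.
have [R1 [R10 sp1]] := @spreading N D kap h b gam s0 D0 k0 gam0 s00 (hh b).
have [R2 [R20 sp2]] := @spreading N D kap h b' gam s0 D0 k0 gam0 s00 (hh b').
have [ym [zm [tm [hm minw]]]] := box_min half_space_time (w b) R1 1 (2 * R1 + 1) 1 1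
  (sol_cont _ _ _ _ sol b) ltac:(move=> y z t [_ [? ?]]; split; lra) ltac:(lra) ltac:(lra) ltac:(lra).
have em : 0 < w b ym zm tm by case: hm => _ [? ?]; apply: pos; lra.
have [del [del0 wd]] := sp1 w (fun _ => 0) (R1 + 1) 1 (w b ym zm tm) sol w0 ltac:(lra) ltac:(lra) em
  ltac:(move=> y z z2 hy hz; apply: minw; split;
        [by move=> i; have := hy i; rewrite Rminus_0_r; lra|split; [rabs|lra]]).
pose kp := kap b; pose kp' := kap b'.
have kp0 : 0 < kp by exact: k0.
have kp'0 : 0 < kp' by exact: k0.
(* [3 kp' < l] makes the slope on side [b'] gentle enough for the exchange condition, and [8 R2]
   makes [[0, l / 4]] contain the height range [[0, 2 R2]] of the second ball. *)
pose l := 3 * kp' + 1 + 8 * R2.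
have l0 : 0 < l by rewrite /l; lra.
have R1k : 0 < R1 / kp by apply: Rdiv_lt_0_compat.
pose Y := 4 + 3 * (R1 / kp) + R1 * R1.
have Y4 : 4 <= Y by rewrite /Y; nra.
pose mn := Rmin (Rmin del s0) K.
have [mn0 [mn1 [mn2 mn3]]] : 0 < mn /\ mn <= del /\ mn <= s0 /\ mn <= K.
  have q1 := Rmin_l (Rmin del s0) K; have q2 := Rmin_r (Rmin del s0) K.
  have q3 := Rmin_l del s0; have q4 := Rmin_r del s0; rewrite -/mn in q1 q2.
  by split; [do 2 (apply: Rmin_pos => //)|lra].
pose x := mn / (2 * Y).
have x0 : 0 < x by apply: Rdiv_lt_0_compat; lra.
have xY : x * Y = mn / 2 by rewrite /x; field; lra.
have x8 : 8 * x <= mn by nra.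
(* Convex on both sides, so its second derivative outweighs the small negative values that [h] may
   take just below 0. On side [b'] it equals [3 x (1 - z / l)^2 - x] up to [l]. The boundary values
   [4 x] and [2 x] differ by [2 x], against the scaled slopes [3 x] on side [b] and
   [- 6 x kp' / l > - 2 x] on side [b']. The size of [x] keeps it below [del] at height [R1]. *)
pose base c z := if c == b then 4 * x + 3 * x / kp * Rmin z R1 + x * (Rmin z R1 * Rmin z R1)
  else 2 * x + (- (6 * x / l)) * Rmin z l + 3 * x / (l * l) * (Rmin z l * Rmin z l).
pose A s c z := base c z - (1 - s) * del.
have ll : 0 < 3 * x / (l * l) by apply: Rdiv_lt_0_compat; [lra|nra].
have [Bc [Bd Br]] := truncated_quadratic (4 * x) (3 * x / kp) x R1 R10.
have [Bc' [Bd' Br']] := truncated_quadratic (2 * x) (- (6 * x / l)) (3 * x / (l * l)) l l0.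
pose eta := Rmin (D b * x) (D b' * (3 * x / (l * l))).
have Db := D0 b; have Db' := D0 b'.
have eta0 : 0 < eta by apply: Rmin_pos; apply: Rmult_lt_0_compat.
have [eta1 eta2] : eta <= D b * x /\ eta <= D b' * (3 * x / (l * l)) by split; [exact: Rmin_l|exact: Rmin_r].
(* Above [- ep] one has [h >= - eta], and beyond [l] the barrier on side [b'] equals at most
   [- x < - ep], hence is inactive. *)
pose ep := Rmin (x / 2) (eta / L).
have etaL : 0 < eta / L by apply: Rdiv_lt_0_compat.
have ep0 : 0 < ep by apply: Rmin_pos; lra.
have [ep1 ep2] : ep <= x / 2 /\ L * ep <= eta.
  split; first exact: Rmin_l.
  have -> : eta = L * (eta / L) by field; lra.
  by apply: Rmult_le_compat_l; [lra|exact: Rmin_r].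
have b'b : (b' == b) = false by rewrite /b'; case: (b).
have other c : c != b -> c = b' by rewrite /b'; case: (c); case: (b).
have baseb z : base b z = 4 * x + 3 * x / kp * Rmin z R1 + x * (Rmin z R1 * Rmin z R1).
  by rewrite /base eq_refl.
have baseb' z : base b' z = 2 * x + (- (6 * x / l)) * Rmin z l + 3 * x / (l * l) * (Rmin z l * Rmin z l).
  by rewrite /base b'b.
have xk : 0 < 3 * x / kp by apply: Rdiv_lt_0_compat; lra.
have bnd z : 0 <= z -> 4 * x <= base b z <= mn / 2.
  move=> z2; rewrite baseb.
  have q1 : 0 <= Rmin z R1 by apply: Rmin_glb; lra.
  have q2 := Rmin_r z R1; move: (Rmin z R1) q1 q2 => r q1 q2.
  have q3 : 0 <= 3 * x / kp * r by apply: Rmult_le_pos; lra.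
  have q4 : 3 * x / kp * r <= 3 * x / kp * R1 by apply: Rmult_le_compat_l; lra.
  have q5 : 0 <= r * r <= R1 * R1 by split; [exact: Rle_0_sqr|apply: Rmult_le_compat].
  have q6 : 0 <= x * (r * r) by apply: Rmult_le_pos; lra.
  have q7 : x * (r * r) <= x * (R1 * R1) by apply: Rmult_le_compat_l; lra.
  have q8 : x * Y = 4 * x + 3 * x / kp * R1 + x * (R1 * R1) by rewrite /Y; field; lra.
  lra.
have bnd' z : 0 <= z -> - x <= base b' z <= 2 * x /\ (z <= l / 4 -> x / 2 <= base b' z).
  move=> z2; rewrite baseb'.
  have q1 : 0 <= Rmin z l by apply: Rmin_glb; lra.
  have q2 := Rmin_r z l.
  have q3 : z <= l / 4 -> Rmin z l <= l / 4 by move=> q; apply: Rle_trans (Rmin_l _ _) q.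
  move: (Rmin z l) q1 q2 q3 => r q1 q2 q3.
  pose u := r / l.
  have u0 : 0 <= u by apply: Rdiv_le_0_compat.
  have ur : r = u * l by rewrite /u; field; lra.
  have u1 : u <= 1 by apply: (Rmult_le_reg_r l) => //; lra.
  have -> : 2 * x + - (6 * x / l) * r + 3 * x / (l * l) * (r * r) = 3 * x * ((1 - u) * (1 - u)) - x.
    by rewrite ur; field; lra.
  have q4 : 0 <= (1 - u) * (1 - u) <= 1.
    split; first exact: Rle_0_sqr.
    by rewrite -[X in _ <= X]Rmult_1_l; apply: Rmult_le_compat; lra.
  have q5 := Rmult_le_pos (3 * x) _ ltac:(lra) (proj1 q4).
  have q6 := Rmult_le_compat_l (3 * x) _ _ ltac:(lra) (proj2 q4).
  split; first lra.
  move=> zl; have := q3 zl; rewrite ur => q7.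
  have u4 : u <= 1 / 4 by apply: (Rmult_le_reg_r l) => //; lra.
  have : 3 / 4 * (3 / 4) <= (1 - u) * (1 - u) by apply: Rmult_le_compat; lra.
  by move=> q8; have := Rmult_le_compat_l (3 * x) _ _ ltac:(lra) q8; lra.
have base2 c z : 0 <= z -> - x <= base c z <= mn / 2.
  move=> z2; case: (eqVneq c b) => [->|/other ->]; first by have := bnd z z2; lra.
  by have := bnd' z z2; lra.
have hlow c r : - ep <= r <= s0 -> - eta <= h c r.
  move=> hr; case: (Rle_dec 0 r) => r0.
    by have := hh c r ltac:(lra); have := Rmult_le_pos gam r ltac:(lra) r0; lra.
  have := hneg c r; rewrite Rabs_left; last lra.
  move=> q; have {}q := q ltac:(lra).
  have : L * (- r) <= L * ep by apply: Rmult_le_compat_l; lra.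
  lra.
have layer : eventually_above w (A 1).
  apply: (strict_sub_sweep D kap h w A
    (fun c z => if (c == b) && (if Rle_dec R1 z then true else false) then del else 0)
    (K + del) eta ep) => //.
  - lra.
  - by move=> c y z t z2 t2; have := wK c y z t z2 t2 => q; apply: Rabs_le; lra.
  - move=> s c _ r; apply: (continuity_pt_minus (base c) (fun _ => (1 - s) * del)); last exact: continuity_pt_const.
    by rewrite /base; case: (c == b); [exact: Bc|exact: Bc'].
  - move=> s c z hs z2; rewrite /A; have := base2 c z z2 => q.
    have q1 : 0 <= (1 - s) * del <= 1 * del.
      by split; [apply: Rmult_le_pos; lra|apply: Rmult_le_compat_r; lra].
    by apply: Rabs_le; lra.
  - move=> e e0; exists (e / del); split; first exact: Rdiv_lt_0_compat.
    move=> s s' c z _ _ hs _; rewrite /A.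
    rewrite (_ : _ - _ = (s - s') * del); last ring.
    rewrite Rabs_mult (Rabs_right del); last lra.
    rewrite (_ : e = e / del * del); last by field; lra.
    by apply: Rmult_le_compat_r; lra.
  - move=> s c z hs zp act; exists (if c == b then 2 * x else 2 * (3 * x / (l * l))).
    have q1 : 0 <= (1 - s) * del by apply: Rmult_le_pos; lra.
    have sd (f : R -> R) q : second_deriv f z q -> second_deriv (fun r => f r - (1 - s) * del) z q.
      move=> hf; rewrite -(Rminus_0_r q).
      apply: (second_deriv_minus f (fun _ => (1 - s) * del)) => //.
      apply: (is_derive_second_deriv _ (fun _ => 0)); last exact: is_derive_const.
      by move=> r; exact: is_derive_const.
    have Aup : A s c z <= s0 by rewrite /A; have := base2 c z (Rlt_le _ _ zp); lra.
    move: act; case: (eqVneq c b) => [cb|cb] /= act.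
    + subst c; have zR : z < R1.
        move: act; case: Rle_dec => q /=; last lra.
        by rewrite /A; have := bnd z (Rlt_le _ _ zp); lra.
      have act0 : 0 - ep <= A s b z.
        by move: act; case: Rle_dec => q /=; lra.
      split; first by apply: sd; rewrite /base eq_refl; apply: Bd.
      by have := hlow b (A s b z) ltac:(lra); lra.
    + have cb' := other c cb; subst c.
      have zl : z < l.
        apply: Rnot_le_lt => q; move: act; rewrite /A baseb' Rmin_right //.
        rewrite (_ : 2 * x + - (6 * x / l) * l + 3 * x / (l * l) * (l * l) = - x); last by field; lra.
        lra.
      split; first by apply: sd; rewrite /base (negbTE cb); apply: Bd'.
      by have := hlow b' (A s b' z) ltac:(lra); lra.
  - move=> s c hs _; exists (if c == b then 3 * x / kp else - (6 * x / l)).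
    have rd (f : R -> R) q : rderiv f 0 q -> rderiv (fun r => f r - (1 - s) * del) 0 q.
      move=> hf; rewrite -(Rminus_0_r q); apply: (rderiv_minus f (fun _ => (1 - s) * del)) => //.
      by apply: is_derive_rderiv; exact: is_derive_const.
    have b0 : base b 0 = 4 * x by rewrite baseb Rmin_left; lra.
    have b0' : base b' 0 = 2 * x by rewrite baseb' Rmin_left; lra.
    rewrite /A; case: (eqVneq c b) => [cb|cb].
    + subst c; split; first by apply: rd; rewrite /base eq_refl.
      rewrite -/b' b0 b0' -/kp (_ : kp * (3 * x / kp) = 3 * x); last by field; lra.
      lra.
    + split; first by apply: rd; rewrite /base (negbTE cb).
      rewrite (other c cb) /b' negbK -/b' b0 b0' -/kp'.
      have : kp' * (6 * x / l) < 2 * x.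
        rewrite (_ : kp' * (6 * x / l) = (3 * kp') * (2 * x) / l); last by field; lra.
        apply: (Rmult_lt_reg_r l) => //.
        rewrite (_ : 3 * kp' * (2 * x) / l * l = 3 * kp' * (2 * x)); last by field; lra.
        rewrite Rmult_comm; apply: Rmult_lt_compat_l; rewrite /l; lra.
      lra.
  (* Lowered by [del], the barrier is nonpositive and lies below [w] everywhere. *)
  - exists 1, 1; split; first lra; split; first lra.
    move=> c y z t t1 _ z2; rewrite /A.
    by have := base2 c z ltac:(lra); have := w0 c y z t ltac:(lra) ltac:(lra); lra.
have [c [T [c0 [T0 hlay]]]] := layer.
have A1 c' z : A 1 c' z = base c' z by rewrite /A; ring.
(* At this time the cone contains the ball of radius [R2] centred at height [R2]. *)
pose T1 := T + 2 * R2 / c.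
have Rc : 0 < 2 * R2 / c by apply: Rdiv_lt_0_compat; lra.
have cT : 2 * R2 <= c * T1.
  have -> : 2 * R2 = c * (2 * R2 / c) by field; lra.
  by apply: Rmult_le_compat_l; rewrite /T1; lra.
have [del2 [del20 wd2]] := sp2 w (fun _ => 0) R2 T1 (x / 2) sol w0 (Rle_refl _) ltac:(rewrite /T1; lra)
  ltac:(lra) ltac:(move=> y z z2 hy hz; have q1 : z < 2 * R2 by [rabs];
    have := hlay b' y z T1 ltac:(rewrite /T1; lra)
      ltac:(move=> i; have := hy i; rewrite Rminus_0_r; lra) ltac:(lra);
    rewrite A1; have [_ q2] := bnd' z z2; have := q2 ltac:(rewrite /l; lra); lra).
pose m := Rmin (x / 2) del2.
exists m; split; first by apply: Rmin_pos; lra.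
have m1 := Rmin_l (x / 2) del2; have m2 := Rmin_r (x / 2) del2; rewrite -/m in m1 m2.
apply: eventually_above_le (eventually_above_max _ _ _ layer wd2) _ => c' z z2.
case: (eqVneq c' b) => [->|/other ->].
  by apply: Rle_trans _ (Rmax_l _ _); rewrite A1; have := bnd z z2; lra.
case: (Rle_dec R2 z) => q.
- by apply: Rle_trans _ (Rmax_r _ _); rewrite eq_refl; case: (Rle_dec R2 z).
- apply: Rle_trans _ (Rmax_l _ _); rewrite A1; have [_ q2] := bnd' z z2.
  by have := q2 ltac:(rewrite /l; lra); lra.
Qed.

(** * Steady state and convergence *)

(** Shooting: the condition on side [false] determines [p true = q r] from [r = p false], and the
    other condition becomes [T r = 0]. At the smaller of the two zeros both speeds are nonpositive,
    at the larger both are nonnegative, so the intermediate value theorem applies. *)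
Lemma steady_boundary_values D kap (ht : bool -> R -> R) e L a b :
  (forall b, 0 < D b) -> (forall b, 0 < kap b) -> (forall b, restoring (ht b) (e b) (L b)) ->
  (forall c, a <= e c <= b) ->
  exists p : bool -> R, (forall c, a <= p c <= b) /\
    forall c, p (negb c) = p c + kap c * speed (D c) (ht c) (e c) (p c).
Proof.
move=> D0 k0 hr he.
pose phi c := speed (D c) (ht c) (e c).
have phi_c c : continuity (phi c) by exact: (speed_continuity (D c) (ht c) (e c) (L c)).
have neg c r : r <= e c -> phi c r <= 0.
  case=> [lt|->]; last by rewrite /phi speed_at_zero; lra.
  by have [h1 _] := speed_sign (D c) (ht c) (e c) (L c) r (D0 c) (hr c); have := h1 lt; rewrite /phi; lra.
have nonneg c r : e c <= r -> 0 <= phi c r.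
  case=> [lt|<-]; last by rewrite /phi speed_at_zero; lra.
  by have [_ h1] := speed_sign (D c) (ht c) (e c) (L c) r (D0 c) (hr c); have := h1 lt; rewrite /phi; lra.
have kneg c r : r <= e c -> kap c * phi c r <= 0.
  by move=> q; have := Rmult_le_compat_l (kap c) _ _ (Rlt_le _ _ (k0 c)) (neg c r q); lra.
have knonneg c r : e c <= r -> 0 <= kap c * phi c r.
  by move=> q; apply: Rmult_le_pos; [exact: Rlt_le (k0 c)|exact: nonneg].
pose q r := r + kap false * phi false r.
pose T r := kap false * phi false r + kap true * phi true (q r).
have qc : continuity q.
  move=> x; apply: continuity_pt_plus; first exact: derivable_continuous_pt (derivable_pt_id x).
  exact: (continuity_pt_scal (phi false) (kap false) x (phi_c false x)).
have Tc : continuity T.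
  move=> x; apply: continuity_pt_plus.
    exact: (continuity_pt_scal (phi false) (kap false) x (phi_c false x)).
  apply: (continuity_pt_scal (fun r => phi true (q r)) (kap true) x).
  exact: (continuity_pt_comp q (phi true) x (qc x) (phi_c true _)).
have heT := he true; have heF := he false.
pose em := Rmin (e true) (e false); pose eM := Rmax (e true) (e false).
have m1 := Rmin_l (e true) (e false); have m2 := Rmin_r (e true) (e false).
have M1 := Rmax_l (e true) (e false); have M2 := Rmax_r (e true) (e false).
have am : a <= em by apply: Rmin_glb; lra.
have Mb : eM <= b by apply: Rmax_lub; lra.
rewrite -/em in m1 m2; rewrite -/eM in M1 M2.
have Tm : T em <= 0.
  have h1 := kneg false em m2.
  have h2 := kneg true (q em) ltac:(rewrite /q; lra).
  by rewrite /T; lra.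
have TM : 0 <= T eM.
  have h1 := knonneg false eM M2.
  have h2 := knonneg true (q eM) ltac:(rewrite /q; lra).
  by rewrite /T; lra.
have [r [hrr Tr]] := IVT_gen T em eM 0 Tc
  ltac:(split; [apply: Rle_trans (Rmin_l _ _) _|apply: Rle_trans _ (Rmax_r _ _)]; lra).
rewrite Rmin_left ?Rmax_right in hrr; try lra.
have Tr' : kap false * phi false r + kap true * phi true (q r) = 0 by exact: Tr.
have qr : q r = r + kap false * phi false r by [].
exists (fun c => if c then q r else r); split.
- case; last lra.
  (* At the root the two speeds have opposite signs, which places [q r] between [e true] and [r]. *)
  case: (Rle_dec r (e false)) => le.
  + have h1 := kneg false r le.
    have : e true <= q r.
      apply: Rnot_lt_le => lt.
      have h2 := kneg true (q r) ltac:(lra).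
      have h3 : phi true (q r) < 0.
        by have [h _] := speed_sign (D true) (ht true) (e true) (L true) (q r) (D0 true) (hr true); exact: h.
      have := Rmult_lt_compat_l (kap true) _ _ (k0 true) h3; lra.
    by lra.
  + have h1 := knonneg false r ltac:(lra).
    have : q r <= e true.
      apply: Rnot_lt_le => lt.
      have h3 : 0 < phi true (q r).
        by have [_ h] := speed_sign (D true) (ht true) (e true) (L true) (q r) (D0 true) (hr true); exact: h.
      have := Rmult_lt_compat_l (kap true) _ _ (k0 true) h3; lra.
    by lra.
- case=> /=; last by [].
  by rewrite -/(phi true (q r)); lra.
Qed.

(** * Reflection, turning upper bounds into lower bounds *)

Lemma potential_opp h e r : continuity h ->
  RInt (fun s => - h (- s)) (- r) (- e) = RInt h r e.
Proof.
move=> hc; apply: is_RInt_unique; apply: (is_RInt_comp_opp h).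
rewrite !Ropp_involutive; apply: RInt_correct.
apply: ex_RInt_continuous => z _.
by apply/continuity_pt_filterlim; apply: hc.
Qed.

(** Reflection exchanges the two square roots in [speed]. *)
Lemma speed_opp D h e r : continuity h ->
  speed D (fun s => - h (- s)) (- e) (- r) = - speed D h e r.
Proof.
move=> hc; rewrite /speed.
have -> : Rmax (- r) (- e) = - Rmin r e by rewrite Ropp_Rmin.
have -> : Rmin (- r) (- e) = - Rmax r e by rewrite Ropp_Rmax.
by rewrite !potential_opp //; ring.
Qed.

Lemma restoring_opp h e L : restoring h e L -> restoring (fun s => - h (- s)) (- e) L.
Proof.
move=> [L0 [hL [he [h1 h2]]]]; split=> //; split.
  move=> r s; rewrite (_ : - h (- r) - - h (- s) = h (- s) - h (- r)); last ring.
  by apply: Rle_trans (hL _ _) _; rewrite (_ : - s - - r = r - s); [lra|ring].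
split; first by rewrite Ropp_involutive he; ring.
by split=> r hr; [have := h2 (- r) ltac:(lra)|have := h1 (- r) ltac:(lra)]; lra.
Qed.

Lemma is_profile_opp D h e p A : continuity h -> is_profile D h e p A ->
  is_profile D (fun s => - h (- s)) (- e) (- p) (fun z => - A z).
Proof.
move=> hc [A0 [dA d2A]]; split; first by rewrite A0.
have sp z : - speed D (fun s => - h (- s)) (- e) (- A z) = - - speed D h e (A z).
  by rewrite speed_opp.
split=> z; first by rewrite sp; apply: (is_derive_opp A).
rewrite (_ : - _ / D = - (- h (A z) / D)); last by rewrite (Ropp_involutive (A z)) /Rdiv; ring.
apply: (is_derive_ext (fun s => - - speed D h e (A s))); first by move=> t; rewrite sp.
exact: (is_derive_opp (fun s => - speed D h e (A s))).
Qed.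

Lemma sign_changing_opp h a e b : sign_changing h a e b ->
  sign_changing (fun s => - h (- s)) (- b) (- e) (- a).
Proof.
move=> [[ae eb] [he [h1 h2]]]; split; first lra.
split; first by rewrite Ropp_involutive he; ring.
by split=> r hr; [have := h2 (- r) ltac:(lra)|have := h1 (- r) ltac:(lra)]; lra.
Qed.

Lemma loc_lipschitz_opp h : loc_lipschitz h -> loc_lipschitz (fun s => - h (- s)).
Proof.
move=> hl K K0; have [L hL] := hl K K0; exists L => r s hr hs.
rewrite (_ : - h (- r) - - h (- s) = h (- s) - h (- r)); last ring.
apply: Rle_trans (hL _ _ _ _) _; rewrite ?Rabs_Ropp //.
by rewrite (_ : - s - - r = r - s); [lra|ring].
Qed.

Lemma eventually_above_local {N} (w : bool -> Pt N -> R -> R -> R) B Z :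
  0 < Z -> eventually_above w B ->
  exists T, 0 < T /\ forall b y z t, T <= t -> (forall i, Rabs (y i) <= Z) -> 0 <= z <= Z ->
    B b z <= w b y z t.
Proof.
move=> Z0 [c [T [c0 [T0 h]]]].
have Zc : 0 < Z / c by apply: Rdiv_lt_0_compat.
exists (T + Z / c); split; first lra.
move=> b y z t Tt hy hz.
have ct : Z <= c * t.
  rewrite (_ : Z = c * (Z / c)); last by field; lra.
  by apply: Rmult_le_compat_l; lra.
by apply: h; [lra|move=> i; have := hy i; lra|lra].
Qed.

Lemma pair_convergence {N} D kap h (w : bool -> Pt N -> R -> R -> R) (e : bool -> R)
    (ht : bool -> R -> R) (L : bool -> R) lo hi (p : bool -> R) (A : bool -> R -> R) gam s0 :
  (forall b, 0 < D b) -> (forall b, 0 < kap b) -> (forall b, loc_lipschitz (h b)) ->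
  (forall b, h b 0 = 0) -> (forall b, h b (e b) = 0) ->
  (forall b r, 0 < r < e b -> 0 < h b r) -> (forall b r, e b < r -> h b r < 0) ->
  0 < gam -> 0 < s0 -> (forall b r, 0 <= r <= s0 -> gam * r <= h b r) ->
  0 < lo -> (forall b, lo < e b < hi) -> (forall b, lo < p b < hi) ->
  (forall b, restoring (ht b) (e b) (L b)) -> (forall b r, lo <= r <= hi -> ht b r = h b r) ->
  (forall b, p (negb b) = p b + kap b * speed (D b) (ht b) (e b) (p b)) ->
  (forall b, is_profile (D b) (ht b) (e b) (p b) (A b)) ->
  pair_solution D kap h w ->
  (forall T, 0 < T -> exists K, forall b y z t, 0 <= z -> 0 <= t <= T -> Rabs (w b y z t) <= K) ->
  (forall b y z, 0 <= z -> 0 <= w b y z 0) ->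
  (exists b y z, 0 <= z /\ w b y z 0 <> 0) ->
  forall tau Z, 0 < tau -> 0 < Z -> exists T, 0 < T /\ forall b y z t, T <= t ->
    (forall i, Rabs (y i) <= Z) -> 0 <= z <= Z -> Rabs (w b y z t - A b z) < tau.
Proof.
move=> D0 k0 hl h0 he hpos hneg gam0 s00 hh lo0 elo plo hrt hth hflux hA sol bd init ne tau Z tau0 Z0.
have wge : forall b y z t, 0 <= z -> 0 <= t -> 0 <= w b y z t.
  by apply: (constant_lower_bound D kap h w 0) => // b; rewrite h0; lra.
have [M hM] := bd 1 ltac:(lra).
(* [K] bounds the datum and exceeds both zeros, so [h] is negative at [K] and the constant is a
   supersolution. *)
pose K := Rabs M + hi + 1.
have hi0 : lo < hi by have := elo true; lra.
have KM : M <= K by rewrite /K; have := Rle_abs M; lra.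
have Khi : hi + 1 <= K by rewrite /K; have := Rabs_pos M; lra.
have wle : forall b y z t, 0 <= z -> 0 <= t -> - K <= - w b y z t.
  apply: (constant_lower_bound D kap (fun b r => - h b (- r)) (fun b y z t => - w b y z t) (- K) D0 k0).
  - by move=> b; exact: loc_lipschitz_opp.
  - exact: pair_solution_opp.
  - by move=> T T0; have [Q hQ] := bd T T0; exists Q => b y z t z0 t0; rewrite Rabs_Ropp; apply: hQ.
  - by move=> b; rewrite Ropp_involutive; have := hneg b K ltac:(have := elo b; lra); lra.
  - by move=> b y z z0; have := hM b y z 0 z0 ltac:(lra) => q; rabs.
have wK b y z t : 0 <= z -> 0 <= t -> Rabs (w b y z t) <= K.
  by move=> z0 t0; have := wge b y z t z0 t0; have := wle b y z t z0 t0 => *; apply: Rabs_le; lra.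
have [m [m0 wm]] := hair_trigger D kap h w K gam s0 D0 k0 hl sol ltac:(lra)
  ltac:(move=> b y z t z0 t0; have := wge b y z t z0 t0; have := wle b y z t z0 t0; lra)
  h0 gam0 s00 hh ne.
pose m1 := Rmin m lo.
have m10 : 0 < m1 by apply: Rmin_pos.
have m1m : m1 <= m by exact: Rmin_l.
have m1lo : m1 <= lo by exact: Rmin_r.
have [B1 [wB1 AB1]] := lower_convergence D kap h w e (m1 / 2) hi m1 K ht L lo hi p A D0 k0 hl sol
  ltac:(lra) wK
  ltac:(move=> b; have := elo b; split; [lra|split=> //; split=> r hr; [apply: hpos|apply: hneg]; lra])
  ltac:(lra) ltac:(move=> b; have := elo b; lra)
  (eventually_above_le _ _ _ wm (fun _ _ _ => m1m))
  hrt ltac:(lra) (Rle_refl _) elo plo hth hflux hA (tau / 2) Z ltac:(lra) Z0.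
have hc b : continuity (ht b) by exact: restoring_continuity (hrt b).
(* For [- w] the starting constant is the global bound [- K]; below [- e b] the reflected
   nonlinearity is positive all the way down, so no analogue of the hair-trigger effect is
   involved. *)
have [B2 [wB2 AB2]] := lower_convergence D kap (fun b r => - h b (- r)) (fun b y z t => - w b y z t)
  (fun b => - e b) (- (K + 1)) (- lo) (- K) K (fun b r => - ht b (- r)) L (- hi) (- lo)
  (fun b => - p b) (fun b z => - A b z) D0 k0 (fun b => loc_lipschitz_opp _ (hl b))
  (pair_solution_opp _ _ _ _ sol) ltac:(lra)
  ltac:(move=> b y z t z0 t0; rewrite Rabs_Ropp; exact: wK)
  ltac:(move=> b; apply: sign_changing_opp; have := elo b; split; [lra|split=> //; split=> r hr;
        [apply: hpos|apply: hneg]; lra])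
  ltac:(lra) ltac:(move=> b; have := elo b; lra)
  ltac:(exists 1, 1; split; [lra|split; [lra|move=> b y z t t1 _ z1; apply: wle; lra]])
  (fun b => restoring_opp _ _ _ (hrt b)) ltac:(lra) (Rle_refl _)
  ltac:(move=> b; have := elo b; lra) ltac:(move=> b; have := plo b; lra)
  ltac:(move=> b r hr /=; rewrite hth //; lra)
  ltac:(move=> b /=; rewrite hflux (speed_opp _ _ _ _ (hc b)); ring)
  (fun b => is_profile_opp _ _ _ _ _ (hc b) (hA b)) (tau / 2) Z ltac:(lra) Z0.
have [T1 [T10 h1]] := eventually_above_local _ _ _ Z0 wB1.
have [T2 [T20 h2]] := eventually_above_local _ _ _ Z0 wB2.
exists (Rmax T1 T2); have q1 := Rmax_l T1 T2; have q2 := Rmax_r T1 T2; split; first lra.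
move=> b y z t Tt hy hz.
have := h1 b y z t ltac:(lra) hy hz; have := h2 b y z t ltac:(lra) hy hz.
have := AB1 b z hz; have := AB2 b z hz => *.
by apply: Rabs_def1; lra.
Qed.

(** * Reduction of problem (H) to the folded system *)

Lemma KPP_g_KPP_f g : KPP_g g -> KPP_f g.
Proof. by move=> [hl hg]; exists 1; split; [lra|split]. Qed.

(** The nonlinearity satisfied by [r = s / c] when [s] obeys the equation with [f]. *)
Definition rescale (f : R -> R) (c r : R) : R := f (c * r) / c.

(** The derivative [f0] is positive because [0 < f (S / 2) <= f0 * (S / 2)]. Differentiability at 0
    then gives growth at rate [f0 / 2] near 0, which drives the hair-trigger effect. *)
Lemma KPP_rescale f c : KPP_f f -> 0 < c -> exists e gam s0, 0 < e /\ 0 < gam /\ 0 < s0 /\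
  loc_lipschitz (rescale f c) /\ rescale f c 0 = 0 /\ rescale f c e = 0 /\ (forall r, 0 < r < e -> 0 < rescale f c r) /\
  (forall r, e < r -> rescale f c r < 0) /\ (forall r, 0 <= r <= s0 -> gam * r <= rescale f c r).
Proof.
move=> [S [S0 [hl [f0 [df [fz [fS [hpos hneg]]]]]]]] c0.
have f00 : 0 < f0.
  have := hpos (S / 2) ltac:(lra) => q.
  by apply: Rnot_le_lt => le; have : f0 * (S / 2) <= 0 by [nra]; lra.
have [[d d0] /= hd] := df (f0 / 2) ltac:(lra).
have ic : 0 < / c by apply: Rinv_0_lt_compat.
exists (S / c), (f0 / 2), (d / 2 / c).
split; first by apply: Rdiv_lt_0_compat.
split; first lra.
split; first by apply: Rdiv_lt_0_compat; lra.
split; last split; last split; last split; last split.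
- move=> K K0.
  have [L hL] := hl (c * K) ltac:(exact: Rmult_lt_0_compat).
  exists L => a b ha hb.
  have hc r : Rabs r <= K -> Rabs (c * r) <= c * K.
    by move=> hr; rewrite Rabs_mult (Rabs_right c); [apply: Rmult_le_compat_l; lra|lra].
  rewrite /rescale (_ : _ - _ = (f (c * a) - f (c * b)) * / c); last by rewrite /Rdiv; ring.
  rewrite Rabs_mult (Rabs_right (/ c)); last lra.
  have := Rmult_le_compat_r _ _ _ (Rlt_le _ _ ic) (hL _ _ (hc a ha) (hc b hb)).
  rewrite (_ : c * a - c * b = c * (a - b)); last ring.
  rewrite Rabs_mult (Rabs_right c); last lra.
  by rewrite (_ : L * (c * Rabs (a - b)) * / c = L * Rabs (a - b)); [|field; lra].
- by rewrite /rescale Rmult_0_r fz /Rdiv Rmult_0_l.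
- by rewrite /rescale (_ : c * (S / c) = S); [rewrite fS /Rdiv Rmult_0_l|field; lra].
- move=> r [r0 re]; apply: Rdiv_lt_0_compat => //.
  have : c * r < c * (S / c) by apply: Rmult_lt_compat_l.
  rewrite (_ : c * (S / c) = S); last by field; lra.
  by move=> q; apply: (proj1 (hpos _ _)); split=> //; apply: Rmult_lt_0_compat.
- move=> r re.
  have : c * (S / c) < c * r by apply: Rmult_lt_compat_l.
  rewrite (_ : c * (S / c) = S); last by field; lra.
  by move=> q; have := hneg _ q => q2; rewrite /rescale /Rdiv; nra.
- move=> r [r0 rs].
  case: (Req_dec r 0) => [->|rne]; first by rewrite /rescale !Rmult_0_r fz /Rdiv; lra.
  have rp : 0 < c * r by apply: Rmult_lt_0_compat; lra.
  have : c * r <= c * (d / 2 / c) by apply: Rmult_le_compat_l; lra.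
  rewrite (_ : c * (d / 2 / c) = d / 2); last by field; lra.
  move=> q; have := hd (c * r) ltac:(lra) ltac:(rewrite Rabs_right; lra).
  rewrite Rplus_0_l fz Rminus_0_r => /Rabs_def2 [_ q2].
  rewrite (_ : rescale f c r = f (c * r) / (c * r) * r); last by rewrite /rescale; field; lra.
  by apply: Rmult_le_compat_r; lra.
Qed.

Lemma second_deriv_reflect (f : R -> R) z a :
  second_deriv f (- z) a -> second_deriv (fun s => f (- s)) z a.
Proof.
have refl (F : R -> R) x l : derivable_pt_lim F (- x) l ->
    derivable_pt_lim (fun s => - F (- s)) x l.
  move=> hF e e0; have [d hd] := hF e e0; exists d => k k0 kd.
  have := hd (- k) ltac:(lra) ltac:(rewrite Rabs_Ropp; exact: kd).
  rewrite (_ : - x + - k = - (x + k)); last ring.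
  by rewrite (_ : (F (- (x + k)) - F (- x)) / - k = (- F (- (x + k)) - - F (- x)) / k); [|field].
move=> [f' [[d [d0 hd]] hl]]; exists (fun s => - f' (- s)); split; last exact: refl.
exists d; split=> // s hs.
have ds : derivable_pt_lim f (- s) (f' (- s)).
  by apply: hd; rewrite (_ : - s - - z = - (s - z)); [rewrite Rabs_Ropp|ring].
have := derivable_pt_lim_opp _ _ _ (refl f s _ ds).
by rewrite (functional_extensionality (opp_fct (fun s => - f (- s))) (fun s => f (- s))) // => r;
  rewrite /opp_fct Ropp_involutive.
Qed.

Lemma lderiv_reflect (f : R -> R) l : lderiv f 0 l -> rderiv (fun s => f (- s)) 0 (- l).
Proof.
move=> hf e e0; have [d [d0 hd]] := hf e e0; exists d; split=> // k hk.
have := hd (- k) ltac:(lra).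
rewrite !Rplus_0_l Ropp_0.
rewrite (_ : (f (- k) - f 0) / k - - l = - ((f (- k) - f 0) / - k - l)); last by field; lra.
by rewrite Rabs_Ropp.
Qed.

Lemma is_derive_lderiv (f : R -> R) x l : is_derive f x l -> lderiv f x l.
Proof.
move/is_derive_Reals => h e e0; have [[d d0] /= hd] := h e e0.
by exists d; split=> // k hk; apply: hd; [lra|rewrite Rabs_left; lra].
Qed.

(** Dividing [v] by [mu] and [u] by [nu] turns [nu v - mu u] into [mu nu] times the difference of
    the new unknowns, whence the coefficients [d / nu] and [D / mu]. *)
Definition folded {N} (mu nu : R) (u v : Pt N -> R -> R -> R) (b : bool) (y : Pt N) (z t : R) : R :=
  if b then / mu * v y z t else / nu * u y (- z) t.

Lemma solution_H_folded N D d mu nu g f u0 v0 (u v : Pt N -> R -> R -> R) :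
  0 < mu -> 0 < nu ->
  solution_H N D d mu nu g f u0 v0 u v ->
  pair_solution (fun b : bool => if b then d else D) (fun b : bool => if b then d / nu else D / mu)
    (fun b : bool => rescale (if b then f else g) (if b then mu else nu))
    (folded mu nu u v).
Proof.
move=> mu0 nu0 [cu [cv [_ [_ [_ [_ [pu [pv [fu fv]]]]]]]]]; split.
- case; apply: cont_on3_mult; try exact: cont_on3_const; first exact: cv.
  move=> y z t [z0 t0] e e0; have [del [del0 h]] := cu y (- z) t ltac:(split; lra) e e0.
  exists del; split=> // y' z' t' [z'0 t'0] hy hz ht; apply: h => //; first by split; lra.
  by rewrite (_ : - z' - - z = - (z' - z)); [rewrite Rabs_Ropp|ring].
- case=> y z t z0 t0.
  + have [c [a [a' [h1 [h2 [h3 h4]]]]]] := pv y z t z0 t0.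
    exists (/ mu * c), (fun i => / mu * a i), (/ mu * a'); split.
      exact: (derivable_pt_lim_scal (fun s => v y z s)).
    split; first by move=> i; apply: second_deriv_scal.
    split; first exact: second_deriv_scal.
    rewrite sumI_scale /folded /rescale (_ : mu * (/ mu * v y z t) = v y z t); last by field; lra.
    by rewrite -h4; field; lra.
  + have [c [a [a' [h1 [h2 [h3 h4]]]]]] := pu y (- z) t ltac:(lra) t0.
    exists (/ nu * c), (fun i => / nu * a i), (/ nu * a'); split.
      exact: (derivable_pt_lim_scal (fun s => u y (- z) s)).
    split; first by move=> i; apply: second_deriv_scal.
    split; first by apply: second_deriv_scal; exact: (second_deriv_reflect (fun s => u y s t)).
    rewrite sumI_scale /folded /rescale (_ : nu * (/ nu * u y (- z) t) = u y (- z) t); last by field; lra.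
    by rewrite -h4; field; lra.
- case=> y t t0 /=.
  + have [l [h1 h2]] := fv y t t0; exists (/ mu * l); split; first exact: rderiv_scal.
    rewrite /folded Ropp_0.
    have -> : d / nu * (/ mu * l) = - (- d * l) / (mu * nu) by field; lra.
    by rewrite h2; field; lra.
  + have [l [h1 h2]] := fu y t t0; exists (/ nu * - l); split.
      by apply: rderiv_scal; exact: (lderiv_reflect (fun s => u y s t)).
    rewrite /folded Ropp_0.
    have -> : D / mu * (/ nu * - l) = - (D * l) / (mu * nu) by field; lra.
    by rewrite h2; field; lra.
Qed.

Lemma second_deriv_const c x : second_deriv (fun _ => c) x 0.
Proof. by apply: (is_derive_second_deriv _ (fun _ => 0)) => *; exact: is_derive_const. Qed.

Lemma second_deriv_continuity h x l : second_deriv h x l -> continuity_pt h x.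
Proof.
move=> [h' [[d [d0 hd]] _]]; apply: derivable_continuous_pt.
by exists (h' x); apply: hd; rewrite Rminus_diag Rabs_R0.
Qed.

Lemma rderiv_continuity (f : R -> R) l e : rderiv f 0 l -> 0 < e ->
  exists d, 0 < d /\ forall s, 0 <= s < d -> Rabs (f s - f 0) < e.
Proof.
move=> hf e0; have [d [d0 hd]] := hf 1 ltac:(lra).
have l0 := Rabs_pos l.
have c0 : 0 < e / (Rabs l + 1) by apply: Rdiv_lt_0_compat; lra.
exists (Rmin d (e / (Rabs l + 1))); split; first exact: Rmin_pos.
have m1 := Rmin_l d (e / (Rabs l + 1)); have m2 := Rmin_r d (e / (Rabs l + 1)).
move=> s [s0 sd]; case: (Req_dec s 0) => [->|sne]; first by rewrite Rminus_diag Rabs_R0.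
have := hd s ltac:(lra); rewrite Rplus_0_l => q.
have q1 : Rabs ((f s - f 0) / s) <= Rabs l + 1.
  by have := Rabs_triang ((f s - f 0) / s - l) l;
     rewrite (_ : (f s - f 0) / s - l + l = (f s - f 0) / s); [lra|ring].
rewrite (_ : f s - f 0 = (f s - f 0) / s * s); last by field.
rewrite Rabs_mult (Rabs_right s); last lra.
apply: Rle_lt_trans (Rmult_le_compat_r s _ _ s0 q1) _.
rewrite (_ : e = (Rabs l + 1) * (e / (Rabs l + 1))); last by field; lra.
by apply: Rmult_lt_compat_l; lra.
Qed.

Lemma half_line_continuity (f : R -> R) l z e :
  (forall z, 0 < z -> exists a, second_deriv f z a) -> rderiv f 0 l -> 0 <= z -> 0 < e ->
  exists d, 0 < d /\ forall s, 0 <= s -> Rabs (s - z) < d -> Rabs (f s - f z) < e.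
Proof.
move=> hf hl z0 e0; case: (Req_dec z 0) => [->|zne].
- have [d [d0 hd]] := rderiv_continuity f l e hl e0.
  by exists d; split=> // s s0 hs; apply: hd; rabs.
- have [a ha] := hf z ltac:(lra).
  have [d [d0 hd]] := continuity_pt_delta f z e (second_deriv_continuity _ _ _ ha) e0.
  by exists d; split=> // s _; apply: hd.
Qed.

Lemma steady_is_solution N D d mu nu g f U V :
  steady_1d D d mu nu g f U V ->
  initial_datum N (fun _ z => U z) (fun _ z => V z) /\
  solution_H N D d mu nu g f (fun _ z => U z) (fun _ z => V z)
    (fun _ z _ => U z) (fun _ z _ => V z).
Proof.
move=> [hU [hV [[lU [hlU fU]] [[lV [hlV fV]] [Up [Vp [[MU bU] [MV bV]]]]]]]].
have cV z e : 0 <= z -> 0 < e -> exists del, 0 < del /\ forall s, 0 <= s -> Rabs (s - z) < del ->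
    Rabs (V s - V z) < e.
  apply: half_line_continuity => [r r0|]; last exact: hlV.
  by have [a [ha _]] := hV r r0; exists a.
have cU z e : z <= 0 -> 0 < e -> exists del, 0 < del /\ forall s, s <= 0 -> Rabs (s - z) < del ->
    Rabs (U s - U z) < e.
  move=> z0 e0.
  have [del [del0 h]] := half_line_continuity (fun s => U (- s)) (- lU) (- z) e
    ltac:(move=> r r0; have [a [ha _]] := hU (- r) ltac:(lra); exists a; exact: second_deriv_reflect)
    (lderiv_reflect U lU hlU) ltac:(lra) e0.
  exists del; split=> // s s0 hs.
  have := h (- s) ltac:(lra) ltac:(rewrite (_ : - s - - z = - (s - z)); [rewrite Rabs_Ropp; exact: hs|ring]).
  by rewrite !Ropp_involutive.
have aU z : z <= 0 -> Rabs (U z) <= MU.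
  by move=> z0; have := Up z z0; have := bU z z0 => *; rewrite Rabs_right; lra.
have aV z : 0 <= z -> Rabs (V z) <= MV.
  by move=> z0; have := Vp z z0; have := bV z z0 => *; rewrite Rabs_right; lra.
split.
  split; first by move=> y z z0 e e0; have [del [del0 h]] := cU z e z0 e0;
    exists del; split=> // y' z' z'0 _; apply: h.
  split; first by move=> y z z0 e e0; have [del [del0 h]] := cV z e z0 e0;
    exists del; split=> // y' z' z'0 _; apply: h.
  split; first by exists MU => y z; exact: aU.
  split; first by exists MV => y z; exact: aV.
  split; first by move=> y z z0; exact: Rlt_le (Up z z0).
  split; first by move=> y z z0; exact: Rlt_le (Vp z z0).
  by left; exists (fun _ => 0), 0; split; [lra|have := Up 0 (Rle_refl 0); lra].
split; first by move=> y z t [z0 t0] e e0; have [del [del0 h]] := cU z e z0 e0;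
  exists del; split=> // y' z' t' [z'0 _] _ hz _; apply: h.
split; first by move=> y z t [z0 t0] e e0; have [del [del0 h]] := cV z e z0 e0;
  exists del; split=> // y' z' t' [z'0 _] _ hz _; apply: h.
split; first by move=> T T0; exists MU => y z t z0 _; exact: aU.
split; first by move=> T T0; exists MV => y z t z0 _; exact: aV.
split; first by [].
split; first by [].
split.
  move=> y z t z0 t0; have [a [ha ea]] := hU z z0.
  exists 0, (fun _ => 0), a; split; first exact: derivable_pt_lim_const.
  split; first by move=> i; exact: second_deriv_const.
  by split=> //; rewrite sumI_const -ea; ring.
split.
  move=> y z t z0 t0; have [a [ha ea]] := hV z z0.
  exists 0, (fun _ => 0), a; split; first exact: derivable_pt_lim_const.
  split; first by move=> i; exact: second_deriv_const.
  by split=> //; rewrite sumI_const -ea; ring.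
by split=> y t t0; [exists lU|exists lV].
Qed.

Lemma is_profile_scaled D h e p A c z : is_profile D h e p A ->
  second_deriv (fun s => c * A s) z (c * (- h (A z) / D)) /\
  is_derive (fun s => c * A s) z (c * - speed D h e (A z)).
Proof.
move=> [_ [dA d2A]]; split.
- by apply: second_deriv_scal; apply: (is_derive_second_deriv _ _ _ _ dA).
- exact: (is_derive_scal A z c).
Qed.

Theorem theorem2p3 (N : nat) (hN : (2 <= N)%nat) (D d mu nu : R) (g f : R -> R)
  (hD : 0 < D) (hd : 0 < d) (hmu : 0 < mu) (hnu : 0 < nu)
  (hg : KPP_g g) (hf : KPP_f f) :
  exists U V : R -> R,
    steady_1d D d mu nu g f U V /\
    (forall U' V', steady_1d D d mu nu g f U' V' ->
       (forall z, z <= 0 -> U' z = U z) /\ (forall z, 0 <= z -> V' z = V z)) /\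
    (forall (u0 v0 : Pt N -> R -> R) (u v : Pt N -> R -> R -> R),
       initial_datum N u0 v0 ->
       solution_H N D d mu nu g f u0 v0 u v ->
       conv_loc_unif N u v U V).
Proof.
pose Df b := if b then d else D; pose kap b := if b then d / nu else D / mu.
pose sc b := if b then mu else nu.
pose h (b : bool) := rescale (if b then f else g) (sc b).
have D0 b : 0 < Df b by case: b.
have sc0 b : 0 < sc b by case: b.
have k0 b : 0 < kap b by case: b; apply: Rdiv_lt_0_compat.
have kpp b : exists q : R * R * R, 0 < q.1.1 /\ 0 < q.1.2 /\ 0 < q.2 /\
    loc_lipschitz (h b) /\ h b 0 = 0 /\ h b q.1.1 = 0 /\ (forall r, 0 < r < q.1.1 -> 0 < h b r) /\
    (forall r, q.1.1 < r -> h b r < 0) /\ (forall r, 0 <= r <= q.2 -> q.1.2 * r <= h b r).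
  have [] := KPP_rescale (if b then f else g) (sc b) _ (sc0 b).
    by case: b => //; exact: KPP_g_KPP_f.
  by move=> e [gam [s0 H]]; exists (e, gam, s0).
have [q hq] := functional_choice _ kpp => {kpp}.
pose e b := (q b).1.1.
have e0 b : 0 < e b by case: (hq b).
have hl b : loc_lipschitz (h b) by case: (hq b) => _ [_ [_ []]].
have h0 b : h b 0 = 0 by case: (hq b) => _ [_ [_ [_ []]]].
have he b : h b (e b) = 0 by case: (hq b) => _ [_ [_ [_ [_ []]]]].
have hpos b : forall r, 0 < r < e b -> 0 < h b r by case: (hq b) => _ [_ [_ [_ [_ [_ []]]]]].
have hneg b : forall r, e b < r -> h b r < 0 by case: (hq b) => _ [_ [_ [_ [_ [_ [_ []]]]]]].
pose gam := Rmin (q true).1.2 (q false).1.2; pose s0 := Rmin (q true).2 (q false).2.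
have gam0 : 0 < gam by apply: Rmin_pos; [case: (hq true) => _ []|case: (hq false) => _ []].
have s00 : 0 < s0 by apply: Rmin_pos; [case: (hq true) => _ [_ []]|case: (hq false) => _ [_ []]].
have hh b r : 0 <= r <= s0 -> gam * r <= h b r.
  move=> hr; have [gb sb] : gam <= (q b).1.2 /\ s0 <= (q b).2.
    by case: b; split; [exact: Rmin_l|exact: Rmin_l|exact: Rmin_r|exact: Rmin_r].
  have [_ [_ [_ [_ [_ [_ [_ [_ hb]]]]]]]] := hq b.
  apply: Rle_trans _ (hb r ltac:(lra)); apply: Rmult_le_compat_r; lra.
pose em := Rmin (e true) (e false); pose eM := Rmax (e true) (e false).
have em0 : 0 < em by exact: Rmin_pos.
have eb b : em <= e b <= eM.
  by case: b; split; [exact: Rmin_l|exact: Rmax_l|exact: Rmin_r|exact: Rmax_r].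
(* Clamping to [[lo, hi]] makes the nonlinearities restoring. The steady boundary values and both
   zeros lie in [[em, eM]], so the profiles stay in [[lo, hi]] and do not see the clamp. *)
pose lo := em / 2; pose hi := eM + 1.
have lo0 : 0 < lo by rewrite /lo; lra.
have elo b : lo < e b < hi by have := eb b; rewrite /lo /hi; lra.
pose ht b r := h b (clamp lo hi r).
have sgn b : sign_changing (h b) lo (e b) hi.
  by split; [exact: elo|split=> //; split=> r hr; [apply: hpos; lra|apply: hneg; lra]].
have [L hrt] := functional_choice _ (fun b => restoring_clamp (h b) lo (e b) hi (hl b) (sgn b)).
have hth b r : lo <= r <= hi -> ht b r = h b r by move=> hr; rewrite /ht clamp_id.
have [p [pin hflux]] := steady_boundary_values Df kap ht e L em eM D0 k0 hrt eb.
have plo b : lo < p b < hi by have := pin b; rewrite /lo /hi; lra.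
have prof b : exists A, is_profile (Df b) (ht b) (e b) (p b) A.
  by have [A [hA _]] := profile_exists (Df b) (ht b) (e b) (L b) (p b) (D0 b) (hrt b); exists A.
have [A hA] := functional_choice _ prof => {prof}.
have Ain b z : 0 <= z -> lo <= A b z <= hi.
  move=> z0; have := profile_between _ _ _ _ _ _ (D0 b) (hrt b) (hA b) z z0.
  have := plo b; have := elo b => q1 q2 [q3 q4]; split.
  - by apply: Rle_trans _ q3; apply: Rmin_glb; lra.
  - by apply: Rle_trans q4 _; apply: Rmax_lub; lra.
pose U z := nu * A false (- z); pose V z := mu * A true z.
have A0 b : A b 0 = p b by case: (hA b).
have conv (u0 v0 : Pt N -> R -> R) (u v : Pt N -> R -> R -> R) :
    initial_datum N u0 v0 -> solution_H N D d mu nu g f u0 v0 u v -> conv_loc_unif N u v U V.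
  move=> [_ [_ [_ [_ [u0p [v0p ne]]]]]] sol K eps K0 eps0.
  have psol := solution_H_folded N D d mu nu g f u0 v0 u v hmu hnu sol.
  have [_ [_ [bu [bv [iu [iv _]]]]]] := sol.
  have imu : 0 < / mu by apply: Rinv_0_lt_compat.
  have inu : 0 < / nu by apply: Rinv_0_lt_compat.
  pose tau := Rmin (eps / mu) (eps / nu).
  have tau0 : 0 < tau by apply: Rmin_pos; apply: Rdiv_lt_0_compat.
  have [T [T0 hT]] := pair_convergence Df kap h (folded mu nu u v) e ht L lo hi p A gam s0
    D0 k0 hl h0 he hpos hneg gam0 s00 hh lo0 elo plo hrt hth hflux hA psol
    ltac:(move=> T T0; have [Mu hMu] := bu T T0; have [Mv hMv] := bv T T0;
      exists (/ mu * Rabs Mv + / nu * Rabs Mu);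
      have pu := Rmult_le_pos (/ nu) _ (Rlt_le _ _ inu) (Rabs_pos Mu);
      have pv := Rmult_le_pos (/ mu) _ (Rlt_le _ _ imu) (Rabs_pos Mv);
      case=> y z t z0 t0; rewrite /folded Rabs_mult Rabs_right; try lra;
      [have q1 := Rle_trans _ _ _ (hMv y z t z0 t0) (Rle_abs Mv)
      |have q1 := Rle_trans _ _ _ (hMu y (- z) t ltac:(lra) t0) (Rle_abs Mu)];
      [have := Rmult_le_compat_l (/ mu) _ _ ltac:(lra) q1
      |have := Rmult_le_compat_l (/ nu) _ _ ltac:(lra) q1]; lra)
    ltac:(case=> y z z0; rewrite /folded; apply: Rmult_le_pos; try lra;
      [rewrite iv //; exact: v0p|rewrite iu; [apply: u0p|]; lra])
    ltac:(case: ne => -[y [z [z0 ne]]];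
      [exists false, y, (- z); split; [lra|rewrite /folded Ropp_involutive iu //]
      |exists true, y, z; split; [lra|rewrite /folded iv //]];
      apply: Rmult_integral_contrapositive_currified => //; lra)
    tau K tau0 K0.
  exists T => t Tt; split=> y z z0 hy hz.
  - have := hT false y (- z) t Tt hy ltac:(rabs).
    rewrite /folded /U Ropp_involutive => q1.
    rewrite (_ : u y z t - _ = nu * (/ nu * u y z t - A false (- z))); last by field; lra.
    rewrite Rabs_mult (Rabs_right nu); last lra.
    have := Rmult_lt_compat_l nu _ _ hnu (Rlt_le_trans _ _ _ q1 (Rmin_r _ _)).
    by rewrite (_ : nu * (eps / nu) = eps); [|field; lra].
  - have := hT true y z t Tt hy ltac:(rabs).
    rewrite /folded /V => q1.
    rewrite (_ : v y z t - _ = mu * (/ mu * v y z t - A true z)); last by field; lra.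
    rewrite Rabs_mult (Rabs_right mu); last lra.
    have := Rmult_lt_compat_l mu _ _ hmu (Rlt_le_trans _ _ _ q1 (Rmin_l _ _)).
    by rewrite (_ : mu * (eps / mu) = eps); [|field; lra].
exists U, V; split; last split=> //; last first.
  move=> U' V' st; have [ini sol] := steady_is_solution N _ _ _ _ _ _ _ _ st.
  have cv := conv _ _ _ _ ini sol.
  have small x y : (forall eps, 0 < eps -> Rabs (x - y) < eps) -> x = y.
    move=> hs; apply: NNPP => ne.
    have : 0 < Rabs (x - y) by apply: Rabs_pos_lt; lra.
    by move=> q1; have := hs _ q1; lra.
  split=> z z0; apply: small => eps eps0.
  - have [T hT] := cv (Rabs z + 1) eps ltac:(have := Rabs_pos z; lra) eps0.
    apply: (proj1 (hT T (Rle_refl T)) (fun _ => 0)) => //; last lra.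
    by move=> i; rewrite Rabs_R0; have := Rabs_pos z; lra.
  - have [T hT] := cv (Rabs z + 1) eps ltac:(have := Rabs_pos z; lra) eps0.
    apply: (proj2 (hT T (Rle_refl T)) (fun _ => 0)) => //; last lra.
    by move=> i; rewrite Rabs_R0; have := Rabs_pos z; lra.
have scA b z : 0 <= z -> - Df b * (sc b * (- ht b (A b z) / Df b)) = (if b then f else g) (sc b * A b z).
  move=> z0; rewrite hth; last exact: Ain.
  by rewrite /h /rescale; field; split; [have := sc0 b|have := D0 b]; lra.
have fluxF : D * speed D (ht false) (e false) (p false) = mu * (p true - p false).
  have := hflux false => /= ->.
  by rewrite /kap /Df; field; lra.
have fluxT : d * speed d (ht true) (e true) (p true) = nu * (p false - p true).
  have := hflux true => /= ->.
  by rewrite /kap /Df; field; lra.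
split.
  move=> z z0; exists (nu * (- ht false (A false (- z)) / D)); split.
    apply: (second_deriv_reflect (fun s => nu * A false s)).
    exact: (proj1 (is_profile_scaled _ _ _ _ _ _ _ (hA false))).
  exact: (scA false (- z) ltac:(lra)).
split.
  move=> z z0; exists (mu * (- ht true (A true z) / d)); split; last exact: (scA true z ltac:(lra)).
  exact: (proj1 (is_profile_scaled _ _ _ _ _ _ _ (hA true))).
split.
  exists (nu * speed D (ht false) (e false) (p false)); split.
    apply: is_derive_lderiv; evar_last.
      apply: (is_derive_comp (fun s => nu * A false s) Ropp).
        exact: (proj2 (is_profile_scaled _ _ _ _ _ _ _ (hA false))).
      by apply: (is_derive_opp (fun z => z)); apply: is_derive_id.
    by rewrite /scal /= /mult /= /opp /one /= Ropp_0 A0 /Df; ring.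
  rewrite /U /V Ropp_0 !A0.
  have -> : D * (nu * speed D (ht false) (e false) (p false)) =
    nu * (D * speed D (ht false) (e false) (p false)) by ring.
  by rewrite fluxF; ring.
split.
  exists (mu * - speed d (ht true) (e true) (p true)); split.
    apply: is_derive_rderiv; rewrite -A0.
    exact: (proj2 (is_profile_scaled _ _ _ _ _ _ _ (hA true))).
  rewrite /U /V Ropp_0 !A0.
  have -> : - d * (mu * - speed d (ht true) (e true) (p true)) =
    mu * (d * speed d (ht true) (e true) (p true)) by ring.
  by rewrite fluxT; ring.
split; first by move=> z z0; apply: Rmult_lt_0_compat => //; have := Ain false (- z) ltac:(lra); lra.
split; first by move=> z z0; apply: Rmult_lt_0_compat => //; have := Ain true z z0; lra.
split.
- exists (nu * hi) => z z0; apply: Rmult_le_compat_l; first lra.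
  by have := Ain false (- z) ltac:(lra); lra.
- exists (mu * hi) => z z0; apply: Rmult_le_compat_l; first lra.
  by have := Ain true z z0; lra.
Qed.
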